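(* Suppose $\beta_1,\beta_2,R,X,Z$ satisfy assumptions A1–A5 of the two-block model. Let $\hat h_q^s$ and $\hat h_q^d$ be the GPS estimators computed from $R_2$ (single, current block) and from $R=[R_1\,R_2]$ (double block), respectively. Let $h_1$ and $h_2$ be the PCA estimators of $R_1$ and $R_2$, let $L=L_p=\mathrm{span}\{h_1,q\}$, and let $$\hat h_L=\frac{\tau_ph_2+\mathrm{proj}_L(h_2)}{\|\tau_ph_2+\mathrm{proj}_L(h_2)\|},\qquad \tau_p=\frac{\psi_p^2-\|\mathrm{proj}_L(h_2)\|^2}{1-\psi_p^2},$$ where $\psi_p$ is computed from the current block $R_2$. Then, almost surely: (a) $\lim_{p\to\infty}\big(\|\hat h_L-b_2\|-\|\hat h_q^s-b_2\|\big)\le0$ and $\lim_{p\to\infty}\big(\|\hat h_L-b_2\|-\|\hat h_q^d-b_2\|\big)\le0$. (b) If $0<|\rho_\infty(\beta_1,\beta_2)|<1$ almost surely, then $\lim_{p\to\infty}\big(\|\hat h_L-b_2\|-\|\hat h_q^s-b_2\|\big)<0$ and $\lim_{p\to\infty}\big(\|\hat h_L-b_2\|-\|\hat h_q^d-b_2\|\big)<0$.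
   Context: Two-block model. Fix $n\ge2$. Let $\beta_1,\beta_2$ be random real sequences, $X=(X_1,X_2)$ with $X_1,X_2\in\mathbb{R}^n$ random vectors, and $Z=[Z_1\,Z_2]$ a random array with rows indexed by $i\ge1$ and $2n$ columns ($n$ in each block). For each $p$, truncating to the first $p$ entries/rows (superscripts $p$ suppressed), $R_t=\beta_tX_t^T+Z_t\in\mathbb{R}^{p\times n}$, $t=1,2$, and $R=[R_1\,R_2]\in\mathbb{R}^{p\times2n}$. For a sequence $\beta$ put $\mu_p(\beta)=\frac1p\sum_{i\le p}\beta(i)$, $d_p(\beta)^2=\frac1p\sum_{i\le p}\big(\frac{\beta(i)}{\mu_p(\beta)}-1\big)^2$, and $$d_p(\beta_1,\beta_2)=\frac1p\sum_{i=1}^p\Big(\frac{\beta_1(i)}{\mu_p(\beta_1)}-1\Big)\Big(\frac{\beta_2(i)}{\mu_p(\beta_2)}-1\Big),\qquad \rho_p(\beta_1,\beta_2)=\frac{d_p(\beta_1,\beta_2)}{d_p(\beta_1)d_p(\beta_2)}.$$ A subscript $\infty$ denotes the limit as $p\to\infty$. A1: for each $t$, the $\beta_t(i)$ are uniformly bounded independent random variables, and $\mu_p(\beta_t)$, $d_p(\beta_t)$ converge (almost surely) to limits $\mu_\infty(\beta_t)\in(0,\infty)$, $d_\infty(\beta_t)\in(0,\infty)$. A2: $(\beta_1,\beta_2)$, $X$, $Z$ are jointly independent. A3: the $2n$ entries of $X$ are iid with mean zero and variance $\sigma^2>0$; $X_1\ne0$ and $X_2\neq0$ almost surely. A4: the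 entries of $Z$ have mean zero, variance $\delta^2\in(0,\infty)$ and uniformly bounded fourth moments; the $2n$-dimensional rows of $Z$ are mutually independent, and within each row the entries are pairwise uncorrelated. A5: almost surely, $(\beta_1,\beta_2)>0$ (inner product of the $p$-truncations, for every $p$), $\mu_\infty(\beta_1)=\mu_\infty(\beta_2)$, $d_\infty(\beta_1)=d_\infty(\beta_2)$, and $\lim_{p}d_p(\beta_1,\beta_2)=d_\infty(\beta_1,\beta_2)$ exists. Notation. $b_t=\beta_t/\|\beta_t\|$ (for the $p$-truncations), $q=(1,\dots,1)/\sqrt p$. For a returns matrix $Y\in\mathbb{R}^{p\times m}$ ($m=n$ for $R_1,R_2$; $m=2n$ for $R$), the PCA estimator of $Y$ is a unit eigenvector $h$ of $\frac1mYY^T$ for its largest eigenvalue $s^2$, with sign chosen so that $(h,q)\ge0$; $l^2=\big(\mathrm{tr}(\frac1mYY^T)-s^2\big)/(m-1)$ is the average of the $m-1$ remaining nonzero eigenvalues; and $\psi=\sqrt{(s^2-l^2)/s^2}$. The GPS estimator of $Y$ is $$\hat h_q=\frac{\tau h+(h,q)q}{\|\tau h+(h,q)q\|},\qquad \tau=\frac{\psi^2-(h,q)^2}{1-\psi^2},$$ with $h$ and $\psi$ computed from $Y$. $\mathrm{proj}_L$ is orthogonal projection onto $L$; if $L\perp h_2$ then $\hat h_L=h_2$.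
   Formalization: The two claims about the double-block estimator are made only off the event that d_∞(β1,β2) = −1 and |X_1| = |X_2|, where the top eigenvalue of the limiting Gram matrix of R is double and the limit can fail to exist. *)

(* Defs.v *)
From HB Require Import structures.
From mathcomp Require Import all_boot all_order all_algebra.
From mathcomp Require Import finmap.
From mathcomp Require Import all_classical all_reals all_analysis.
Set Implicit Arguments.
Unset Strict Implicit.
Unset Printing Implicit Defensive.
Import Order.TTheory GRing.Theory Num.Theory.
Import numFieldNormedType.Exports.

Local Open Scope classical_set_scope.
Local Open Scope ring_scope.

(** * Euclidean geometry of row vectors *)

(* Vectors of R^p are row vectors. The norm that MathComp-Analysis puts on
   matrices is the sup norm, hence the separate Euclidean norm [enorm]. *)

Section euclid.
Context {R : realType}.

Definition dotv p (u v : 'rV[R]_p) : R := (u *m v^T) 0 0.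

Definition enorm p (u : 'rV[R]_p) : R := Num.sqrt (dotv u u).

Definition normalize p (u : 'rV[R]_p) : 'rV[R]_p := (enorm u)^-1 *: u.

(* Projection onto the row space of [A] along [kermx A^T], whose row space is
   the orthogonal complement of that of [A]; see [oprojP]. *)
Definition oproj k p (A : 'M[R]_(k, p)) (x : 'rV[R]_p) : 'rV[R]_p :=
  x *m proj_mx <<A>>%MS (kermx A^T).

Lemma dotv_eq0 p (u : 'rV[R]_p) : dotv u u = 0 -> u = 0.
Proof.
rewrite /dotv mxE => /eqP; rewrite psumr_eq0; last first.
  by move=> i _; rewrite mxE -expr2 sqr_ge0.
move=> /allP u0; apply/rowP => i; rewrite mxE.
by have := u0 i (mem_index_enum i); rewrite mxE mulf_eq0 orbb => /eqP.
Qed.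

Lemma oprojP k p (A : 'M[R]_(k, p)) (x : 'rV[R]_p) :
  (oproj A x <= A)%MS /\
  forall w : 'rV[R]_p, (w <= A)%MS -> dotv (x - oproj A x) w = 0.
Proof.
have orthA (u w : 'rV[R]_p) :
    (u <= kermx A^T)%MS -> (w <= A)%MS -> u *m w^T = 0.
  move=> /sub_kermxP uA /submxP[D ->].
  by rewrite trmx_mul mulmxA uA mul0mx.
have cap0 : (<<A>> :&: kermx A^T)%MS = 0.
  apply/eqP; rewrite -submx0; apply/row_subP => i.
  have := row_sub i (<<A>> :&: kermx A^T)%MS.
  rewrite sub_capmx genmxE => /andP[rA rK].
  by rewrite (dotv_eq0 (u := row i _)) ?sub0mx// /dotv (orthA _ _ rK rA) mxE.
have full : (x <= <<A>> + kermx A^T)%MS.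
  apply: submx_full; rewrite /row_full; apply/eqP.
  rewrite mxrank_disjoint_sum// mxrank_ker mxrank_tr genmxE subnKC//.
  exact: rank_leq_col.
split; first by rewrite /oproj (submx_trans (proj_mx_sub _ _ _))// genmxE.
move=> w wA; rewrite /dotv (orthA _ _ _ wA) ?mxE//.
exact: proj_mx_compl_sub.
Qed.

End euclid.

(** * Statistics of a sequence of factor loadings *)

(* Sequences indexed by [i >= 1] are shifted to start at 0, so that the
   truncation at [p] keeps the indices [i < p]. *)

Section loadings.
Context {R : realType}.
Implicit Types a b : nat -> R.

Definition trunc p b : 'rV[R]_p := \row_(i < p) b i.

Definition mu_ b (p : nat) : R := p%:R^-1 * \sum_(i < p) b i.

Definition dcov a b (p : nat) : R :=
  p%:R^-1 * \sum_(i < p) (a i / mu_ a p - 1) * (b i / mu_ b p - 1).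

Definition d_ b (p : nat) : R := Num.sqrt (dcov b b p).

Definition rho_ a b (p : nat) : R := dcov a b p / (d_ a p * d_ b p).

End loadings.

(** * PCA, GPS and two-anchor estimators *)

Section estimators.
Context {R : realType}.

Definition qvec p : 'rV[R]_p := const_mx (Num.sqrt p%:R)^-1.

Definition scov p m (Y : 'M[R]_(p, m)) : 'M[R]_p := m%:R^-1 *: (Y *m Y^T).

(* The set is finite, and nonempty for [p > 0] as [scov Y] is symmetric, so the
   supremum is the largest eigenvalue. *)
Definition s2 p m (Y : 'M[R]_(p, m)) : R := sup [set a | eigenvalue (scov Y) a].

Definition l2 p m (Y : 'M[R]_(p, m)) : R := (\tr (scov Y) - s2 Y) / (m%:R - 1).

Definition psi p m (Y : 'M[R]_(p, m)) : R := Num.sqrt ((s2 Y - l2 Y) / s2 Y).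

(* A relation and not a function, since the eigenvector need not be unique. As
   [scov Y] is symmetric, row eigenvectors ([h *m S = a *: h]) and column
   eigenvectors are the same. *)
Definition is_pca p m (Y : 'M[R]_(p, m)) (h : 'rV[R]_p) : Prop :=
  [/\ (h <= eigenspace (scov Y) (s2 Y))%MS, enorm h = 1 & 0 <= dotv h (qvec p)].

Definition gps p m (Y : 'M[R]_(p, m)) (h : 'rV[R]_p) : 'rV[R]_p :=
  let c := dotv h (qvec p) in
  let tau := (psi Y ^+ 2 - c ^+ 2) / (1 - psi Y ^+ 2) in
  normalize (tau *: h + c *: qvec p).

(* [L] is the row space of [A]; [h] is the PCA estimator of [Y]. *)
Definition maps p m k (A : 'M[R]_(k, p)) (Y : 'M[R]_(p, m)) (h : 'rV[R]_p) :
    'rV[R]_p :=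
  let u := oproj A h in
  let tau := (psi Y ^+ 2 - enorm u ^+ 2) / (1 - psi Y ^+ 2) in
  if u == 0 then h else normalize (tau *: h + u).

End estimators.

(** * Independence *)

Section independence.
Context d (T : measurableType d) (R : realType) (P : probability T R).

Definition sigma_rv (I : Type) (X : I -> T -> R) : set (set T) :=
  <<s \bigcup_i preimage_set_system setT (X i) measurable >>.

Definition mutual_indep (I : choiceType) (F : I -> set (set T)) : Prop :=
  forall (J : {fset I}) (A : I -> set T), (forall i, i \in J -> F i (A i)) ->
    P (\bigcap_(i in [set` J]) A i) = (\prod_(i <- J) P (A i))%E.

Definition indep3 (F G H : set (set T)) : Prop :=
  forall A B C, F A -> G B -> H C ->
    P (A `&` B `&` C) = (P A * P B * P C)%E.

End independence.

(** * The two-block model *)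

(* The blocks t = 1, 2. *)
Definition blk1 : 'I_2 := ord0.
Definition blk2 : 'I_2 := ord_max.

Section model.
Context d (T : measurableType d) (R : realType) (P : probability T R) (n : nat).
Variable beta : 'I_2 -> nat -> {RV P >-> R}.
Variable X : 'I_2 -> 'I_n -> {RV P >-> R}.
Variable Z : nat -> 'I_2 -> 'I_n -> {RV P >-> R}.

Definition beta_path t (w : T) : nat -> R := fun i => beta t i w.

Definition Xvec t (w : T) : 'rV[R]_n := \row_j X t j w.

Definition Rblk t (w : T) p : 'M[R]_(p, n) :=
  (trunc p (beta_path t w))^T *m Xvec t w + \matrix_(i < p, j < n) Z i t j w.

Definition Rfull (w : T) p : 'M[R]_(p, n + n) :=
  row_mx (Rblk blk1 w p) (Rblk blk2 w p).

Definition assumption1 : Prop :=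
  [/\ exists M : R, forall t i, {ae P, forall w, `|beta t i w| <= M},
      forall t, mutual_indep P (fun i => sigma_rv (fun _ : unit => beta t i)) &
      {ae P, forall w, forall t,
        [/\ cvgn (mu_ (beta_path t w)), 0 < limn (mu_ (beta_path t w)),
            cvgn (d_ (beta_path t w)) & 0 < limn (d_ (beta_path t w))]}].

Definition assumption2 : Prop :=
  indep3 P (sigma_rv (fun k : 'I_2 * nat => beta k.1 k.2))
           (sigma_rv (fun k : 'I_2 * 'I_n => X k.1 k.2))
           (sigma_rv (fun k : nat * 'I_2 * 'I_n => Z k.1.1 k.1.2 k.2)).

Definition assumption3 (sigma : R) : Prop :=
  [/\ mutual_indep P
        (fun k : 'I_2 * 'I_n => sigma_rv (fun _ : unit => X k.1 k.2)),
      forall (k k' : 'I_2 * 'I_n) (B : set R), measurable B ->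
        distribution P (X k.1 k.2) B = distribution P (X k'.1 k'.2) B,
      forall t j, ('E_P[X t j] = 0)%E,
      forall t j, ('V_P[X t j] = (sigma ^+ 2)%:E)%E &
      {ae P, forall w, forall t, Xvec t w != 0}].

Definition assumption4 (delta : R) : Prop :=
  [/\ forall i t j, ('E_P[Z i t j] = 0)%E,
      forall i t j, ('V_P[Z i t j] = (delta ^+ 2)%:E)%E,
      exists K : R, forall i t j,
        ('E_P[fun w => (Z i t j w ^+ 4)%R] <= K%:E)%E,
      mutual_indep P
        (fun i : nat => sigma_rv (fun k : 'I_2 * 'I_n => Z i k.1 k.2)) &
      forall i (k k' : 'I_2 * 'I_n), k != k' ->
        covariance P (Z i k.1 k.2) (Z i k'.1 k'.2) = 0%E].

Definition assumption5 : Prop :=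
  {ae P, forall w,
    let b1 := beta_path blk1 w in let b2 := beta_path blk2 w in
    [/\ forall p, (0 < p)%N -> 0 < dotv (trunc p b1) (trunc p b2),
        limn (mu_ b1) = limn (mu_ b2),
        limn (d_ b1) = limn (d_ b2) &
        cvgn (dcov b1 b2)]}.

(* Gram matrix computations give [R^T R / p -> mu^2 (1 + d^2) M + delta^2 I],
   where M has the diagonal blocks [X_t^T X_t] and the off-diagonal block
   [(1 + dcov) / (1 + d^2) X_1^T X_2]. Its top eigenvalue is double exactly
   when [dcov = -1] and [|X_1| = |X_2|]; on that event the PCA direction of the
   double block is driven by the noise and need not converge: for [n = 2],
   deterministic [beta_1], [beta_2] with values 3, 0, 0, 3, 0, 0, ... and
   0, 3, 0, 0, 3, 0, ... (first terms replaced by 1), Rademacher X and Gaussian Z,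
   [gap_double] diverges almost surely. *)
Definition double_degenerate (w : T) : Prop :=
  limn (dcov (beta_path blk1 w) (beta_path blk2 w)) = -1 /\
  enorm (Xvec blk1 w) = enorm (Xvec blk2 w).

(* [h t p] and [hR p] range over all PCA estimators of [R_t] and of [R]. There
   is no unit vector for [p = 0], which is therefore left out. *)
Definition pca_choice (w : T) (h : 'I_2 -> forall p, 'rV[R]_p)
    (hR : forall p, 'rV[R]_p) : Prop :=
  forall p, (0 < p)%N ->
    (forall t, is_pca (Rblk t w p) (h t p)) /\ is_pca (Rfull w p) (hR p).

Definition err (w : T) p (v : 'rV[R]_p) : R :=
  enorm (v - normalize (trunc p (beta_path blk2 w))).

Definition hL (w : T) (h : 'I_2 -> forall p, 'rV[R]_p) p : 'rV[R]_p :=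
  maps (col_mx (h blk1 p) (qvec p)) (Rblk blk2 w p) (h blk2 p).

Definition gap_single (w : T) (h : 'I_2 -> forall p, 'rV[R]_p) (p : nat) : R :=
  err w (hL w h p) - err w (gps (Rblk blk2 w p) (h blk2 p)).

Definition gap_double (w : T) (h : 'I_2 -> forall p, 'rV[R]_p)
    (hR : forall p, 'rV[R]_p) (p : nat) : R :=
  err w (hL w h p) - err w (gps (Rfull w p) (hR p)).

End model.

(* Main.v *)
(* After division by p, everything that enters PCA of a returns matrix Y is read
   off the Gram matrix Y^T Y / p. By a strong law for uncorrelated variables with
   bounded second moments, that Gram matrix converges almost surely to
   (signal) + delta^2 I, whose top eigenvalue is simple off the degenerate event.
   Hence every inner product between PCA directions, q and b_2 converges, as if
   h_t = psi_t b_t + e_t with noise e_t orthogonal to everything else and to each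
   other, and the PCA direction of the double block becomes a combination of h_1
   and h_2.

   In the limit, the two-anchor estimator is the normalized projection of b_2 on
   span {h_1, h_2, q}, while both GPS estimators lie in that span: this gives the
   weak inequalities. Against the single block the inequality is strict as soon as
   h_1 has a component along b_2 orthogonal to q, i.e. as the correlation is not
   zero. Against the double block, equality would force the coefficients of h_1 and
   h_2 in the projection to be proportional to the top eigenvector of the signal,
   and the shrinkage of the double block to be optimal in span {h, q}; the two
   conditions contradict each other when the correlation is not 0 or 1 in absolute
   value. *)

(* PCA directions live in dimension [p], which grows, and are only known up to the choice of an
   eigenvector, so no limit theorem applies to them directly. What converges are their scores
   [p^(-1/2) h Y] in the fixed dimension [m]; there a Rayleigh quotient estimate with the spectral
   gap takes the place of eigenvector perturbation theory. The convention [(h, q) >= 0] fixes the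
   sign, since the limiting score of [q] has a positive inner product with the top eigenvector. The
   shrinkage constants separate the estimators. A single block has one signal eigenvalue, so its
   rescaled [l^2] tends to the noise variance and the shrinkage is optimal for the given direction
   and anchors. Two blocks have two signal eigenvalues, and [l^2] averages the smaller one in as
   noise; the sign of that bias is what makes the two equality conditions incompatible. Randomness
   enters only through strong laws for finitely many columns and pairs of columns. The remainder
   holds for each fixed outcome, so one null set serves all choices of eigenvectors. *)
Require Import Defs.
From mathcomp Require Import all_boot all_order all_algebra.
From mathcomp Require Import finmap.
From mathcomp Require Import all_classical all_reals all_analysis.
From mathcomp Require Import measurable_realfun ring lra zify.
Set Implicit Arguments.
Unset Strict Implicit.
Unset Printing Implicit Defensive.
Import Order.TTheory GRing.Theory Num.Theory.
Import numFieldNormedType.Exports.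
Local Open Scope classical_set_scope.
Local Open Scope ring_scope.

(** * Limit angles *)

(* [Psi] is the limit of [psi ^+ 2] and [G] that of the squared length of the
   projection of [b_2] on the anchor space [L] ([L] is spanned by [q] for GPS). *)
Definition gps_tau (F : realFieldType) (Psi G : F) := (Psi - Psi * G) / (1 - Psi).

Definition gps_cos2 (F : realFieldType) (Psi G : F) :=
  (gps_tau Psi G + G) / (gps_tau Psi G + 1).

Section gps_cosine.
Variable F : realFieldType.

Lemma gps_tau_ge0 (Psi G : F) : 0 < Psi < 1 -> G <= 1 -> 0 <= gps_tau Psi G.
Proof.
move=> /andP[P0 P1] G1; rewrite /gps_tau divr_ge0 ?subr_ge0 ?(ltW P1)//.
by rewrite ler_piMr ?(ltW P0).
Qed.

Lemma gps_cos2_le1 (Psi G : F) : 0 < Psi < 1 -> G <= 1 -> gps_cos2 Psi G <= 1.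
Proof.
move=> P01 G1; have t0 := gps_tau_ge0 P01 G1.
by rewrite /gps_cos2 ler_pdivrMr ?mul1r ?lerD2l// ltr_wpDl.
Qed.

(** With [h] equal to [psi] times [b_2] plus orthogonal noise, the residuals off the anchors have
    squared lengths [1 - G] for [b_2] and [1 - Psi * G] for [h], and inner product [psi * (1 - G)].
    The right side is therefore the squared length of the projection of [b_2] on the span of the
    anchors and [h]. *)
Lemma gps_cos2E (Psi G : F) : 0 < Psi < 1 -> G <= 1 ->
  gps_cos2 Psi G = 1 - (1 - G) * (1 - Psi) / (1 - Psi * G).
Proof.
move=> /andP[P0 P1] G1; rewrite /gps_cos2 /gps_tau.
have h1 : 1 - Psi != 0 by apply: lt0r_neq0; rewrite subr_gt0.
have h2 : 1 - Psi * G != 0.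
  apply: lt0r_neq0; rewrite subr_gt0 (le_lt_trans _ P1)//.
  by rewrite ler_piMr ?(ltW P0).
by field; rewrite h1 h2.
Qed.

Lemma gps_cos2_le (Psi G G' : F) : 0 < Psi < 1 -> G' <= 1 -> G <= G' ->
  gps_cos2 Psi G <= gps_cos2 Psi G'.
Proof.
move=> P01 G'1 GG'; have G1 := le_trans GG' G'1.
rewrite !gps_cos2E//; move: P01 => /andP[P0 P1].
have h0 : 0 < 1 - Psi * G by nra.
have h1 : 0 < 1 - Psi * G' by nra.
rewrite lerD2l lerN2 ler_pdivlMr// mulrAC ler_pdivrMr// -subr_ge0.
rewrite (_ : _ - _ = (1 - Psi) ^+ 2 * (G' - G)); last by ring.
by rewrite mulr_ge0 ?sqr_ge0 ?subr_ge0.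
Qed.

Lemma gps_cos2_lt (Psi G G' : F) : 0 < Psi < 1 -> G' <= 1 -> G < G' ->
  gps_cos2 Psi G < gps_cos2 Psi G'.
Proof.
move=> P01 G'1 GG'; have G1 := le_trans (ltW GG') G'1.
rewrite !gps_cos2E//; move: P01 => /andP[P0 P1].
have h0 : 0 < 1 - Psi * G by nra.
have h1 : 0 < 1 - Psi * G' by nra.
rewrite ltrD2l ltrN2 ltr_pdivlMr// mulrAC ltr_pdivrMr// -subr_gt0.
rewrite (_ : _ - _ = (1 - Psi) ^+ 2 * (G' - G)); last by ring.
by rewrite mulr_gt0 ?exprn_gt0 ?subr_gt0.
Qed.

End gps_cosine.

(* With [b_t] the normalized loadings: [g = (b_t, q)], [r = (b_1, b_2)],
   [D_t ^+ 2] is the signal eigenvalue of block [t], [v] the noise variance,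
   [(k1, k2)] the top eigenvector of the 2 x 2 signal matrix of the double block,
   [Lam > Lam2] its eigenvalues, [L ^+ 2] the top eigenvalue of the Gram limit and
   [nu = 1 / (2 n - 1)]. [N / sqrt Q] is the cosine of the double-block GPS
   estimator with [b_2]. After projecting [q] out, the Gram matrix of the block
   directions is [M], and [w] solves the normal equations for [b_2]; [K] is the
   squared length of the projection of [b_2] on the span of both blocks and [q]. *)
Section double_block_cosine.
Variable F : realFieldType.
Variables (s rho D1 D2 v k1 k2 Lam g L nu : F).
Hypotheses (s01 : 0 < s < 1) (rho1 : rho ^+ 2 <= 1) (D1p : 0 < D1) (D2p : 0 < D2).
Hypotheses (vp : 0 < v) (k1p : 0 <= k1) (k2p : 0 <= k2) (k12 : k1 ^+ 2 + k2 ^+ 2 = 1).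
Hypotheses (gp : 0 < g) (g2 : g ^+ 2 = 1 - s) (Lp : 0 < L) (L2 : L ^+ 2 = Lam + v).
Let r := s * rho + (1 - s).
Hypotheses (e1 : D1 ^+ 2 * k1 + r * D1 * D2 * k2 = Lam * k1).
Hypotheses (e2 : r * D1 * D2 * k1 + D2 ^+ 2 * k2 = Lam * k2).
Let Lam2 := D1 ^+ 2 + D2 ^+ 2 - Lam.
Hypotheses (Lam2p : 0 <= Lam2) (Lamp : 0 < Lam) (nup : 0 <= nu).
Let c := g * (k1 * D1 + k2 * D2) / L.
Let hb := (k1 * r * D1 + k2 * D2) / L.
Let Psi := (Lam - nu * Lam2) / L ^+ 2.
Let tau := (Psi - c ^+ 2) / (1 - Psi).
Let N := tau * hb + c * g.
Let Q := tau ^+ 2 + 2 * tau * c ^+ 2 + c ^+ 2.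
Let Psi1 := D1 ^+ 2 / (D1 ^+ 2 + v).
Let Psi2 := D2 ^+ 2 / (D2 ^+ 2 + v).
Let GL := g ^+ 2 + Psi1 * (r - g ^+ 2) ^+ 2 / (1 - Psi1 * g ^+ 2).
Let M11 := D1 ^+ 2 * s + v.
Let M12 := D1 * D2 * s * rho.
Let M22 := D2 ^+ 2 * s + v.
Let Delta := M11 * M22 - M12 ^+ 2.
Let w1 := D1 * s * rho * v / Delta.
Let w2 := D2 * s * (v + D1 ^+ 2 * s * (1 - rho ^+ 2)) / Delta.
Let E := (k1 * D1 * s * rho + k2 * D2 * s) / L.
Let m := 1 - c ^+ 2.
Let K := g ^+ 2 + w1 * (D1 * s * rho) + w2 * (D2 * s).

Let DeltaE : Delta = v ^+ 2 + v * s * (D1 ^+ 2 + D2 ^+ 2)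
  + D1 ^+ 2 * D2 ^+ 2 * s ^+ 2 * (1 - rho ^+ 2).
Proof. rewrite /Delta /M11 /M12 /M22; ring. Qed.

Let Delta_gt0 : 0 < Delta.
Proof.
rewrite DeltaE; move: s01 => /andP[s0 s1].
have : 0 <= D1 ^+ 2 * D2 ^+ 2 * s ^+ 2 * (1 - rho ^+ 2).
  by rewrite !mulr_ge0 ?subr_ge0 ?exprn_ge0 // ltW.
have : 0 < v ^+ 2 by rewrite exprn_gt0.
have : 0 <= v * s * (D1 ^+ 2 + D2 ^+ 2).
  by rewrite !mulr_ge0 ?addr_ge0 ?exprn_ge0 // ltW.
lra.
Qed.

Let M11_gt0 : 0 < M11.
Proof. by rewrite /M11 ltr_wpDl// mulr_ge0 ?exprn_ge0// ltW//; case/andP: s01. Qed.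

Let DDv (x : F) : 0 < x -> 0 < x ^+ 2 + v.
Proof. by move=> x0; rewrite addr_gt0 ?exprn_gt0. Qed.

Let Psi01 (x : F) : 0 < x -> 0 < x ^+ 2 / (x ^+ 2 + v) < 1.
Proof.
move=> x0; have h := DDv x0.
by rewrite divr_gt0 ?exprn_gt0//= ltr_pdivrMr// mul1r ltrDl.
Qed.

Let GLE : GL = (1 - s) + D1 ^+ 2 * s ^+ 2 * rho ^+ 2 / M11.
Proof.
rewrite /GL /Psi1 g2 (_ : r - (1 - s) = s * rho); last by rewrite /r; ring.
have h := lt0r_neq0 (DDv D1p); have h' := lt0r_neq0 M11_gt0.
rewrite /M11 in h' *.
by field; rewrite h' h.
Qed.

Lemma anchor2_le1 : GL <= 1.
Proof.
rewrite GLE -lerBrDl opprB addrC subrK ler_pdivrMr// /M11.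
move: s01 => /andP[s0 s1].
have : 0 <= D1 ^+ 2 * s ^+ 2 * (1 - rho ^+ 2).
  by rewrite !mulr_ge0 ?subr_ge0 ?exprn_ge0 // ltW.
have : 0 < s * v by rewrite mulr_gt0.
nra.
Qed.

(** One Gram-Schmidt step, adding [h_2] to the span of [h_1] and [q], gives the same squared length
    as solving the normal equations for [h_1] and [h_2] together. *)
Let gps_cos2_GL : gps_cos2 Psi2 GL = K.
Proof.
rewrite gps_cos2E ?Psi01 ?anchor2_le1// GLE /Psi2 /K /w1 /w2 g2.

have h2 := lt0r_neq0 (DDv D2p); have h' := lt0r_neq0 M11_gt0.
have hD := lt0r_neq0 Delta_gt0.
set G := 1 - s + D1 ^+ 2 * s ^+ 2 * rho ^+ 2 / M11.
(* [y] is the squared distance from [b_2] to the span of [h_1] and [q]. *)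
pose y := 1 - G; rewrite -/y.
have yE : y = s * (v + D1 ^+ 2 * s * (1 - rho ^+ 2)) / M11.
  by rewrite /y /G /M11; rewrite /M11 in h'; field.
have -> : y * (1 - D2 ^+ 2 / (D2 ^+ 2 + v)) / (1 - D2 ^+ 2 / (D2 ^+ 2 + v) * G) =
     y * v / (D2 ^+ 2 * y + v).
  have h4 : D2 ^+ 2 * y + v != 0.
    have : 0 <= y by rewrite subr_ge0 /G -GLE anchor2_le1.
    by move=> y0; rewrite gt_eqF// ltr_wpDl// mulr_ge0// exprn_ge0// ltW.
  by move: h4; rewrite (_ : G = 1 - y) => [h4|]; [field; rewrite h4 h2|rewrite /y; ring].
(* This is the Schur complement of [M11] in [M]. *)
have -> : D2 ^+ 2 * y + v = Delta / M11.
  rewrite yE /Delta /M12 /M22; move: h'; rewrite /M11 => h'; by field.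
have -> : y * v / (Delta / M11) = s * v * (v + D1 ^+ 2 * s * (1 - rho ^+ 2)) / Delta.
  by rewrite yE; field; rewrite hD h'.
apply/eqP; rewrite -subr_eq0; apply/eqP.
set z := v + D1 ^+ 2 * s * (1 - rho ^+ 2).
transitivity ((s * Delta - s * v * z - D1 ^+ 2 * s ^+ 2 * rho ^+ 2 * v
    - D2 ^+ 2 * s ^+ 2 * z) / Delta); first by field.
by rewrite DeltaE /z [X in X / _](_ : _ = 0) ?mul0r//; ring.
Qed.

(** [L] times the double-block direction has coordinates [(k1, k2)] on the unnormalized block
    directions, so its squared length after [q] is projected out is the quadratic form of [M] at
    [(k1, k2)]. *)
Let mE : L ^+ 2 * m = k1 ^+ 2 * M11 + 2 * k1 * k2 * M12 + k2 ^+ 2 * M22.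
Proof.
have Lc : L ^+ 2 * c ^+ 2 = (1 - s) * (k1 * D1 + k2 * D2) ^+ 2.
  by rewrite -g2 /c; field; rewrite gt_eqF.
have LamE : Lam = D1 ^+ 2 * k1 ^+ 2 + 2 * r * D1 * D2 * k1 * k2 + D2 ^+ 2 * k2 ^+ 2.
  have -> : Lam = Lam * k1 * k1 + Lam * k2 * k2 by rewrite -[LHS]mulr1 -k12; ring.
  by rewrite -e1 -e2; ring.
have vE : v = v * k1 ^+ 2 + v * k2 ^+ 2 by rewrite -mulrDr k12 mulr1.
rewrite /m mulrBr mulr1 Lc L2 [in Lam + v]vE LamE /r /M11 /M12 /M22.
ring.
Qed.

Let kM_gt0 : 0 < k1 ^+ 2 * M11 + 2 * k1 * k2 * M12 + k2 ^+ 2 * M22.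
Proof.
have -> : k1 ^+ 2 * M11 + 2 * k1 * k2 * M12 + k2 ^+ 2 * M22 =
   s * ((k1 * D1 + rho * k2 * D2) ^+ 2 + (1 - rho ^+ 2) * (k2 * D2) ^+ 2)
   + v * (k1 ^+ 2 + k2 ^+ 2).
  by rewrite /M11 /M12 /M22; ring.
move: s01 => /andP[s0 s1].
rewrite k12 mulr1 ltr_wpDl// mulr_ge0// ?(ltW s0)// addr_ge0 ?sqr_ge0//.
by rewrite mulr_ge0 ?subr_ge0 ?sqr_ge0.
Qed.

Let m_gt0 : 0 < m.
Proof. by rewrite -(pmulr_rgt0 _ (exprn_gt0 2 Lp)) mE. Qed.

Let rE : r = s * rho + (1 - s). Proof. by []. Qed.

(** [E] is the inner product of the double-block direction with [b_2] after [q] is projected out. *)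
Let hbE : hb = E + c * g.
Proof.
have : c * g = (1 - s) * (k1 * D1 + k2 * D2) / L.
  by rewrite -g2 /c; field; rewrite gt_eqF.
by move=> ->; rewrite /hb /E rE; field; rewrite gt_eqF.
Qed.

Let X1 := k1 * w2 - k2 * w1.
Let X2 := E * c * (1 + tau) - g * tau * m.

(** Lagrange's identity for the form [M]. The right side of the normal equations is [M w], so [m]
    and [E] are, up to powers of [L], the values [(k, M k)] and [(k, M w)]; the Cauchy-Schwarz
    defect is [det M] times the squared determinant of [k] and [w]. *)
Let wmE : (w1 * (D1 * s * rho) + w2 * (D2 * s)) * m - E ^+ 2 =
  Delta / L ^+ 2 * X1 ^+ 2.
Proof.
have hL := lt0r_neq0 Lp; have hD := lt0r_neq0 Delta_gt0.
have -> : m = (k1 ^+ 2 * M11 + 2 * k1 * k2 * M12 + k2 ^+ 2 * M22) / L ^+ 2.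
  by rewrite -mE; field.
have -> : D1 * s * rho = M11 * w1 + M12 * w2.
  rewrite /w1 /w2; apply/eqP; rewrite -subr_eq0; apply/eqP.
  set x := _ - _; have -> : x = (D1 * s * rho * Delta - M11 * (D1 * s * rho * v)
     - M12 * (D2 * s * (v + D1 ^+ 2 * s * (1 - rho ^+ 2)))) / Delta.
    by rewrite /x; field.
  by rewrite DeltaE /M11 /M12 [X in X / _](_ : _ = 0) ?mul0r//; ring.
have e2E : D2 * s = M12 * w1 + M22 * w2.
  rewrite /w1 /w2; apply/eqP; rewrite -subr_eq0; apply/eqP.
  set x := _ - _; have -> : x = (D2 * s * Delta - M12 * (D1 * s * rho * v)
     - M22 * (D2 * s * (v + D1 ^+ 2 * s * (1 - rho ^+ 2)))) / Delta.
    by rewrite /x; field.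
  by rewrite DeltaE /M22 /M12 [X in X / _](_ : _ = 0) ?mul0r//; ring.
have e1E : D1 * s * rho = M11 * w1 + M12 * w2.
  rewrite /w1 /w2; apply/eqP; rewrite -subr_eq0; apply/eqP.
  set x := _ - _; have -> : x = (D1 * s * rho * Delta - M11 * (D1 * s * rho * v)
     - M12 * (D2 * s * (v + D1 ^+ 2 * s * (1 - rho ^+ 2)))) / Delta.
    by rewrite /x; field.
  by rewrite DeltaE /M11 /M12 [X in X / _](_ : _ = 0) ?mul0r//; ring.
rewrite e2E.
have -> : E = (k1 * (M11 * w1 + M12 * w2) + k2 * (M12 * w1 + M22 * w2)) / L.
  by rewrite -e1E -e2E /E; field.
by rewrite /Delta /X1; field.
Qed.

(* The defects of two Cauchy-Schwarz inequalities: [X1] vanishes when the double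
   block has the optimal direction, [X2] when its shrinkage is optimal. *)
Let gapE : K * Q - N ^+ 2 =
  Delta / L ^+ 2 * X1 ^+ 2 * (tau ^+ 2 + c ^+ 2 * (1 + tau) ^+ 2 / m) + X2 ^+ 2 / m.
Proof.
have hm := lt0r_neq0 m_gt0.
rewrite -wmE /X2 /N hbE.
(* Split [tau h + c q] into its part along [q], of coefficient [c (1 + tau)], and [tau] times the
   residual of [h], whose squared length is [m]. *)
have -> : Q = tau ^+ 2 * m + c ^+ 2 * (1 + tau) ^+ 2 by rewrite /Q /m; ring.
rewrite /K -addrA; set W := w1 * _ + _.
by field.
Qed.

Let gap_term_ge0 :
  0 <= Delta / L ^+ 2 * X1 ^+ 2 * (tau ^+ 2 + c ^+ 2 * (1 + tau) ^+ 2 / m).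
Proof.
have hD := ltW Delta_gt0; have hm := ltW m_gt0.
apply: mulr_ge0; first by apply: mulr_ge0 (sqr_ge0 _); rewrite divr_ge0 ?sqr_ge0.
apply: addr_ge0; first exact: sqr_ge0.
by apply: divr_ge0 => //; apply: mulr_ge0; exact: sqr_ge0.
Qed.

Lemma double_le : N ^+ 2 <= gps_cos2 Psi2 GL * Q.
Proof.
rewrite gps_cos2_GL -subr_ge0 gapE addr_ge0//.
by rewrite divr_ge0 ?sqr_ge0// ltW.
Qed.

Let c_gt0 : 0 < c.
Proof.
rewrite divr_gt0// mulr_gt0//.
have [k10|k10] := eqVneq k1 0; last first.
  by rewrite ltr_pwDl ?mulr_gt0 ?mulr_ge0// ?ltW// lt0r k10.
have k2_gt0 : 0 < k2.
  rewrite lt0r k2p andbT; apply/negP => /eqP k20.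
  by move: k12; rewrite k10 k20 !expr0n addr0 => /eqP; rewrite eq_sym oner_eq0.
by rewrite k10 mul0r add0r mulr_gt0.
Qed.

Lemma double_Psi_lt1 : Psi < 1.
Proof.
rewrite ltr_pdivrMr ?exprn_gt0// mul1r L2.
by rewrite ltrD2l (le_lt_trans _ vp)// oppr_le0 mulr_ge0.
Qed.

Lemma double_Q_gt0 : 0 < Q.
Proof.
have -> : Q = tau ^+ 2 * m + c ^+ 2 * (1 + tau) ^+ 2 by rewrite /Q /m; ring.
have [->|t0] := eqVneq tau 0.
  by rewrite expr0n mul0r add0r addr0 expr1n mulr1 exprn_gt0.
rewrite ltr_pwDl//; last by apply: mulr_ge0; exact: sqr_ge0.
by rewrite mulr_gt0// lt0r sqrf_eq0 t0 sqr_ge0.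
Qed.

(** If equality held, [X1 = 0] would make [(k1, k2)] proportional to [w], whence
    [k1 * D2 < rho * k2 * D1]. But [X2 = 0], combined with the second eigenvector equation, gives
    [k2 * D1 <= k1 * D2]. As [rho <= 1], these exclude each other. *)
Lemma double_lt : rho != 0 -> rho ^+ 2 < 1 -> N ^+ 2 < gps_cos2 Psi2 GL * Q.
Proof.
move=> rho0 rho_lt1; rewrite lt_neqAle double_le andbT; apply/negP => /eqP NQ.
have hL := lt0r_neq0 Lp; have hD := lt0r_neq0 Delta_gt0.
have /eqP : K * Q - N ^+ 2 = 0 by rewrite NQ gps_cos2_GL subrr.
rewrite gapE paddr_eq0 ?gap_term_ge0 ?divr_ge0 ?sqr_ge0 ?(ltW m_gt0)//.
have t0 : tau ^+ 2 + c ^+ 2 * (1 + tau) ^+ 2 / m != 0.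
  have h2 : 0 <= c ^+ 2 * (1 + tau) ^+ 2 / m.
    by apply: divr_ge0 (ltW m_gt0); apply: mulr_ge0; exact: sqr_ge0.
  rewrite paddr_eq0 ?sqr_ge0// sqrf_eq0; have [->/=|//] := eqVneq tau 0.
  by rewrite addr0 expr1n mulr1 mulf_neq0 ?invr_eq0 ?sqrf_eq0 ?gt_eqF.
rewrite !(sqrf_eq0, mulf_eq0, invr_eq0) (negPf t0) (negPf hL) (negPf hD) /=.
rewrite (gt_eqF m_gt0) !orbF => /andP[/eqP X10 /eqP X20].
have i1 : k2 * (D1 * rho * v) = k1 * (D2 * (v + D1 ^+ 2 * s * (1 - rho ^+ 2))).
  move: X10; have s0 : s != 0 by case/andP: s01 => s0 _; rewrite gt_eqF.
  have -> : X1 = (s / Delta) * (k1 * (D2 * (v + D1 ^+ 2 * s * (1 - rho ^+ 2)))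
     - k2 * (D1 * rho * v)) by rewrite /X1 /w1 /w2; field.
  have sD : s / Delta != 0 by exact: mulf_neq0 s0 (invr_neq0 hD).
  move/eqP; rewrite mulf_eq0 (negPf sD) /= subr_eq0 => /eqP X11.
  by rewrite X11.
have hP : 1 - Psi != 0 by rewrite subr_eq0 gt_eqF ?double_Psi_lt1.
have i2 : E * c = g * (Psi - c ^+ 2).
  have -> : g * (Psi - c ^+ 2) = g * tau * (1 - Psi) by rewrite /tau; field.
  move: X20; have -> : X2 = m / (1 - Psi) * (E * c - g * tau * (1 - Psi)).
    by rewrite /X2 /m /tau; field.
  have mP : m / (1 - Psi) != 0 by exact: mulf_neq0 (lt0r_neq0 m_gt0) (invr_neq0 hP).
  by move/eqP; rewrite mulf_eq0 (negPf mP) /= subr_eq0 => /eqP.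
(* The second eigenvector equation turns optimality of the shrinkage into a relation where [rho] and
   [s] no longer appear explicitly. *)
have i3 : Lam * (k2 ^+ 2 * D2 + k1 * k2 * D1) = (Lam - nu * Lam2) * D2.
  have : (k1 * D1 * s * rho + k2 * D2 * s) * (k1 * D1 + k2 * D2) =
      Lam - nu * Lam2 - (1 - s) * (k1 * D1 + k2 * D2) ^+ 2.
    have -> : Lam - nu * Lam2 = Psi * L ^+ 2 by rewrite /Psi; field.
    have -> : (1 - s) * (k1 * D1 + k2 * D2) ^+ 2 = c ^+ 2 * L ^+ 2.
      by rewrite -g2 /c; field.
    rewrite -mulrBl; apply: (mulfI (lt0r_neq0 gp)); rewrite [RHS]mulrA -i2.
    by rewrite /E /c; field.
  move=> h.
  have -> : Lam - nu * Lam2 = (k1 * D1 * s * rho + k2 * D2 * s) * (k1 * D1 + k2 * D2)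
      + (1 - s) * (k1 * D1 + k2 * D2) ^+ 2 by rewrite h subrK.
  transitivity (Lam * k2 * (k2 * D2 + k1 * D1)); first by ring.
  by rewrite -e2 /r; ring.
(* The right side is the part of the smaller signal eigenvalue that the shrinkage counts as noise;
   its sign orders [k2 * D1] and [k1 * D2]. *)
have LD : Lam * k1 * (k1 * D2 - k2 * D1) = nu * Lam2 * D2.
  transitivity (Lam * D2 * (k1 ^+ 2 + k2 ^+ 2) - Lam * (k2 ^+ 2 * D2 + k1 * k2 * D1)).
    by ring.
  by rewrite i3 k12; ring.
have k1_gt0 : 0 < k1.
  rewrite lt0r k1p andbT; apply/negP => /eqP k10.
  move: i1 c_gt0; rewrite /c k10 !mul0r add0r => /eqP.
  rewrite !mulf_eq0 (negPf rho0) (gt_eqF vp) (gt_eqF D1p) !orbF => /eqP ->.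
  by rewrite mul0r mulr0 mul0r ltxx.
have kD : k2 * D1 <= k1 * D2.
  have : 0 <= Lam * k1 * (k1 * D2 - k2 * D1).
    by rewrite LD mulr_ge0 ?mulr_ge0// ltW.
  by rewrite pmulr_rge0 ?mulr_gt0// subr_ge0.
have rho_le1 : rho <= 1.
  rewrite leNgt; apply/negP => rho_gt1.
  by move: rho_lt1; rewrite ltNge ltW// exprn_egt1.
have lt1 : k1 * D2 * v < k1 * (D2 * (v + D1 ^+ 2 * s * (1 - rho ^+ 2))).
  rewrite mulrA ltr_pM2l ?mulr_gt0// ltrDl !mulr_gt0 ?exprn_gt0 ?subr_gt0//.
  by case/andP: s01.
move: lt1; rewrite -i1 ltNge => /negP; apply.
rewrite (_ : k2 * (D1 * rho * v) = k2 * D1 * rho * v); last by ring.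
by rewrite ler_pM2r// (le_trans _ kD)// ler_piMr ?mulr_ge0 ?(ltW D1p).
Qed.

End double_block_cosine.

(** The relation [tau * (1 - f ^+ 2) = f ^+ 2 * (1 - G)] factors the squared length [Q] as
    [f ^+ 2 * (tau + 1) * (tau + G)], so a factor [tau + G] cancels in the squared cosine. *)
Lemma gps_cos2_ratio (F : rcfType) (f G : F) : 0 < f -> f ^+ 2 < 1 -> 0 < G <= 1 ->
  let tau := gps_tau (f ^+ 2) G in
  let Q := tau ^+ 2 + 2 * tau * (f ^+ 2 * G) + f ^+ 2 * G in
  0 < Q /\ (tau * f + f * G) / Num.sqrt Q = Num.sqrt (gps_cos2 (f ^+ 2) G).
Proof.
move=> f0 f1 /andP[G0 G1] tau Q.
have f2 : 0 < f ^+ 2 by rewrite exprn_gt0.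
have t0 : 0 <= tau by apply: gps_tau_ge0 => //; rewrite f2.
have QE : Q = f ^+ 2 * (tau + 1) * (tau + G).
  have : tau * (1 - f ^+ 2) = f ^+ 2 * (1 - G).
    by rewrite /tau /gps_tau mulfVK ?subr_eq0 ?gt_eqF//; ring.
  move=> /(congr1 (fun z => z * tau)) H; apply/eqP; rewrite -subr_eq0.
  have -> : Q - f ^+ 2 * (tau + 1) * (tau + G) =
    tau * (1 - f ^+ 2) * tau - f ^+ 2 * (1 - G) * tau by rewrite /Q; ring.
  by rewrite H subrr.
have t1 : 0 < tau + 1 by rewrite ltr_wpDl.
have tG : 0 < tau + G by rewrite ltr_wpDl.
have Q0 : 0 < Q by rewrite QE !mulr_gt0.
split=> //.
have N0 : 0 < tau * f + f * G by rewrite (_ : _ + _ = f * (tau + G)) ?mulr_gt0//; ring.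
rewrite -[LHS]ger0_norm; last by rewrite divr_ge0 ?sqrtr_ge0// ltW.
rewrite -sqrtr_sqr; congr Num.sqrt.
rewrite exprMn exprVn sqr_sqrtr ?(ltW Q0)// QE /gps_cos2 -/tau.
by field; rewrite !gt_eqF.
Qed.

(** Half-angle formulas: [C] and [N] are the cosine and sine of twice the angle of the top
    eigenvector, and [S] is the gap between the eigenvalues, positive by the last hypothesis.
    [0 <= r] allows an eigenvector in the closed first quadrant; [r <= 1] makes the smaller
    eigenvalue non-negative. The last clause is the spectral decomposition of the form. *)
Lemma sym2_top_eigenvector (F : rcfType) (D1 D2 r : F) : 0 < D1 -> 0 < D2 -> 0 <= r <= 1 ->
  (D1 != D2) || (r != 0) ->
  exists k1 k2 Lam, [/\ [/\ 0 <= k1, 0 <= k2 & k1 ^+ 2 + k2 ^+ 2 = 1],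
    D1 ^+ 2 * k1 + r * D1 * D2 * k2 = Lam * k1,
    r * D1 * D2 * k1 + D2 ^+ 2 * k2 = Lam * k2,
    0 <= D1 ^+ 2 + D2 ^+ 2 - Lam < Lam &
    forall y1 y2, D1 ^+ 2 * y1 ^+ 2 + 2 * r * D1 * D2 * y1 * y2 + D2 ^+ 2 * y2 ^+ 2 =
      Lam * (k1 * y1 + k2 * y2) ^+ 2
      + (D1 ^+ 2 + D2 ^+ 2 - Lam) * (y1 ^+ 2 + y2 ^+ 2 - (k1 * y1 + k2 * y2) ^+ 2)].
Proof.
move=> D1p D2p /andP[r0 r1] ndeg.
pose Q := (D1 ^+ 2 - D2 ^+ 2) ^+ 2 + (2 * r * D1 * D2) ^+ 2.
have Q0 : 0 < Q.
  rewrite lt0r addr_ge0 ?sqr_ge0// andbT paddr_eq0 ?sqr_ge0// !sqrf_eq0 negb_and.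
  case/orP: ndeg => [D12|rn0]; last by rewrite !mulf_neq0 ?orbT// ?gt_eqF.
  by rewrite subr_eq0 eqrXn2 ?D12// ltW.
pose S := Num.sqrt Q.
have S0 : 0 < S by rewrite sqrtr_gt0.
have S2 : S ^+ 2 = Q by rewrite sqr_sqrtr ?ltW.
pose C := (D1 ^+ 2 - D2 ^+ 2) / S; pose N := 2 * r * D1 * D2 / S.
have N0 : 0 <= N by rewrite /N !mulr_ge0 ?invr_ge0// ltW.
have CN : C ^+ 2 + N ^+ 2 = 1.
  by rewrite /C /N !expr_div_n -mulrDl -/Q S2 divff ?gt_eqF.
have C1 : 0 <= (1 + C) / 2.
  by rewrite divr_ge0//; have := sqr_ge0 N; nra.
have C2 : 0 <= (1 - C) / 2.
  by rewrite divr_ge0//; have := sqr_ge0 N; nra.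
pose k1 := Num.sqrt ((1 + C) / 2); pose k2 := Num.sqrt ((1 - C) / 2).
have k1E : k1 ^+ 2 = (1 + C) / 2 by rewrite sqr_sqrtr.
have k2E : k2 ^+ 2 = (1 - C) / 2 by rewrite sqr_sqrtr.
have k12 : k1 * k2 = N / 2.
  rewrite /k1 /k2 -sqrtrM// (_ : _ * _ = (N / 2) ^+ 2).
    by rewrite sqrtr_sqr ger0_norm// divr_ge0.
  rewrite (_ : (N / 2) ^+ 2 = N ^+ 2 / 4); last by field.
  have N2 : N ^+ 2 = 1 - C ^+ 2 by rewrite -CN; ring.
  by rewrite N2; field.
have sumk : k1 ^+ 2 + k2 ^+ 2 = 1 by rewrite k1E k2E; field.
have CE : C = k1 ^+ 2 - k2 ^+ 2 by rewrite k1E k2E; field.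
have D12 : D1 ^+ 2 - D2 ^+ 2 = S * (k1 ^+ 2 - k2 ^+ 2).
  by rewrite -CE /C mulrC divfK ?gt_eqF.
have rD : r * D1 * D2 = S * (k1 * k2).
  by rewrite k12 /N; field; rewrite gt_eqF.
have SE : S = S * k1 ^+ 2 + S * k2 ^+ 2 by rewrite -mulrDr sumk mulr1.
pose Lam := (D1 ^+ 2 + D2 ^+ 2 + S) / 2.
have L1 : D1 ^+ 2 = Lam - S * k2 ^+ 2.
  have -> : D1 ^+ 2 = (D1 ^+ 2 + D2 ^+ 2 + S * (k1 ^+ 2 - k2 ^+ 2)) / 2.
    by rewrite -D12; field.
  by rewrite /Lam [X in _ = (_ + X) / 2 - _]SE; field.
have L2 : D2 ^+ 2 = Lam - S * k1 ^+ 2.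
  have -> : D2 ^+ 2 = (D1 ^+ 2 + D2 ^+ 2 - S * (k1 ^+ 2 - k2 ^+ 2)) / 2.
    by rewrite -D12; field.
  by rewrite /Lam [X in _ = (_ + X) / 2 - _]SE; field.
exists k1, k2, Lam; split.
- by split; rewrite ?sqrtr_ge0.
- by rewrite rD L1; ring.
- by rewrite rD L2; ring.
- have -> : D1 ^+ 2 + D2 ^+ 2 - Lam = (D1 ^+ 2 + D2 ^+ 2 - S) / 2 by rewrite /Lam; field.
  apply/andP; split; last by rewrite /Lam ltr_pM2r ?invr_gt0// ltrD2l gtrN.
  rewrite divr_ge0// subr_ge0 -(@ler_pXn2r _ 2)// ?nnegrE ?addr_ge0 ?sqr_ge0 ?(ltW S0)//.
  rewrite S2 -subr_ge0.
  rewrite (_ : _ - _ = (2 * D1 * D2) ^+ 2 * (1 - r ^+ 2)); last by rewrite /Q; ring.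
  by rewrite mulr_ge0 ?sqr_ge0// subr_ge0 expr_le1.
move=> y1 y2.
have -> : D1 ^+ 2 + D2 ^+ 2 - Lam = Lam - S.
  by rewrite L1 L2 [S in RHS]SE; ring.
have -> : 2 * r * D1 * D2 = 2 * (S * (k1 * k2)) by rewrite -rD; ring.
rewrite L1 L2; apply/eqP; rewrite -subr_eq0; apply/eqP.
transitivity (S * (y1 ^+ 2 + y2 ^+ 2) * (1 - (k1 ^+ 2 + k2 ^+ 2))); first by ring.
by rewrite sumk subrr mulr0.
Qed.

(** * A strong law of large numbers *)

(** Telescoping, from [1 / x^2 <= 2 / (x (x + 1))] for [x >= 1]. *)
Lemma sum_inv_sqr_le (R : realFieldType) (N : nat) :
  \sum_(0 <= m < N) (m.+1%:R ^- 2 : R) <= 2 - 2 / N.+1%:R.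
Proof.
elim: N => [|N IH]; first by rewrite big_nil divr1 subrr.
rewrite big_nat_recr//=; have h : 0 < N.+1%:R :> R by rewrite ltr0n.
have h1 : 1 <= N.+1%:R :> R by rewrite ler1n.
rewrite -[N.+2]addn1 natrD; move: (N.+1%:R : R) h h1 IH => x x0 x1 IH.
have : x ^- 2 <= 2 / x - 2 / (x + 1).
  have x2 : 0 < x + 1 by rewrite ltr_wpDr.
  rewrite -subr_ge0 (_ : _ - _ = (x - 1) / (x ^+ 2 * (x + 1))); last first.
    by field; rewrite !gt_eqF.
  by rewrite divr_ge0 ?subr_ge0// mulr_ge0 ?sqr_ge0// ltW.
lra.
Qed.

Section slln.
Context d (T : measurableType d) (R : realType) (P : probability T R).

(** The sum of the [V m] has finite expectation, so it is finite almost everywhere and its terms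
    tend to 0. This stands in for Markov's inequality followed by Borel-Cantelli. *)
Lemma ae_cvg0_summable_integral (V : nat -> T -> R) (C : R) :
  (forall m, measurable_fun setT (V m)) -> (forall m w, 0 <= V m w) ->
  (forall m, (\int[P]_w (V m w)%:E <= (C / m.+1%:R ^+ 2)%:E)%E) ->
  {ae P, forall w, V ^~ w @ \oo --> (0 : R)}.
Proof.
move=> mV V0 VC.
have C0 : 0 <= C.
  rewrite -lee_fin (_ : C%:E = (C / 1%:R ^+ 2)%:E) ?(le_trans _ (VC 0))//; last first.
    by rewrite expr1n divr1.
  by apply: integral_ge0 => w _; rewrite lee_fin.
pose S (w : T) : \bar R := (\sum_(0 <= m <oo) (V m w)%:E)%E.
have mS : measurable_fun setT S.
  apply: ge0_emeasurable_sum => [m x _ _|m _]; first by rewrite lee_fin.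
  exact/measurable_EFinP.
have iS : (\int[P]_w S w <= (2 * C)%:E)%E.
  rewrite /S integral_nneseries//; last 2 first.
  - by move=> m; exact/measurable_EFinP.
  - by move=> m w _; rewrite lee_fin.
  apply: lime_le.
    by apply: is_cvg_nneseries => m _ _; apply: integral_ge0 => w _; rewrite lee_fin.
  apply: nearW => N.
  apply: (@le_trans _ _ (\sum_(0 <= m < N) (C / m.+1%:R ^+ 2)%:E)%E).
    by apply: lee_sum => m _.
  rewrite sumEFin lee_fin -mulr_sumr mulrC ler_wpM2r//.
  apply: le_trans (sum_inv_sqr_le _ _) _.
  by rewrite gerBl divr_ge0.
have S0 w : (0 <= S w)%E by apply: nneseries_ge0 => m *; rewrite lee_fin.
have intS : P.-integrable setT S.
  apply/integrableP; split => //.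
  under eq_integral do rewrite gee0_abs//.
  by rewrite (le_lt_trans iS)// ltry.
have := integrable_ae measurableT intS.
apply: filterS => w /(_ I) Sfin.
apply: cvg_series_cvg_0; apply: nondecreasing_is_cvgn.
  by apply/nondecreasing_seqP => n; rewrite /series/= big_nat_recr//= lerDl.
exists (fine (S w)) => _ [n _ <-].
rewrite -lee_fin fineK// /series/= -sumEFin.
by apply: nneseries_lim_ge => m *; rewrite lee_fin.
Qed.

End slln.

(* Between consecutive squares, the fluctuation of the partial sums is bounded by
   the sum of all squared increments over the block. *)
Lemma cvg_mean_of_squares (R : realType) (y : nat -> R) :
  let S p := \sum_(0 <= i < p) y i in
  (fun m => (S (m.+1 ^ 2)%N ^+ 2 +
     \sum_(0 <= j < m.*2.+3) (S (m.+1 ^ 2 + j)%N - S (m.+1 ^ 2)%N) ^+ 2)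
     / (m.+1%:R ^+ 4)) @ \oo --> (0 : R) ->
  (fun p => p%:R^-1 * S p) @ \oo --> (0 : R).
Proof.
move=> S; set V := (fun m : nat => _) => V0.
apply/cvgrPdist_lt => e e0.
(* The 2 absorbs the constant in [(a + b)^2 <= 2 (a^2 + b^2)], applied to [S p] split at the
   preceding square. *)
have /cvgrPdist_lt /(_ (e ^+ 2 / 2)) := V0.
rewrite divr_gt0 ?exprn_gt0// => /(_ isT)[M _ HM].
exists (M.+1 ^ 2)%N => // p /= Mp.
have [m mp] : exists m, (m.+1 ^ 2 <= p < m.+2 ^ 2)%N.
  have p0 : (0 < p)%N by apply: leq_trans Mp; rewrite expn_gt0.
  elim: p p0 {Mp} => // -[_ _|p IH _]; first by exists 0%N.
  have [//|m /andP[m1 m2]] := IH.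
  have [m3|m3] := ltnP p.+2 (m.+2 ^ 2).
    by exists m; rewrite m3 andbT (leq_trans m1).
  exists m.+1; rewrite m3/= (leq_ltn_trans m2)// ltn_exp2r//.
move: mp => /andP[m1 m2].
have Mm : (M <= m)%N.
  by have := leq_ltn_trans Mp m2; rewrite ltn_exp2r.
have := HM _ Mm; rewrite sub0r normrN.
have x0 : 0 < m.+1%:R :> R by rewrite ltr0n.
(* [m.*2.+3] is the distance between the consecutive squares [m.+1 ^ 2] and [m.+2 ^ 2]. *)
have jp : (p - m.+1 ^ 2 < m.*2.+3)%N.
  rewrite ltn_subLR//; apply: leq_trans m2 _.
  by rewrite -!mulnn -muln2 ; lia.
have Vge : (S (m.+1 ^ 2)%N ^+ 2 + (S p - S (m.+1 ^ 2)%N) ^+ 2) / m.+1%:R ^+ 4 <= V m.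
  rewrite /V ler_pM2r ?invr_gt0 ?exprn_gt0// lerD2l.
  rewrite (bigD1_seq (p - m.+1 ^ 2)%N) ?iota_uniq ?mem_index_iota//= subnKC//.
  by rewrite lerDl sumr_ge0// => i _; rewrite sqr_ge0.
move=> /(le_lt_trans (ler_norm _)) /(le_lt_trans Vge).
rewrite ltr_pdivrMr ?exprn_gt0// => h.
rewrite sub0r normrN -(@ltr_pXn2r _ 2)// ?nnegrE ?(ltW e0)//.
rewrite -normrX ger0_norm ?sqr_ge0// exprMn.
have p0 : 0 < p%:R :> R.
  by rewrite ltr0n; apply: leq_trans m1; rewrite expn_gt0.
rewrite exprVn mulrC ltr_pdivrMr ?exprn_gt0//.
have hp : m.+1%:R ^+ 4 <= p%:R ^+ 2 :> R.
  rewrite (exprM _ 2 2) ler_pXn2r ?nnegrE ?exprn_ge0//.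
  by rewrite -natrX ler_nat.
have h2 : S p ^+ 2 <= 2 * (S (m.+1 ^ 2)%N ^+ 2 + (S p - S (m.+1 ^ 2)%N) ^+ 2).
  rewrite -subr_ge0 (_ : _ - _ = (S p - 2 * S (m.+1 ^ 2)%N) ^+ 2) ?sqr_ge0//.
  by ring.
apply: (le_lt_trans h2); rewrite mulrC -ltr_pdivlMr//.
apply: (lt_le_trans h); rewrite mulrAC ler_pM2r ?invr_gt0//.
by rewrite ler_pM2l ?exprn_gt0.
Qed.

Section slln2.
Context d (T : measurableType d) (R : realType) (P : probability T R).

Lemma integrable_mul_sqr (f g : T -> R) :
  measurable_fun setT f -> measurable_fun setT g ->
  P.-integrable setT (fun w => (f w ^+ 2)%:E) ->
  P.-integrable setT (fun w => (g w ^+ 2)%:E) ->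
  P.-integrable setT (fun w => (f w * g w)%:E).
Proof.
move=> mf mg f2 g2.
apply: (le_integrable measurableT _ _ (integrableD measurableT f2 g2)).
  by apply/measurable_EFinP; exact: measurable_funM.
move=> w _; rewrite -EFinD !abse_EFin lee_fin normrM.
rewrite [leRHS]ger0_norm ?addr_ge0 ?sqr_ge0//.
rewrite -(real_normK (num_real (f w))) -(real_normK (num_real (g w))).
move: (`|f w|) (`|g w|) (normr_ge0 (f w)) (normr_ge0 (g w)) => a b a0 b0.
by rewrite -subr_ge0; nra.
Qed.

Lemma integrable_sqr (f : T -> R) (C : R) :
  measurable_fun setT f -> (\int[P]_w (f w ^+ 2)%:E <= C%:E)%E ->
  P.-integrable setT (fun w => (f w ^+ 2)%:E).
Proof.
move=> mf fC; apply/integrableP; split.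
  by apply/measurable_EFinP; exact: measurable_funX.
under eq_integral do rewrite abse_EFin ger0_norm ?sqr_ge0//.
by rewrite (le_lt_trans fC)// ltry.
Qed.

Variables (Y : nat -> T -> R) (C : R).
Hypothesis mY : forall i, measurable_fun setT (Y i).
Hypothesis YC : forall i, (\int[P]_w (Y i w ^+ 2)%:E <= C%:E)%E.
Hypothesis Y0 : forall i j, i != j -> (\int[P]_w (Y i w * Y j w)%:E = 0)%E.

Let intYY i j : P.-integrable setT (fun w => (Y i w * Y j w)%:E).
Proof. by apply: integrable_mul_sqr => //; exact: integrable_sqr (YC _). Qed.

Lemma integral_sqr_sum_le (s : seq nat) : uniq s ->
  (\int[P]_w ((\sum_(i <- s) Y i w) ^+ 2)%:E <= (C *+ size s)%:E)%E.
Proof.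
move=> us.
under eq_integral do rewrite expr2 big_distrlr/= -sumEFin.
rewrite (@integral_sum _ _ _ _ _ measurableT _
  (fun i w => (\sum_(j <- s) Y i w * Y j w)%:E)); last first.
  move=> i; under eq_fun do rewrite -sumEFin; exact: integrable_sum.
rewrite -[size s](sum1_size s) -sumrMnr -sumEFin big_seq [leRHS]big_seq.
apply: lee_sum => i si.
under eq_integral do rewrite -sumEFin.
rewrite (@integral_sum _ _ _ _ _ measurableT _ (fun j w => (Y i w * Y j w)%:E))//.
rewrite (bigD1_seq i)//= [X in (_ + X)%E]big1 => [|j ji]; last first.
  by rewrite Y0// eq_sym.
by rewrite adde0; apply: YC.
Qed.

(** Orthogonality bounds the second moment of a sum of [N] terms by [C * N]. Along squares the
    normalized moments are summable, and the blocks between squares are short enough for the crude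
    bound by the sum of all their squared increments. *)
Lemma orthogonal_slln :
  {ae P, forall w, (fun p : nat => p%:R^-1 * \sum_(0 <= i < p) Y i w) @ \oo --> (0 : R)}.
Proof.
pose S (w : T) p : R := \sum_(0 <= i < p) Y i w.
pose V (m : nat) (w : T) : R := (S w (m.+1 ^ 2)%N ^+ 2 +
     \sum_(0 <= j < m.*2.+3) (S w (m.+1 ^ 2 + j)%N - S w (m.+1 ^ 2)%N) ^+ 2)
     / (m.+1%:R ^+ 4).
have mS p : measurable_fun setT (S ^~ p) by apply: measurable_sum.
have C0 : 0 <= C.
  rewrite -lee_fin (le_trans _ (YC 0))//.
  by apply: integral_ge0 => w _; rewrite lee_fin sqr_ge0.
suff : {ae P, forall w, V ^~ w @ \oo --> (0 : R)}.
  by apply: filterS => w; exact: cvg_mean_of_squares.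
(* With [x = m + 1], the numerator has expectation at most [C (x^2 + (2 x + 1)^2) <= 10 C x^2], to
   be divided by [x^4]. *)
apply: (@ae_cvg0_summable_integral _ _ _ _ _ (10 * C)).
- move=> m; apply: measurable_funM => //.
  apply: measurable_funD; first exact: measurable_funX.
  apply: measurable_sum => j; apply: measurable_funX.
  exact: measurable_funB.
- move=> m w; rewrite divr_ge0 ?exprn_ge0// addr_ge0 ?sqr_ge0//.
  by apply: sumr_ge0 => j _; rewrite sqr_ge0.
move=> m.
have mV2 j : measurable_fun setT
    (fun w => ((S w (m.+1 ^ 2 + j)%N - S w (m.+1 ^ 2)%N) ^+ 2)%:E).
  by apply/measurable_EFinP; apply: measurable_funX; exact: measurable_funB.
have mV1 : measurable_fun setT (fun w => (S w (m.+1 ^ 2)%N ^+ 2)%:E).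
  by apply/measurable_EFinP; exact: measurable_funX.
have x0 : 0 < m.+1%:R :> R by rewrite ltr0n.
under eq_integral do rewrite /V mulrC EFinM EFinD -sumEFin.
have sum0 w : (0 <= \sum_(0 <= j < m.*2.+3)
    ((S w (m.+1 ^ 2 + j)%N - S w (m.+1 ^ 2)%N) ^+ 2)%:E)%E.
  by apply: sume_ge0 => j _; rewrite lee_fin sqr_ge0.
rewrite ge0_integralZl//; last 2 first.
- by apply: emeasurable_funD => //; exact: emeasurable_sum.
- by move=> w _; rewrite adde_ge0// lee_fin sqr_ge0.
rewrite ge0_integralD//; last 2 first.
- by move=> w _; rewrite lee_fin sqr_ge0.
- exact: emeasurable_sum.
rewrite ge0_integral_sum//; last by move=> j w _; rewrite lee_fin sqr_ge0.
apply: (@le_trans _ _ ((m.+1%:R ^- 4)%:E * ((C *+ (m.+1 ^ 2))%:E +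
    \sum_(0 <= j < m.*2.+3) (C *+ m.*2.+3)%:E))%E).
  rewrite lee_pmul2l ?lte_fin ?invr_gt0 ?exprn_gt0//.
  apply: leeD.
    by have := integral_sqr_sum_le (iota_uniq 0 (m.+1 ^ 2 - 0)); rewrite size_iota subn0.
  rewrite big_seq [leRHS]big_seq; apply: lee_sum => j; rewrite mem_index_iota => /= jm.
  have -> : (\int[P]_w ((S w (m.+1 ^ 2 + j)%N - S w (m.+1 ^ 2)%N) ^+ 2)%:E =
     \int[P]_w ((\sum_(i <- index_iota (m.+1 ^ 2) (m.+1 ^ 2 + j)) Y i w) ^+ 2)%:E)%E.
    apply: eq_integral => w _.
    by rewrite /S (@big_cat_nat _ _ _ (m.+1 ^ 2)%N 0)//= ?leq_addr// addrAC subrr add0r.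
  apply: le_trans (integral_sqr_sum_le (iota_uniq _ _)) _.
  by rewrite lee_fin size_iota addKn ler_wpMn2l// ltnW.
rewrite sumEFin -EFinD -EFinM lee_fin sumr_const_nat subn0.
rewrite -[C *+ _ ^ 2]mulr_natr -[_ *+ _ *+ _]mulr_natr -[C *+ _.+3]mulr_natr natrX.
have -> : m.*2.+3%:R = 2 * m.+1%:R + 1 :> R.
  by rewrite -natrM natr1 mul2n doubleS.
have x1 : 1 <= m.+1%:R :> R by rewrite ler1n.
move: (m.+1%:R : R) x0 x1 => x x0 x1.
rewrite mulrC ler_pdivrMr ?exprn_gt0//.
rewrite (_ : 10 * C / _ * _ = C * (10 * x ^+ 2)); last first.
  by field; rewrite gt_eqF.
rewrite -mulrA -mulrDr ler_wpM2l//.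
by nra.
Qed.

End slln2.

(** * Independence *)

Section indep.
Context d (T : measurableType d) (R : realType) (P : probability T R).

(** Independence identifies the joint law with the product of the marginal laws, by uniqueness on
    rectangles; Fubini then splits the integral. *)
Lemma indep_integral_mul (f g : T -> R) :
  measurable_fun setT f -> measurable_fun setT g ->
  (forall A B, measurable A -> measurable B ->
    P (f @^-1` A `&` g @^-1` B) = (P (f @^-1` A) * P (g @^-1` B))%E) ->
  P.-integrable setT (EFin \o f) -> P.-integrable setT (EFin \o g) ->
  (\int[P]_w (f w * g w)%:E = \int[P]_w (f w)%:E * \int[P]_w (g w)%:E)%E.
Proof.
move=> mf mg fg intf intg.
pose X : {mfun T >-> R} := mfun_Sub (mem_set mf).
pose Y : {mfun T >-> R} := mfun_Sub (mem_set mg).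
have XE : X = f :> (T -> R) by [].
have YE : Y = g :> (T -> R) by [].
pose h w := (f w, g w).
have mh : measurable_fun setT h by exact: measurable_fun_pair.
pose H : {mfun T >-> (R * R)%type} := mfun_Sub (mem_set mh).
pose m1 := distribution P X; pose m2 := distribution P Y.
pose m := distribution P H.
have mE A : measurable A -> (m1 \x m2)%E A = m A.
  by apply: product_measure_unique => A1 B1 mA1 mB1; rewrite -fg.
have mxy : measurable_fun setT (fun z : R * R => (z.1 * z.2)%:E).
  by apply/measurable_EFinP; apply: measurable_funM.
have mabs : measurable_fun setT (fun x : R => `|x|%:E).
  by apply/measurable_EFinP; exact: normr_measurable.
have intXY : (m1 \x m2)%E.-integrable setT (fun z : R * R => (z.1 * z.2)%:E).
  apply/integrableP; split => //.
  rewrite fubini_tonelli1//; last exact: measurableT_comp.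
  have -> : (\int[m1]_x fubini_F m2 (fun z : R * R => `|(z.1 * z.2)%:E|) x =
      \int[m1]_x (`|x|%:E * \int[m2]_y `|y|%:E))%E.
    apply: eq_integral => x _; rewrite /fubini_F/=.
    under eq_integral do rewrite normrM EFinM.
    by rewrite ge0_integralZl//; exact: mabs.
  rewrite ge0_integralZr//; last first.
    by apply: integral_ge0 => y _; rewrite lee_fin.
  rewrite lte_mul_pinfty//.
  - by apply: integral_ge0 => y _; rewrite lee_fin.
  - rewrite fin_real//.
    have -> : (\int[m1]_x `|x|%:E = \int[P]_w `|(f w)%:E|)%E.
      by rewrite /m1 ge0_integral_distribution//; exact: mabs.
    case/integrableP: intf => _ ->; rewrite andbT (lt_le_trans ltNy0)//.
    exact: integral_ge0.
  have -> : (\int[m2]_x `|x|%:E = \int[P]_w `|(g w)%:E|)%E.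
    by rewrite /m2 ge0_integral_distribution//; exact: mabs.
  by case/integrableP: intg.
have intfg : P.-integrable setT (fun w => (f w * g w)%:E).
  apply/integrableP; split.
    by apply/measurable_EFinP; exact: measurable_funM.
  have -> : (\int[P]_w `|(f w * g w)%:E| = \int[m]_z `|(z.1 * z.2)%:E|)%E.
    by rewrite /m ge0_integral_distribution//; exact: measurableT_comp.
  rewrite (eq_measure_integral (m1 \x m2)%E); last by move=> A mA _; exact/esym/mE.
  by case/integrableP: intXY.
have -> : (\int[P]_w (f w * g w)%:E = \int[m]_z (z.1 * z.2)%:E)%E.
  by rewrite /m integral_distribution.
rewrite (eq_measure_integral (m1 \x m2)%E); last by move=> A mA _; exact/esym/mE.
rewrite -integral12_prod_meas1//.
have mid : measurable_fun setT (fun y : R => y%:E).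
  by apply/measurable_EFinP; exact: measurable_id.
have intY : m2.-integrable setT (fun y => y%:E).
  by apply: (@integrable_pushforward _ _ _ _ _ _ mg P setT (fun y : R => y%:E)).
have intX : m1.-integrable setT (fun y => y%:E).
  by apply: (@integrable_pushforward _ _ _ _ _ _ mf P setT (fun y : R => y%:E)).
have E2 : (\int[m2]_y y%:E = \int[P]_w (g w)%:E)%E by rewrite /m2 integral_distribution.
have E1 : (\int[m1]_y y%:E = \int[P]_w (f w)%:E)%E by rewrite /m1 integral_distribution.
have gfin : (\int[P]_w (g w)%:E)%E \is a fin_num by exact: integrable_fin_num.
have -> : (\int[m1]_x fubini_F m2 (fun z : R * R => (z.1 * z.2)%:E) x =
    \int[m1]_x (x%:E * \int[m2]_y y%:E))%E.
  apply: eq_integral => x _; rewrite /fubini_F/=.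
  by under eq_integral do rewrite EFinM; rewrite integralZl.
by rewrite E2 -(fineK gfin) integralZr// E1.
Qed.
End indep.

Local Notation sigma_rv_type X :=
  (g_sigma_algebraType (\bigcup_i preimage_set_system setT (X i) measurable)).

Section sigma.
Context d (T : measurableType d) (R : realType) (P : probability T R).

Lemma sigma_rv_setT (I : Type) (X : I -> T -> R) : sigma_rv X setT.
Proof.
exact: (@measurableT _ (sigma_rv_type X)).
Qed.

Lemma measurable_sigma_rv (I : Type) (X : I -> T -> R) i :
  measurable_fun (setT : set (sigma_rv_type X)) (X i).
Proof.
by move=> _ A mA; apply: sub_sigma_algebra; exists i => //; exists A.
Qed.

Lemma sigma_rv_preimage (I : Type) (X : I -> T -> R) (f : T -> R) A :
  measurable_fun (setT : set (sigma_rv_type X)) f ->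
  measurable A -> sigma_rv X (f @^-1` A).
Proof.
by move=> mf mA; have := mf measurableT A mA; rewrite setTI.
Qed.

Lemma mutual_indep2 (I : choiceType) (F : I -> set (set T)) i j A B :
  mutual_indep P F -> i != j -> F i A -> F j B ->
  P (A `&` B) = (P A * P B)%E.
Proof.
move=> indF ij FA FB.
have := indF [fset i; j]%fset (fun k => if k == i then A else B).
have -> : \bigcap_(k in [set` [fset i; j]%fset]) (if k == i then A else B) = A `&` B.
  apply/seteqP; split => w /= h.
    split; first by have := h i; rewrite /= eqxx; apply; rewrite !inE eqxx.
    by have := h j; rewrite /= eq_sym (negPf ij); apply; rewrite !inE eqxx orbT.
  move=> k /=; rewrite !inE => /orP[/eqP->|/eqP->].
    by rewrite eqxx; case: h.
  by rewrite eq_sym (negPf ij); case: h.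
rewrite big_fsetU1/= ?inE// big_seq_fset1 eqxx eq_sym (negPf ij) => -> //.
by move=> k; rewrite !inE => /orP[/eqP->|/eqP->]; rewrite ?eqxx// eq_sym (negPf ij).
Qed.
End sigma.

(** * Strong laws for the noise and the loadings *)

Section model_lln.
Context (R : realType) (d : measure_display) (T : measurableType d)
  (P : probability T R) (n : nat) (delta : R).
Variables (beta : 'I_2 -> nat -> {RV P >-> R}) (X : 'I_2 -> 'I_n -> {RV P >-> R})
  (Z : nat -> 'I_2 -> 'I_n -> {RV P >-> R}).
Hypotheses (A1 : assumption1 beta) (A2 : assumption2 beta X Z) (A4 : assumption4 Z delta).

Let mZ i t j : measurable_fun setT (Z i t j) := measurable_funPT (Z i t j).
Let mb t i : measurable_fun setT (beta t i) := measurable_funPT (beta t i).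

Let EZ i t j : (\int[P]_w (Z i t j w)%:E = 0)%E.
Proof. by case: A4 => h _ _ _ _; have := h i t j; rewrite unlock. Qed.

Let EZ2 i t j : (\int[P]_w (Z i t j w ^+ 2)%:E = (delta ^+ 2)%:E)%E.
Proof.
case: A4 => h0 h _ _ _; have := h i t j.
rewrite /variance covariance.unlock h0/= unlock => <-.
apply: eq_integral => w _; rewrite -[RHS]/(((Z i t j w - 0) * (Z i t j w - 0))%:E).
by rewrite !subr0 expr2.
Qed.

Let EZZ i k k' : (\int[P]_w (Z i k.1 k.2 w * Z i k'.1 k'.2 w)%:E =
   (if k == k' then delta ^+ 2 else 0)%:E)%E.
Proof.
have [<-|kk'] := eqVneq k k'; first exact: EZ2.
case: A4 => h0 _ _ _ h; have := h i k k' kk'.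
rewrite covariance.unlock !h0/= unlock => cov0.
rewrite -[RHS]cov0; apply: eq_integral => w _.
by rewrite -[RHS]/(((Z i k.1 k.2 w - 0) * (Z i k'.1 k'.2 w - 0))%:E) !subr0.
Qed.

Let intZ2 i t j : P.-integrable setT (fun w => (Z i t j w ^+ 2)%:E).
Proof. by apply: (@integrable_sqr _ _ _ _ _ (delta ^+ 2)) => //; rewrite EZ2. Qed.

Let intZZ i k i' k' : P.-integrable setT (fun w => (Z i k.1 k.2 w * Z i' k'.1 k'.2 w)%:E).
Proof. exact: integrable_mul_sqr. Qed.

Let intC (c : R) : P.-integrable setT (fun=> c%:E).
Proof. by apply: finite_measure_integrable_cst. Qed.

Let EC (c : R) : (\int[P]_w c%:E = c%:E)%E.
Proof. by rewrite integral_cst//= probability_setT mule1. Qed.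

Let intsq (f : T -> R) : measurable_fun setT f ->
  P.-integrable setT (fun w => (f w ^+ 2)%:E) -> P.-integrable setT (fun w => (f w)%:E).
Proof.
move=> mf f2; have := integrable_mul_sqr mf (measurable_cst (1 : R)) f2.
move=> /(_ _); have -> : (fun w => (f w * cst (1 : R) w)%:E) = (fun w : T => (f w)%:E).
  by apply/funext => w; rewrite mulr1.
by apply; have := intC (1 ^+ 2).
Qed.

Let rowsig i := sigma_rv (fun k : 'I_2 * 'I_n => Z i k.1 k.2 : T -> R).

Let mrow i k : measurable_fun
  (setT : set (sigma_rv_type (fun k : 'I_2 * 'I_n => Z i k.1 k.2 : T -> R)))
  (Z i k.1 k.2).
Proof.
exact: (@measurable_sigma_rv _ _ _ _ (fun k : 'I_2 * 'I_n => Z i k.1 k.2 : T -> R) k).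
Qed.

Let rows_indep (f g : T -> R) i j : i != j ->
  (forall A, measurable A -> rowsig i (f @^-1` A)) ->
  (forall A, measurable A -> rowsig j (g @^-1` A)) ->
  measurable_fun setT f -> measurable_fun setT g ->
  P.-integrable setT (fun w => (f w)%:E) -> P.-integrable setT (fun w => (g w)%:E) ->
  (\int[P]_w (f w * g w)%:E = \int[P]_w (f w)%:E * \int[P]_w (g w)%:E)%E.
Proof.
move=> ij fA gB mf mg intf intg; apply: indep_integral_mul => // A B mA mB.
case: A4 => _ _ _ ind _.
by apply: (mutual_indep2 ind ij); [exact: fA|exact: gB].
Qed.

(** Bounded fourth moments of the entries bound the second moments of the centred products;
    independence of the rows makes these products orthogonal. *)
Lemma ae_mean_ZZ (k k' : 'I_2 * 'I_n) :
  {ae P, forall w, (fun p : nat =>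
     p%:R^-1 * \sum_(0 <= i < p) (Z i k.1 k.2 w * Z i k'.1 k'.2 w))
     @ \oo --> (if k == k' then delta ^+ 2 else 0 : R)}.
Proof.
set c : R := if _ then _ else _.
have mZZ i : measurable_fun setT (fun w => Z i k.1 k.2 w * Z i k'.1 k'.2 w - c).
  by apply: measurable_funB => //; exact: measurable_funM.
have [K ZK] : exists K : R, forall i t j, (\int[P]_w (Z i t j w ^+ 4)%:E <= K%:E)%E.
  by case: A4 => _ _ [K h] _ _; exists K => i t j; have := h i t j; rewrite unlock.
have intZ4 i t j : P.-integrable setT (fun w => (Z i t j w ^+ 4)%:E).
  have -> : (fun w => (Z i t j w ^+ 4)%:E) = (fun w => ((Z i t j w ^+ 2) ^+ 2)%:E).
    by apply/funext => w; rewrite -exprM.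
  apply: (@integrable_sqr _ _ _ P (fun w => Z i t j w ^+ 2) K).
    exact: measurable_funX.
  by under eq_integral do rewrite -exprM.
have le4 i w : (Z i k.1 k.2 w * Z i k'.1 k'.2 w - c) ^+ 2 <=
   Z i k.1 k.2 w ^+ 4 + Z i k'.1 k'.2 w ^+ 4 + 2 * c ^+ 2.
  move: (Z i k.1 k.2 w) (Z i k'.1 k'.2 w) => a b.
  rewrite -subr_ge0.
  rewrite (_ : _ - _ = (a ^+ 2 - b ^+ 2) ^+ 2 + (a * b + c) ^+ 2); last by ring.
  by rewrite addr_ge0 ?sqr_ge0.
have YC i : (\int[P]_w ((Z i k.1 k.2 w * Z i k'.1 k'.2 w - c) ^+ 2)%:E <=
    (K + K + 2 * c ^+ 2)%:E)%E.
  have m4 t j : measurable_fun setT (fun w => (Z i t j w ^+ 4)%:E).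
    by apply/measurable_EFinP; exact: measurable_funX.
  apply: (@le_trans _ _ (\int[P]_w
      ((Z i k.1 k.2 w ^+ 4)%:E + (Z i k'.1 k'.2 w ^+ 4)%:E + (2 * c ^+ 2)%:E))%E).
    apply: ge0_le_integral => //.
    - by move=> w _; rewrite lee_fin sqr_ge0.
    - by apply/measurable_EFinP; exact: measurable_funX.
    - by apply: emeasurable_funD => //; exact: emeasurable_funD.
    - by move=> w _; rewrite -!EFinD lee_fin.
  rewrite integralD//; last exact: integrableD.
  rewrite integralD// EC !EFinD.
  by rewrite leeD2r// leeD.
have intYY i : P.-integrable setT (fun w => (Z i k.1 k.2 w * Z i k'.1 k'.2 w - c)%:E).
  by apply: intsq => //; exact: integrable_sqr (YC i).
have EY i : (\int[P]_w (Z i k.1 k.2 w * Z i k'.1 k'.2 w - c)%:E = 0)%E.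
  under eq_integral do rewrite EFinB.
  rewrite integralB// EZZ -/c EC.
  by rewrite subee.
have Y0 i j : i != j -> (\int[P]_w
    ((Z i k.1 k.2 w * Z i k'.1 k'.2 w - c)
     * (Z j k.1 k.2 w * Z j k'.1 k'.2 w - c))%:E = 0)%E.
  move=> ij; rewrite (rows_indep ij)// ?EY ?mul0e//.
  - move=> A mA; apply: sigma_rv_preimage mA; apply: measurable_funB => //.
    by apply: measurable_funM; exact: mrow.
  - move=> A mA; apply: sigma_rv_preimage mA; apply: measurable_funB => //.
    by apply: measurable_funM; exact: mrow.
have := orthogonal_slln mZZ YC Y0.
apply: filterS => w Yw.
rewrite -[c]add0r.
have h : (fun p : nat =>
    p%:R^-1 * (\sum_(0 <= i < p) (Z i k.1 k.2 w * Z i k'.1 k'.2 w - c)) + c)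
    @ \oo --> (0 + c : R).
  by apply: cvgD => //; exact: cvg_cst.
apply: cvg_trans h; apply: near_eq_cvg; exists 1%N => // p /= p0.
rewrite sumrB mulrBr sumr_const_nat subn0 -[c *+ p]mulr_natl mulrA.
by rewrite mulVf ?pnatr_eq0 ?gtn_eqF// mul1r subrK.
Qed.

Let EZiZj i j k : i != j -> (\int[P]_w (Z i k.1 k.2 w * Z j k.1 k.2 w)%:E = 0)%E.
Proof.
move=> ij; rewrite (rows_indep ij)// ?EZ ?mul0e//.
- by move=> A mA; apply: sigma_rv_preimage mA; exact: mrow.
- by move=> A mA; apply: sigma_rv_preimage mA; exact: mrow.
- exact: intsq.
- exact: intsq.
Qed.

Lemma ae_mean_Z (k : 'I_2 * 'I_n) :
  {ae P, forall w, (fun p : nat => p%:R^-1 * \sum_(0 <= i < p) Z i k.1 k.2 w)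
     @ \oo --> (0 : R)}.
Proof.
apply: (@orthogonal_slln _ _ _ P (fun i => Z i k.1 k.2) (delta ^+ 2)) => //.
  by move=> i; rewrite EZ2.
by move=> i j ij; exact: EZiZj.
Qed.

(** The loadings are independent of the noise, so the expectation of a cross term splits, and its
    noise factor vanishes between distinct rows. Boundedness of the loadings controls the second
    moments. *)
Lemma ae_mean_betaZ (t : 'I_2) (k : 'I_2 * 'I_n) :
  {ae P, forall w,
    (fun p : nat => p%:R^-1 * \sum_(0 <= i < p) (beta t i w * Z i k.1 k.2 w))
     @ \oo --> (0 : R)}.
Proof.
case: A1 => -[M bM] _ _.
have intb2 i : P.-integrable setT (fun w => (beta t i w ^+ 2)%:E).
  apply: (@integrable_sqr _ _ _ _ _ (M ^+ 2)) => //.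
  rewrite -(EC (M ^+ 2)); apply: ae_ge0_le_integral => //.
  - by move=> w _; rewrite lee_fin sqr_ge0.
  - by apply/measurable_EFinP; exact: measurable_funX.
  - by move=> w _; rewrite lee_fin sqr_ge0.
  - apply: filterS (bM t i) => w bw _.
    rewrite lee_fin -(real_normK (num_real (beta t i w))).
    by rewrite ler_pXn2r// nnegrE// (le_trans _ bw).
apply: (@orthogonal_slln _ _ _ P (fun i w => beta t i w * Z i k.1 k.2 w)
  (M ^+ 2 * delta ^+ 2)) => //.
- by move=> i; exact: measurable_funM.
- move=> i; rewrite EFinM -(EZ2 i k.1 k.2).
  have -> : ((M ^+ 2)%:E * \int[P]_w (Z i k.1 k.2 w ^+ 2)%:E =
      \int[P]_w ((M ^+ 2)%:E * (Z i k.1 k.2 w ^+ 2)%:E))%E.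
    by rewrite integralZl.
  have mZ2 : measurable_fun setT (fun w => (Z i k.1 k.2 w ^+ 2)%:E).
    by apply/measurable_EFinP; exact: measurable_funX.
  apply: ae_ge0_le_integral => //.
  - by move=> w _; rewrite lee_fin sqr_ge0.
  - by apply/measurable_EFinP; apply: measurable_funX; exact: measurable_funM.
  - by move=> w _; rewrite -EFinM lee_fin mulr_ge0 ?sqr_ge0.
  - under eq_fun do rewrite -EFinM.
    by apply/measurable_EFinP; apply: measurable_funM => //; exact: measurable_funX.
  - apply: filterS (bM t i) => w bw _; rewrite -EFinM lee_fin exprMn ler_wpM2r ?sqr_ge0//.
    rewrite -(real_normK (num_real (beta t i w))).
    by rewrite ler_pXn2r// nnegrE// (le_trans _ bw).
move=> i j ij.
have -> : (\int[P]_w (beta t i w * Z i k.1 k.2 w * (beta t j w * Z j k.1 k.2 w))%:E =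
    \int[P]_w ((beta t i w * beta t j w) * (Z i k.1 k.2 w * Z j k.1 k.2 w))%:E)%E.
  by apply: eq_integral => w _; rewrite mulrACA.
rewrite (@indep_integral_mul _ _ _ P (fun w => beta t i w * beta t j w)
  (fun w => Z i k.1 k.2 w * Z j k.1 k.2 w)).
- by rewrite EZiZj// mule0.
- exact: measurable_funM.
- exact: measurable_funM.
- move=> A B mA mB.
  pose bf (k : 'I_2 * nat) : T -> R := beta k.1 k.2.
  pose Zf (k : nat * 'I_2 * 'I_n) : T -> R := Z k.1.1 k.1.2 k.2.
  have mbs l : measurable_fun (setT : set (sigma_rv_type bf)) (beta t l).
    exact: (@measurable_sigma_rv _ _ _ _ bf (t, l)).
  have mZs l : measurable_fun (setT : set (sigma_rv_type Zf)) (Z l k.1 k.2).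
    exact: (@measurable_sigma_rv _ _ _ _ Zf (l, k.1, k.2)).
  have sb := sigma_rv_preimage (measurable_funM (mbs i) (mbs j)) mA.
  have sZ := sigma_rv_preimage (measurable_funM (mZs i) (mZs j)) mB.
  have := A2 sb (@sigma_rv_setT _ _ _ _ _) sZ.
  by rewrite setIT probability_setT mule1.
- exact: integrable_mul_sqr.
- exact: integrable_mul_sqr.
Qed.

End model_lln.

(** * Principal components of a sequence of matrices *)

Lemma cvg_sumr (R : realType) (T : Type) (F : set_system T) {FF : Filter F}
    (I : Type) (r : seq I) (f : I -> T -> R) (l : I -> R) :
  (forall i, f i x @[x --> F] --> l i) ->
  \sum_(i <- r) f i x @[x --> F] --> \sum_(i <- r) l i.
Proof.
by move=> fl; apply: cvg_big => //; exact: add_continuous.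
Qed.

Section dotv.
Context {R : realType}.

Lemma dotvE p (u v : 'rV[R]_p) : dotv u v = \sum_i u 0 i * v 0 i.
Proof. by rewrite /dotv mxE; apply: eq_bigr => i _; rewrite mxE. Qed.

Lemma dotvC p (u v : 'rV[R]_p) : dotv u v = dotv v u.
Proof. by rewrite !dotvE; apply: eq_bigr => i _; rewrite mulrC. Qed.

Lemma dotvDl p (u v w : 'rV[R]_p) : dotv (u + v) w = dotv u w + dotv v w.
Proof. by rewrite /dotv mulmxDl mxE. Qed.

Lemma dotvDr p (u v w : 'rV[R]_p) : dotv w (u + v) = dotv w u + dotv w v.
Proof. by rewrite dotvC dotvDl !(dotvC _ w). Qed.

Lemma dotvZl p a (u v : 'rV[R]_p) : dotv (a *: u) v = a * dotv u v.
Proof. by rewrite /dotv -scalemxAl mxE. Qed.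

Lemma dotvZr p a (u v : 'rV[R]_p) : dotv u (a *: v) = a * dotv u v.
Proof. by rewrite dotvC dotvZl dotvC. Qed.

Lemma dotvNl p (u v : 'rV[R]_p) : dotv (- u) v = - dotv u v.
Proof. by rewrite -scaleN1r dotvZl mulN1r. Qed.

Lemma dotvNr p (u v : 'rV[R]_p) : dotv u (- v) = - dotv u v.
Proof. by rewrite dotvC dotvNl dotvC. Qed.

Lemma dotvv_ge0 p (u : 'rV[R]_p) : 0 <= dotv u u.
Proof. by rewrite dotvE sumr_ge0// => i _; rewrite -expr2 sqr_ge0. Qed.

Lemma dotv_mulmx p m (x : 'rV[R]_p) (A : 'M[R]_(p, m)) (y : 'rV[R]_m) :
  dotv (x *m A) y = dotv x (y *m A^T).
Proof. by rewrite /dotv trmx_mul trmxK mulmxA. Qed.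

Lemma sqr_coord_le p (u : 'rV[R]_p) i : u 0 i ^+ 2 <= dotv u u.
Proof.
rewrite dotvE (bigD1 i)//= -expr2 lerDl sumr_ge0// => j _.
by rewrite -expr2 sqr_ge0.
Qed.

Lemma dotv_unit_le p (u k : 'rV[R]_p) : dotv k k = 1 -> dotv u k ^+ 2 <= dotv u u.
Proof.
move=> k1; have := dotvv_ge0 (u - dotv u k *: k).
rewrite !(dotvDl, dotvDr, dotvNl, dotvNr, dotvZl, dotvZr) k1 (dotvC k u).
by move: (dotv u u) (dotv u k) => a b; lra.
Qed.

Lemma dotv_cauchy p (u v : 'rV[R]_p) : dotv u v ^+ 2 <= dotv u u * dotv v v.
Proof.
have [v0|v0] := eqVneq (dotv v v) 0.
  by rewrite (dotv_eq0 v0) /dotv trmx0 !mulmx0 !mxE expr0n mulr0.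
have vp : 0 < dotv v v by rewrite lt0r v0 dotvv_ge0.
have := dotvv_ge0 (dotv v v *: u - dotv u v *: v).
rewrite !(dotvDl, dotvDr, dotvNl, dotvNr, dotvZl, dotvZr) (dotvC v u).
rewrite (_ : _ + _ = dotv v v * (dotv u u * dotv v v - dotv u v ^+ 2)); last by ring.
by rewrite pmulr_rge0// subr_ge0.
Qed.

Lemma cvg_dotv p (T : Type) (F : set_system T) {FF : Filter F}
    (u v : T -> 'rV[R]_p) (a b : 'rV[R]_p) :
  (forall i, u x 0 i @[x --> F] --> a 0 i) ->
  (forall i, v x 0 i @[x --> F] --> b 0 i) ->
  dotv (u x) (v x) @[x --> F] --> dotv a b.
Proof.
move=> ua vb; rewrite dotvE; under eq_fun do rewrite dotvE.
by apply: cvg_sumr => i; exact: cvgM.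
Qed.

Lemma cvg_mulmx_coord m n p (T : Type) (F : set_system T) {FF : Filter F}
    (A : T -> 'M[R]_(m, n)) (B : T -> 'M[R]_(n, p))
    (A0 : 'M[R]_(m, n)) (B0 : 'M[R]_(n, p)) :
  (forall i j, A x i j @[x --> F] --> A0 i j) ->
  (forall i j, B x i j @[x --> F] --> B0 i j) ->
  forall i j, (A x *m B x) i j @[x --> F] --> (A0 *m B0) i j.
Proof.
move=> ua vb i j; rewrite mxE; under eq_fun do rewrite mxE.
by apply: cvg_sumr => k; exact: cvgM.
Qed.

End dotv.

(** * Rayleigh quotients and the largest eigenvalue *)

Section rayleigh.
Context {R : realType}.

(** A maximizer [v] on the unit sphere exists by compactness. The residual [v *m S - a *: v] is
    orthogonal to [v], and moving [v] along it would increase the quotient unless it is 0. *)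
Lemma rayleigh_max p (S : 'M[R]_p) : (0 < p)%N -> S^T = S ->
  exists a (v : 'rV[R]_p), [/\ dotv v v = 1, v *m S = a *: v &
    forall x, dotv (x *m S) x <= a * dotv x x].
Proof.
move=> p0 symS.
pose A := [set x : 'rV[R]_p | dotv x x = 1].
have A0 : A !=set0.
  exists (delta_mx 0 (Ordinal p0)); rewrite /A /= dotvE (bigD1 (Ordinal p0))//=.
  rewrite big1 ?addr0 => [|i ip]; first by rewrite mxE !eqxx mulr1.
  by rewrite mxE eqxx (negPf ip) mulr0.
have cdot (B : 'M[R]_p) : continuous (fun x : 'rV[R]_p => dotv (x *m B) x).
  move=> x; apply: (@cvg_dotv _ _ _ (nbhs x)) => i; last exact: coord_continuous.
  apply: (@cvg_mulmx_coord _ _ _ _ _ (nbhs x)) => k l; first exact: coord_continuous.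
  exact: cvg_cst.
have cA : compact A.
  apply: bounded_closed_compact.
    exists 1; split => // M M1 x Ax; rewrite /Num.norm/= mx_normrE.
    apply/bigmax_leP; split => [|[i j] _ /=]; first by rewrite (le_trans _ (ltW M1)).
    rewrite (ord1 i) (le_trans _ (ltW M1))// -(@ler_pXn2r _ 2)// ?nnegrE//.
    by rewrite expr1n real_normK ?num_real// -Ax sqr_coord_le.
  have -> : A = (fun x : 'rV[R]_p => dotv (x *m 1%:M) x) @^-1` [set 1].
    by apply/seteqP; split => x /=; rewrite mulmx1.
  apply: preimage_closed; last exact: closed_eq.
  by move=> x _; exact: cdot.
have [v Av vmax] := EVT_max_rV A0 cA (continuous_subspaceT (cdot S)).
move: Av; rewrite inE => Av.
pose a := dotv (v *m S) v.
have amax x : dotv (x *m S) x <= a * dotv x x.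
  have [x0|x0] := eqVneq (dotv x x) 0.
    by rewrite (dotv_eq0 x0) mul0mx /dotv !mul0mx mxE mulr0.
  have xp : 0 < dotv x x by rewrite lt0r x0 dotvv_ge0.
  pose c := (Num.sqrt (dotv x x))^-1.
  have cc : c * c = (dotv x x)^-1.
    by rewrite /c -invfM -expr2 sqr_sqrtr ?dotvv_ge0.
  have := vmax (c *: x).
  rewrite inE /A/= -scalemxAl !dotvZl !dotvZr !mulrA cc mulVf// => /(_ erefl).
  by rewrite mulrC ler_pdivrMr.
exists a, v; split => //.
apply/eqP; rewrite -subr_eq0; apply/eqP/dotv_eq0.
set w := _ - _.
have vw : dotv v w = 0.
  by rewrite /w dotvDr dotvNr dotvZr Av mulr1 dotvC subrr.
have vSw : dotv (v *m S) w = dotv w w.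
  by rewrite {2}/w dotvDl dotvNl dotvZl vw mulr0 subr0.
clearbody w.
(* Perturb [v] to [v + t w]: the linear term in [t] must vanish *)
have H t : 2 * t * dotv w w <= t ^+ 2 * (a * dotv w w - dotv (w *m S) w).
  have := amax (v + t *: w).
  rewrite !(mulmxDl, dotvDl, dotvDr) -!scalemxAl !(dotvZl, dotvZr).
  rewrite (dotv_mulmx w S v) symS (dotvC w (v *m S)) vSw (dotvC w v) vw Av -/a.
  by lra.
set c := a * _ - _ in H.
have W0 := dotvv_ge0 w; have [//|W1] := eqVneq (dotv w w) 0.
have Wp : 0 < dotv w w by rewrite lt0r W1.
have c0 : 0 <= c by rewrite subr_ge0.
(* At this [t] the linear term exceeds the quadratic one; [1 + c] rather than [c], which may be
   0. *)
have := H (dotv w w / (1 + c)).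
have c1 : 0 < 1 + c by rewrite ltr_pwDl.
rewrite -subr_ge0 (_ : _ - _ = - (dotv w w ^+ 2 * (2 + c)) / (1 + c) ^+ 2); last first.
  by field; rewrite gt_eqF.
rewrite mulNr oppr_ge0 leNgt => /negP; case.
by rewrite divr_gt0 ?mulr_gt0 ?exprn_gt0// ltr_pwDl.
Qed.

Lemma scov_sym p m (Y : 'M[R]_(p, m)) : (scov Y)^T = scov Y.
Proof. by rewrite /scov linearZ/= trmx_mul trmxK. Qed.

(** The maximizer of the quotient is an eigenvector and its value bounds every eigenvalue, so the
    supremum defining [s2] is attained there. *)
Lemma rayleigh_s2 p m (Y : 'M[R]_(p, m)) (x : 'rV[R]_p) : (0 < p)%N ->
  dotv (x *m scov Y) x <= s2 Y * dotv x x.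
Proof.
move=> p0; have [a [v [v1 va amax]]] := rayleigh_max p0 (scov_sym Y).
have Ea : [set a | eigenvalue (scov Y) a] a.
  apply/eigenvalueP; exists v => //; apply/eqP => v0; move: v1.
  by rewrite v0 /dotv mul0mx mxE => /eqP; rewrite eq_sym oner_eq0.
suff -> : s2 Y = a by exact: amax.
have ub : ubound [set a | eigenvalue (scov Y) a] a.
  move=> b /= /eigenvalueP[u ub u0].
  have up : 0 < dotv u u.
    rewrite lt0r dotvv_ge0 andbT; apply/eqP => /dotv_eq0 u00.
    by rewrite u00 eqxx in u0.
  by have := amax u; rewrite ub dotvZl ler_pM2r.
apply/eqP; rewrite eq_le; apply/andP; split.
  by apply: ge_sup => //; exists a.
have hs : has_sup [set a | eigenvalue (scov Y) a] by split; exists a.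
exact: sup_upper_bound hs _ Ea.
Qed.

End rayleigh.

(** * Passage from the covariance to the Gram matrix *)

Section pca_finite.
Context {R : realType}.
Variables (p m : nat) (p0 : (0 < p)%N) (m0 : (0 < m)%N) (Y : 'M[R]_(p, m)) (h : 'rV[R]_p).

(* The nonzero eigenvalues of [p^-1 Y Y^T], of growing size, are those of the Gram
   matrix, of fixed size [m]; [lscore] maps eigenvectors of the former to
   eigenvectors of the latter. *)
Definition gram : 'M[R]_m := p%:R^-1 *: (Y^T *m Y).
Definition lscore k (x : 'M[R]_(k, p)) : 'M[R]_(k, m) := (Num.sqrt p%:R)^-1 *: (x *m Y).
Definition topval : R := m%:R * s2 Y / p%:R.

Hypothesis hh : is_pca Y h.

Let pR : p%:R != 0 :> R. Proof. by rewrite pnatr_eq0 -lt0n. Qed.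
Let mR : m%:R != 0 :> R. Proof. by rewrite pnatr_eq0 -lt0n. Qed.
Let sqp : (Num.sqrt p%:R)^-1 * (Num.sqrt p%:R)^-1 = p%:R^-1 :> R.
Proof. by rewrite -invfM -expr2 sqr_sqrtr. Qed.

Let hYY : h *m Y *m Y^T = (m%:R * s2 Y) *: h.
Proof.
case: hh => /eigenspaceP; rewrite /scov -scalemxAr => e _ _.
by rewrite -scalerA -e scalerA divff// scale1r mulmxA.
Qed.

Lemma enorm1_dotv : dotv h h = 1.
Proof.
case: hh => _ h1 _; rewrite -(sqr_sqrtr (dotvv_ge0 h)).
by rewrite -[Num.sqrt _]/(enorm h) h1 expr1n.
Qed.

Lemma lscore_gram : lscore h *m gram = topval *: lscore h.
Proof.
rewrite /lscore /gram /topval -scalemxAl -scalemxAr !scalerA mulmxA hYY.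
by rewrite -scalemxAl scalerA; congr (_ *: _); ring.
Qed.

(** Gives the scores of [h] against another returns matrix; with the two blocks this is how the
    inner product of [h_1] and [h_2] is reached. *)
Lemma lscore_cross m' (Y' : 'M[R]_(p, m')) :
  lscore h *m (p%:R^-1 *: (Y^T *m Y')) = topval *: ((Num.sqrt p%:R)^-1 *: (h *m Y')).
Proof.
rewrite /lscore /topval -scalemxAl -scalemxAr !scalerA mulmxA hYY.
by rewrite -scalemxAl scalerA; congr (_ *: _); ring.
Qed.

(** Carries inner products with [h] from dimension [p] to the fixed dimension [m], where limits can
    be taken coordinate by coordinate. *)
Lemma dotv_lscore (x : 'rV[R]_p) : dotv (lscore h) (lscore x) = topval * dotv h x.
Proof.
rewrite /lscore dotvZl dotvZr mulrA sqp dotvC dotv_mulmx hYY dotvZr dotvC.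
by rewrite /topval; ring.
Qed.

(** The Rayleigh bound for [scov Y] at the test vector [k *m Y^T]. When [k] is the top eigenvector
    of the limit, it yields a lower bound on [topval] that tends to the limit eigenvalue. *)
Lemma rayleigh_gram (k : 'rV[R]_m) :
  dotv (k *m gram) (k *m gram) <= topval * dotv (k *m gram) k.
Proof.
have := rayleigh_s2 Y (k *m Y^T) p0.
have -> : dotv (k *m Y^T *m scov Y) (k *m Y^T) =
    m%:R^-1 * dotv (k *m Y^T *m Y) (k *m Y^T *m Y).
  by rewrite /scov -scalemxAr dotvZl (mulmxA _ Y) dotv_mulmx trmxK.
have -> : dotv (k *m Y^T) (k *m Y^T) = dotv (k *m Y^T *m Y) k.
  by rewrite [RHS]dotv_mulmx.
have -> : k *m Y^T *m Y = p%:R *: (k *m gram).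
  by rewrite /gram -scalemxAr scalerA divff// scale1r mulmxA.
rewrite !(dotvZl, dotvZr).
set A := dotv _ _; set B := dotv _ _ => H.
have m1 : 0 < m%:R :> R by rewrite ltr0n.
have p1 : 0 < p%:R :> R by rewrite ltr0n.
have : 0 <= m%:R / p%:R ^+ 2 * (s2 Y * (p%:R * B) - m%:R^-1 * (p%:R * (p%:R * A))).
  by rewrite mulr_ge0 ?subr_ge0// divr_ge0 ?exprn_ge0 ?ltW.
have -> : m%:R / p%:R ^+ 2 * (s2 Y * (p%:R * B) - m%:R^-1 * (p%:R * (p%:R * A))) =
    topval * B - A by rewrite /topval; field; rewrite pR mR.
by rewrite subr_ge0.
Qed.

End pca_finite.

Lemma dotv_mx_le (R : realType) m (E : 'M[R]_m) (x : 'rV[R]_m) :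
  dotv (x *m E) x <= (\sum_i \sum_j `|E i j|) * dotv x x.
Proof.
rewrite dotvE mulr_suml; under eq_bigr do rewrite mxE mulr_suml.
rewrite exchange_big/=; apply: ler_sum => i _; rewrite mulr_suml; apply: ler_sum => j _.
rewrite -mulrA mulrCA (le_trans (ler_norm _))// normrM ler_wpM2l//.
rewrite (le_trans (ler_norm _))// normr_id normrM.
have := sqr_coord_le x i; have := sqr_coord_le x j.
rewrite -(real_normK (num_real (x 0 i))) -(real_normK (num_real (x 0 j))).
by move: `|_| `|_| (dotv _ _) => a b c; nra.
Qed.

Lemma dotv_resid (R : realType) m (u k : 'rV[R]_m) : dotv k k = 1 ->
  dotv (u - dotv u k *: k) (u - dotv u k *: k) = dotv u u - dotv u k ^+ 2.
Proof.
move=> k1; rewrite !(dotvDl, dotvDr, dotvNl, dotvNr, dotvZl, dotvZr) k1 (dotvC k).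
by ring.
Qed.

(** * Convergence of principal components under a spectral gap *)

Section pca_cvg.
Context {R : realType}.
Variables (m : nat) (m0 : (0 < m)%N).
Variables (Y : forall p, 'M[R]_(p, m)) (h : forall p, 'rV[R]_p).
Hypothesis hh : forall p, (0 < p)%N -> is_pca (Y p) (h p).
Variables (G : 'M[R]_m) (k a : 'rV[R]_m) (lam lam' : R).
Hypothesis cG : forall i j, (fun p => gram (Y p) i j) @ \oo --> G i j.
Hypothesis ca : forall j, (fun p => lscore (Y p) (qvec p) 0 j) @ \oo --> a 0 j.
Hypotheses (k1 : dotv k k = 1) (kG : k *m G = lam *: k).
Hypotheses (lam0 : 0 < lam) (gap : lam' < lam).
Hypothesis gapG : forall x,
  dotv (x *m G) x <= lam * dotv x k ^+ 2 + lam' * (dotv x x - dotv x k ^+ 2).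
Hypothesis ak : 0 < dotv a k.

Let u p := lscore (Y p) (h p).
Let l p := topval (Y p).
Let eps p := \sum_i \sum_j `|(gram (Y p) - G) i j|.

Let near0 : \forall p \near \oo, (0 < p)%N.
Proof. by exists 1%N. Qed.

Let ceps : eps @ \oo --> 0.
Proof.
have <- : \sum_(i < m) \sum_(j < m) (0 : R) = 0 by rewrite big1// => i _; rewrite big1.
apply: cvg_sumr => i; apply: cvg_sumr => j.
rewrite -[X in _ --> X](@normr0 _ R) -(subrr (G i j)); apply: cvg_norm.
have -> : (fun p => (gram (Y p) - G) i j) = (fun p => gram (Y p) i j - G i j).
  by apply/funext => p; rewrite !mxE.
by apply: cvgB => //; exact: cvg_cst.
Qed.

Let uu p : (0 < p)%N -> dotv (u p) (u p) = l p.
Proof.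
by move=> p0; rewrite /u dotv_lscore ?(enorm1_dotv (hh p0)) ?mulr1//; exact: hh.
Qed.

Let ckG i : (fun p => (k *m gram (Y p)) 0 i) @ \oo --> (lam *: k) 0 i.
Proof. by rewrite -kG; apply: cvg_mulmx_coord => // *; exact: cvg_cst. Qed.

Let rq p := dotv (k *m gram (Y p)) (k *m gram (Y p)) / dotv (k *m gram (Y p)) k.

Let l_lower : \forall p \near \oo, rq p <= l p.
Proof.
have ck : (fun p => dotv (k *m gram (Y p)) k) @ \oo --> lam.
  rewrite -[lam]mulr1 -k1 -dotvZl; apply: cvg_dotv => //.
  by move=> i; exact: cvg_cst.
have : \forall p \near \oo, 0 < dotv (k *m gram (Y p)) k.
  by apply: (cvgr_gt _ ck).
apply: filterS2 near0 => p p0 kp; rewrite /rq ler_pdivrMr//.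
exact: rayleigh_gram.
Qed.

Let clower : rq @ \oo --> lam.
Proof.
have -> : lam = (lam * lam) / lam by rewrite mulfK ?gt_eqF.
apply: cvgM.
  rewrite -[lam * lam]mulr1 -k1 -mulrA -[lam * dotv k k]dotvZr -dotvZl.
  exact: cvg_dotv.
apply: cvgV; first by rewrite gt_eqF.
rewrite -[lam]mulr1 -k1 -dotvZl; apply: cvg_dotv => //.
by move=> i; exact: cvg_cst.
Qed.

Let lpos : \forall p \near \oo, 0 < l p.
Proof.
have : \forall p \near \oo, 0 < rq p.
  by apply: (cvgr_gt _ clower).
by apply: filterS2 l_lower => p; move=> h1 h2; exact: lt_le_trans h2 h1.
Qed.

(** The form of the Gram matrix at the score [u] is [l^2], while [u] has squared length [l];
    comparing with the limit form costs [eps * l]. Since the left side is non-negative, this bounds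
    [l] by [lam + eps]; once [l] tends to [lam], it forces the part of [u] orthogonal to [k] to
    vanish. *)
Let l_upper : \forall p \near \oo,
  (lam - lam') * (l p - dotv (u p) k ^+ 2) <= (eps p + lam - l p) * l p.
Proof.
near=> p.
have p0 : (0 < p)%N by near: p; exact: near0.
have H1 : dotv (u p *m gram (Y p)) (u p) = l p * l p.
  by rewrite {1}/u lscore_gram ?[dotv (topval _ *: _) _]dotvZl -/(u p) ?uu//; exact: hh.
have H2 := gapG (u p).
have H3 := dotv_mx_le (gram (Y p) - G) (u p).
move: H3; rewrite mulmxBr dotvDl dotvNl H1 -/(eps p) uu//.
move: H2; rewrite uu//.
lra.
Unshelve. all: by end_near.
Qed.

Let uk_le p : (0 < p)%N -> dotv (u p) k ^+ 2 <= l p.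
Proof. by move=> p0; rewrite -uu// dotv_unit_le. Qed.

Lemma topval_cvg : l @ \oo --> lam.
Proof.
apply: (squeeze_cvgr (f := rq) (h := fun p => eps p + lam)).
- near=> p; apply/andP; split; first by near: p; exact: l_lower.
  have p0 : (0 < p)%N by near: p; exact: near0.
  have lp : 0 < l p by near: p; exact: lpos.
  have up : (lam - lam') * (l p - dotv (u p) k ^+ 2) <= (eps p + lam - l p) * l p.
    by near: p; exact: l_upper.
  rewrite -subr_ge0 -(pmulr_lge0 _ lp) (le_trans _ up)//.
  by rewrite mulr_ge0 ?subr_ge0 ?(ltW gap) ?uk_le.
- exact: clower.
- by rewrite -[X in _ --> X]add0r; apply: cvgD => //; exact: cvg_cst.
Unshelve. all: by end_near.
Qed.

Let resid : (fun p => l p - dotv (u p) k ^+ 2) @ \oo --> 0.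
Proof.
apply: (squeeze_cvgr (f := fun=> 0)
  (h := fun p => (lam - lam')^-1 * ((eps p + lam - l p) * l p))).
- near=> p.
  have p0 : (0 < p)%N by near: p; exact: near0.
  rewrite subr_ge0 uk_le//= mulrC ler_pdivlMr ?subr_gt0// mulrC.
  by near: p; exact: l_upper.
- exact: cvg_cst.
- have -> : 0 = (lam - lam')^-1 * ((0 + lam - lam) * lam).
    by rewrite add0r subrr mul0r mulr0.
  apply: cvgM; first exact: cvg_cst.
  apply: cvgM; last exact: topval_cvg.
  apply: cvgB; last exact: topval_cvg.
  by apply: cvgD => //; exact: cvg_cst.
Unshelve. all: by end_near.
Qed.

Let w p := u p - dotv (u p) k *: k.

Let ww p : (0 < p)%N -> dotv (w p) (w p) = l p - dotv (u p) k ^+ 2.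
Proof.
by move=> p0; rewrite /w dotv_resid ?uu.
Qed.

Let cw j : (fun p => w p 0 j) @ \oo --> 0.
Proof.
apply: norm_cvg0.
apply: (squeeze_cvgr (f := fun=> 0) (h := fun p => Num.sqrt (l p - dotv (u p) k ^+ 2))).
- near=> p.
  have p0 : (0 < p)%N by near: p; exact: near0.
  by rewrite normr_ge0/= -sqrtr_sqr ler_wsqrtr// -ww// sqr_coord_le.
- exact: cvg_cst.
- rewrite -[X in _ --> X](@sqrtr0 R).
  by apply: (cvg_comp _ _ resid); exact: sqrt_continuous.
Unshelve. all: by end_near.
Qed.

(** Only the absolute value follows from the previous estimates. A negative [(u, k)] would bring the
    inner product of [u] with the score of [q] close to [- sqrt lam * (a, k) < 0], against
    [(h, q) >= 0]. *)
Let ctk : (fun p => dotv (u p) k) @ \oo --> Num.sqrt lam.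
Proof.
have cn : (fun p => `|dotv (u p) k|) @ \oo --> Num.sqrt lam.
  have : (fun p => dotv (u p) k ^+ 2) @ \oo --> lam.
    have -> : (fun p => dotv (u p) k ^+ 2) = (fun p => l p - (l p - dotv (u p) k ^+ 2)).
      by apply/funext => p; rewrite subKr.
    by rewrite -[lam]subr0; apply: cvgB; [exact: topval_cvg|exact: resid].
  move=> c2; under eq_fun do rewrite -sqrtr_sqr.
  by apply: (cvg_comp _ _ c2); exact: sqrt_continuous.
have cwa : (fun p => dotv (w p) (lscore (Y p) (qvec p))) @ \oo --> 0.
  rewrite -[X in _ --> X](_ : dotv 0 a = 0); last by rewrite /dotv mul0mx mxE.
  by apply: cvg_dotv => // i; rewrite mxE; exact: cw.
have cka : (fun p => dotv k (lscore (Y p) (qvec p))) @ \oo --> dotv a k.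
  by rewrite dotvC; apply: cvg_dotv => // i; exact: cvg_cst.
have sl : 0 < Num.sqrt lam by rewrite sqrtr_gt0.
have := cn; apply: cvg_trans; apply: near_eq_cvg.
near=> p.
have p0 : (0 < p)%N by near: p; exact: near0.
have kap : dotv a k / 2 < dotv k (lscore (Y p) (qvec p)).
  by near: p; apply: (cvgr_gt _ cka); rewrite ltr_pdivrMr// mulr_natr mulr2n ltrDl.
have tp : Num.sqrt lam / 2 < `|dotv (u p) k|.
  by near: p; apply: (cvgr_gt _ cn); rewrite ltr_pdivrMr// mulr_natr mulr2n ltrDl.
have wp : dotv (w p) (lscore (Y p) (qvec p)) < dotv a k / 2 * (Num.sqrt lam / 2).
  by near: p; apply: (cvgr_lt _ cwa); rewrite !mulr_gt0.
have lp : 0 < l p by near: p; exact: lpos.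
rewrite gtr0_norm// ltNge; apply/negP => t0.
have : 0 <= dotv (u p) (lscore (Y p) (qvec p)).
  rewrite dotv_lscore//; last exact: hh.
  by rewrite mulr_ge0 ?(ltW lp)//; case: (hh p0).
have -> : dotv (u p) (lscore (Y p) (qvec p)) =
    dotv (w p) (lscore (Y p) (qvec p)) + dotv (u p) k * dotv k (lscore (Y p) (qvec p)).
  by rewrite -dotvZl -dotvDl /w subrK.
move: tp; rewrite ler0_norm// => tp; apply/negP; rewrite -ltNge.
have a2 : 0 <= dotv a k / 2 by rewrite divr_ge0// ltW.
have s2' : 0 <= Num.sqrt lam / 2 by rewrite divr_ge0// ltW.
have := ltr_pM a2 s2' kap tp; rewrite mulrN => h1.
move: wp h1.
move: (dotv (w p) _) (dotv (u p) k) (dotv k _) (dotv a k / 2 * _) => x1 x2 x3 x4.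
by move=> h1 h2; rewrite -ltrBrDr sub0r mulrC (lt_trans h1).

Unshelve. all: by end_near.
Qed.

Lemma lscore_cvg j : (fun p => lscore (Y p) (h p) 0 j) @ \oo --> Num.sqrt lam * k 0 j.
Proof.
have -> : (fun p => lscore (Y p) (h p) 0 j) = (fun p => w p 0 j + dotv (u p) k * k 0 j).
  by apply/funext => p; rewrite /w !mxE subrK.
rewrite -[X in _ --> X]add0r; apply: cvgD => //.
by apply: cvgM => //; exact: cvg_cst.
Qed.

Lemma pca_dotv_cvg (x : forall p, 'rV[R]_p) (b : 'rV[R]_m) :
  (forall j, (fun p => lscore (Y p) (x p) 0 j) @ \oo --> b 0 j) ->
  (fun p => dotv (h p) (x p)) @ \oo --> dotv b k / Num.sqrt lam.
Proof.
move=> cb.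
have : (fun p => dotv (u p) (lscore (Y p) (x p)) / l p) @ \oo -->
    (Num.sqrt lam * dotv b k) / lam.
  apply: cvgM; last by apply: cvgV; [rewrite gt_eqF|exact: topval_cvg].
  rewrite dotvC -dotvZl; apply: cvg_dotv => // j; rewrite mxE; exact: lscore_cvg.
have sl : Num.sqrt lam != 0 by rewrite gt_eqF// sqrtr_gt0.
have -> : Num.sqrt lam * dotv b k / lam = dotv b k / Num.sqrt lam.
  by rewrite -{2}(sqr_sqrtr (ltW lam0)); field.
apply: cvg_trans; apply: near_eq_cvg; near=> p.
have p0 : (0 < p)%N by near: p; exact: near0.
have lp : 0 < l p by near: p; exact: lpos.
rewrite /u dotv_lscore//; last exact: hh.
by rewrite mulrAC divff ?mul1r// gt_eqF.
Unshelve. all: by end_near.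
Qed.

End pca_cvg.

(** * Limits of the estimators *)

Section est.
Context {R : realType}.

Lemma near_pos : \forall p \near \oo, (0 < p)%N.
Proof. by exists 1%N. Qed.

Lemma cvg_sqrt (T : Type) (F : set_system T) {FF : Filter F} (f : T -> R) (l : R) :
  f x @[x --> F] --> l -> Num.sqrt (f x) @[x --> F] --> Num.sqrt l.
Proof. by move=> fl; apply: (cvg_comp _ _ fl); exact: sqrt_continuous. Qed.

Lemma enorm_sqr p (u : 'rV[R]_p) : enorm u ^+ 2 = dotv u u.
Proof. by rewrite /enorm sqr_sqrtr ?dotvv_ge0. Qed.

Lemma qvec_unit p : (0 < p)%N -> dotv (qvec p) (qvec p) = 1 :> R.
Proof.
move=> p0; rewrite dotvE; under eq_bigr do rewrite mxE -expr2 exprVn sqr_sqrtr//.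
by rewrite sumr_const card_ord -[_ *+ p]mulr_natr mulVf// pnatr_eq0 -lt0n.
Qed.

Lemma normalize_unit p (u : 'rV[R]_p) : 0 < dotv u u ->
  dotv (normalize u) (normalize u) = 1.
Proof.
move=> u0; rewrite /normalize dotvZl dotvZr mulrA -invfM -expr2 enorm_sqr.
by rewrite mulVf// gt_eqF.
Qed.

(** For unit vectors [|v - b|^2 = 2 - 2 (v, b)], so errors are compared through cosines. *)
Lemma err_cvg (V b : forall p, 'rV[R]_p) (N Q : R) :
  (\forall p \near \oo, dotv (b p) (b p) = 1) ->
  (fun p => dotv (V p) (b p)) @ \oo --> N ->
  (fun p => dotv (V p) (V p)) @ \oo --> Q -> 0 < Q ->
  (fun p => enorm (normalize (V p) - b p)) @ \oo --> Num.sqrt (2 - 2 * (N / Num.sqrt Q)).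
Proof.
move=> b1 cN cQ Q0.
have : (fun p => Num.sqrt (2 - 2 * (dotv (V p) (b p) / Num.sqrt (dotv (V p) (V p)))))
   @ \oo --> Num.sqrt (2 - 2 * (N / Num.sqrt Q)).
  apply: cvg_sqrt; apply: cvgB; first exact: cvg_cst.
  apply: cvgM; first exact: cvg_cst.
  apply: cvgM => //; apply: cvgV; first by rewrite gt_eqF// sqrtr_gt0.
  exact: cvg_sqrt.
apply: cvg_trans; apply: near_eq_cvg; near=> p.
have bp : dotv (b p) (b p) = 1 by near: p.
have vp : 0 < dotv (V p) (V p) by near: p; exact: (cvgr_gt _ cQ).
rewrite /enorm; congr Num.sqrt.
rewrite dotvDl !dotvDr !dotvNl !dotvNr opprK bp normalize_unit// (dotvC (b p)).
by rewrite /normalize dotvZl /enorm; ring.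
Unshelve. all: by end_near.
Qed.

Lemma gps_cvg m (Y : forall p, 'M[R]_(p, m)) (h b : forall p, 'rV[R]_p) (c hb g Psi : R) :
  let tau := (Psi - c ^+ 2) / (1 - Psi) in
  let Q := tau ^+ 2 + 2 * tau * c ^+ 2 + c ^+ 2 in
  (forall p, (0 < p)%N -> is_pca (Y p) (h p)) ->
  (\forall p \near \oo, dotv (b p) (b p) = 1) ->
  (fun p => dotv (h p) (qvec p)) @ \oo --> c ->
  (fun p => dotv (h p) (b p)) @ \oo --> hb ->
  (fun p => dotv (qvec p) (b p)) @ \oo --> g ->
  (fun p => psi (Y p) ^+ 2) @ \oo --> Psi -> Psi < 1 -> 0 < Q ->
  (fun p => enorm (gps (Y p) (h p) - b p)) @ \oo -->
    Num.sqrt (2 - 2 * ((tau * hb + c * g) / Num.sqrt Q)).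
Proof.
move=> tau Q hh b1 cc chb cg cPsi Psi1 Q0.
pose t p := (psi (Y p) ^+ 2 - dotv (h p) (qvec p) ^+ 2) / (1 - psi (Y p) ^+ 2).
have ct : t @ \oo --> tau.
  apply: cvgM; first by apply: cvgB => //; exact: cvgM.
  apply: cvgV; first by rewrite subr_eq0 gt_eqF.
  by apply: cvgB => //; exact: cvg_cst.
apply: (@err_cvg (fun p => t p *: h p + dotv (h p) (qvec p) *: qvec p)) => //.
  under eq_fun do rewrite dotvDl !dotvZl.
  by apply: cvgD; exact: cvgM.
have : (fun p => t p ^+ 2 + 2 * t p * dotv (h p) (qvec p) ^+ 2
    + dotv (h p) (qvec p) ^+ 2) @ \oo --> Q.
  apply: cvgD; last exact: cvgM.
  apply: cvgD; first exact: cvgM.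
  apply: cvgM; last exact: cvgM.
  by apply: cvgM => //; exact: cvg_cst.
apply: cvg_trans; apply: near_eq_cvg; near=> p.
have p0 : (0 < p)%N by near: p; exact: near_pos.
rewrite !(dotvDl, dotvDr, dotvZl, dotvZr) (enorm1_dotv (hh p p0)) qvec_unit//.
by rewrite (dotvC (qvec p) (h p)); ring.
Unshelve. all: by end_near.
Qed.

Lemma oproj_uniq k p (A : 'M[R]_(k, p)) (x y : 'rV[R]_p) :
  (y <= A)%MS -> (forall w : 'rV[R]_p, (w <= A)%MS -> dotv (x - y) w = 0) ->
  oproj A x = y.
Proof.
move=> yA yo; have [oA oo] := oprojP A x.
apply/eqP; rewrite -subr_eq0; apply/eqP/dotv_eq0.
have dA : (oproj A x - y <= A)%MS by rewrite addmx_sub// eqmx_opp.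
have := yo _ dA; have := oo _ dA; rewrite !dotvDl !dotvNl => h1 h2.
rewrite -[RHS]subr0 -{1}h2 -h1; ring.
Qed.

Lemma dotv_orth_col p (z h1 q w : 'rV[R]_p) : dotv z h1 = 0 -> dotv z q = 0 ->
  (w <= col_mx h1 q)%MS -> dotv z w = 0.
Proof.
move=> zh zq /submxP[D ->].
rewrite -[D]hsubmxK mul_row_col dotvDr /dotv !trmx_mul !mulmxA.
rewrite (mx11_scalar (z *m h1^T)) (mx11_scalar (z *m q^T)).
by rewrite -/(dotv z h1) -/(dotv z q) zh zq !mul_scalar_mx !scale0r !mxE addr0.
Qed.

Lemma oproj2 p (h1 q x : 'rV[R]_p) :
  let e := h1 - dotv h1 q *: q in
  dotv q q = 1 -> dotv e e != 0 ->
  oproj (col_mx h1 q) x = dotv x q *: q + (dotv x e / dotv e e) *: e.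
Proof.
move=> e q1 e0.
have qe : dotv q e = 0.
  by rewrite /e dotvDr dotvNr dotvZr q1 mulr1 dotvC subrr.
have qA : (q <= col_mx h1 q)%MS by rewrite -addsmxE addsmxSr.
have hA : (h1 <= col_mx h1 q)%MS by rewrite -addsmxE addsmxSl.
have eA : (e <= col_mx h1 q)%MS by rewrite addmx_sub// eqmx_opp scalemx_sub.
apply: oproj_uniq; first by rewrite addmx_sub// scalemx_sub.
set z := x - _.
have zq : dotv z q = 0.
  by rewrite /z dotvDl dotvNl dotvDl !dotvZl q1 mulr1 (dotvC e) qe mulr0 addr0 subrr.
have ze : dotv z e = 0.
  by rewrite /z dotvDl dotvNl dotvDl !dotvZl qe mulr0 add0r divfK// subrr.
have zh : dotv z h1 = 0.
  have -> : h1 = e + dotv h1 q *: q by rewrite subrK.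
  by rewrite dotvDr dotvZr ze zq mulr0 addr0.
by move=> w; exact: dotv_orth_col.
Qed.

(** With [e] the residual of [h1] off [q], [he], [be] and [ee] are the limits of its inner products
    with [h], [b] and itself. [U] is the limit of the squared length of the projection of [h], [UB]
    that of its inner product with [b]. As [0 < U], the branch of [maps] for a zero projection is
    eventually left. *)
Lemma maps_cvg m (Y : forall p, 'M[R]_(p, m)) (h h1 b : forall p, 'rV[R]_p)
    (P1 P2 H12 B1 B2 g Psi : R) :
  let he := H12 - P1 * P2 in let be := B1 - P1 * g in let ee := 1 - P1 ^+ 2 in
  let U := P2 ^+ 2 + he ^+ 2 / ee in let UB := P2 * g + he * be / ee in
  let tau := (Psi - U) / (1 - Psi) in
  let Q := tau ^+ 2 + 2 * tau * U + U in
  (forall p, (0 < p)%N -> dotv (h p) (h p) = 1) ->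
  (forall p, (0 < p)%N -> dotv (h1 p) (h1 p) = 1) ->
  (\forall p \near \oo, dotv (b p) (b p) = 1) ->
  (fun p => dotv (h1 p) (qvec p)) @ \oo --> P1 ->
  (fun p => dotv (h p) (qvec p)) @ \oo --> P2 ->
  (fun p => dotv (h1 p) (h p)) @ \oo --> H12 ->
  (fun p => dotv (h1 p) (b p)) @ \oo --> B1 ->
  (fun p => dotv (h p) (b p)) @ \oo --> B2 ->
  (fun p => dotv (qvec p) (b p)) @ \oo --> g ->
  (fun p => psi (Y p) ^+ 2) @ \oo --> Psi -> Psi < 1 ->
  0 < ee -> 0 < U -> 0 < Q ->
  (fun p => enorm (maps (col_mx (h1 p) (qvec p)) (Y p) (h p) - b p)) @ \oo -->
    Num.sqrt (2 - 2 * ((tau * B2 + UB) / Num.sqrt Q)).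
Proof.
move=> he be ee U UB tau Q hu h1u bu cP1 cP2 cH cB1 cB2 cg cPsi Psi1 ee0 U0 Q0.
pose E p := h1 p - dotv (h1 p) (qvec p) *: qvec p.
pose u p := oproj (col_mx (h1 p) (qvec p)) (h p).
have EE p : (0 < p)%N -> dotv (E p) (E p) = 1 - dotv (h1 p) (qvec p) ^+ 2.
  by move=> p0; rewrite /E dotv_resid ?qvec_unit// h1u.
have near_e : \forall p \near \oo, 0 < 1 - dotv (h1 p) (qvec p) ^+ 2.
  have : (fun p => 1 - dotv (h1 p) (qvec p) ^+ 2) @ \oo --> ee.
    by apply: cvgB; [exact: cvg_cst|exact: cvgM].
  by move/cvgr_gt; apply.
pose c p := dotv (h p) (qvec p).
pose a p := dotv (h1 p) (h p) - dotv (h1 p) (qvec p) * c p.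
have ca : a @ \oo --> he by apply: cvgB => //; exact: cvgM.
pose d p := 1 - dotv (h1 p) (qvec p) ^+ 2.
have cd : d @ \oo --> ee by apply: cvgB; [exact: cvg_cst|exact: cvgM].
have cdV : (fun p => (d p)^-1) @ \oo --> ee^-1 by apply: cvgV => //; rewrite gt_eqF.
have ux : \forall p \near \oo, forall x, dotv (u p) x =
    c p * dotv (qvec p) x
    + a p / d p * (dotv (h1 p) x - dotv (h1 p) (qvec p) * dotv (qvec p) x).
  near=> p => x.
  have p0 : (0 < p)%N by near: p; exact: near_pos.
  have d0 : 0 < d p by near: p.
  rewrite /u oproj2 ?qvec_unit// -/(E p) ?EE ?gt_eqF// dotvDl !dotvZl.
  rewrite /E dotvDr dotvNr dotvZr (dotvC (h p) (h1 p)) -/(a p).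
  by rewrite dotvDl dotvNl dotvZl.
have uu : \forall p \near \oo, dotv (u p) (u p) = dotv (u p) (h p).
  near=> p.
  have [oA oo] := oprojP (col_mx (h1 p) (qvec p)) (h p).
  have := oo _ oA; rewrite -/(u p) dotvDl dotvNl (dotvC (h p)) => /eqP.
  by rewrite subr_eq0 => /eqP.
have cuh : (fun p => dotv (u p) (h p)) @ \oo --> U.
  have : (fun p => c p ^+ 2 + a p ^+ 2 / d p) @ \oo --> U.
    apply: cvgD; first exact: cvgM.
    by apply: cvgM => //; exact: cvgM.
  apply: cvg_trans; apply: near_eq_cvg; near=> p.
  have -> : dotv (u p) (h p) = c p * dotv (qvec p) (h p)
      + a p / d p * (dotv (h1 p) (h p) - dotv (h1 p) (qvec p) * dotv (qvec p) (h p)).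
    by move: (h p); near: p.
  by rewrite (dotvC (qvec p)) -/(c p) -/(a p); ring.
have cuu : (fun p => dotv (u p) (u p)) @ \oo --> U.
  by have := cuh; apply: cvg_trans; apply: near_eq_cvg; apply: filterS uu => p ->.
have cub : (fun p => dotv (u p) (b p)) @ \oo --> UB.
  have : (fun p => c p * dotv (qvec p) (b p)
      + a p * (dotv (h1 p) (b p) - dotv (h1 p) (qvec p) * dotv (qvec p) (b p)) / d p)
      @ \oo --> UB.
    apply: cvgD; first exact: cvgM.
    apply: cvgM => //; apply: cvgM => //; apply: cvgB => //; exact: cvgM.
  apply: cvg_trans; apply: near_eq_cvg; near=> p.
  have -> : dotv (u p) (b p) = c p * dotv (qvec p) (b p)
      + a p / d p * (dotv (h1 p) (b p) - dotv (h1 p) (qvec p) * dotv (qvec p) (b p)).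
    by move: (b p); near: p.
  by rewrite mulrAC.
pose t p := (psi (Y p) ^+ 2 - enorm (u p) ^+ 2) / (1 - psi (Y p) ^+ 2).
have ct : t @ \oo --> tau.
  rewrite /t; under eq_fun do rewrite enorm_sqr.
  apply: cvgM; first exact: cvgB.
  apply: cvgV; first by rewrite subr_eq0 gt_eqF.
  by apply: cvgB => //; exact: cvg_cst.
have : (fun p => enorm (normalize (t p *: h p + u p) - b p)) @ \oo -->
    Num.sqrt (2 - 2 * ((tau * B2 + UB) / Num.sqrt Q)).
  apply: err_cvg => //.
    under eq_fun do rewrite dotvDl !dotvZl.
    by apply: cvgD => //; exact: cvgM.
  have : (fun p => t p ^+ 2 + 2 * t p * dotv (u p) (h p) + dotv (u p) (u p)) @ \oo --> Q.
    apply: cvgD => //; apply: cvgD; first exact: cvgM.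
    by apply: cvgM => //; apply: cvgM => //; exact: cvg_cst.
  apply: cvg_trans; apply: near_eq_cvg; near=> p.
  have p0 : (0 < p)%N by near: p; exact: near_pos.
  rewrite dotvDl !dotvDr !dotvZl !dotvZr hu// (dotvC (h p) (u p)).
  by ring.
apply: cvg_trans; apply: near_eq_cvg; near=> p.
have u0 : 0 < dotv (u p) (u p) by near: p; exact: (cvgr_gt _ cuu).
rewrite /maps -/(u p); case: ifPn => // /eqP up0.
by move: u0; rewrite up0 /dotv mul0mx mxE ltxx.
Unshelve. all: by end_near.
Qed.

(** The ratio in [psi] is invariant under scaling, so [s2] and the trace of [scov] may be replaced
    by [topval] and the trace of the Gram matrix. *)
Lemma psi_cvg m (Y : forall p, 'M[R]_(p, m)) (G : 'M[R]_m) (lam : R) : (1 < m)%N ->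
  (forall i j, (fun p => gram (Y p) i j) @ \oo --> G i j) ->
  (fun p => topval (Y p)) @ \oo --> lam -> 0 < lam ->
  let Psi := (lam - (\tr G - lam) / (m%:R - 1)) / lam in
  0 <= Psi -> (fun p => psi (Y p) ^+ 2) @ \oo --> Psi.
Proof.
move=> m1 cG cl lam0 Psi Psi0.
have m0 : (0 < m)%N by exact: ltnW.
have mR : m%:R != 0 :> R by rewrite pnatr_eq0 -lt0n.
have m1R : m%:R - 1 != 0 :> R by rewrite subr_eq0 pnatr_eq1 gtn_eqF.
have ctr : (fun p => \tr (gram (Y p))) @ \oo --> \tr G.
  have -> : (fun p => \tr (gram (Y p))) = (fun p => \sum_i gram (Y p) i i) by [].
  by apply: cvg_sumr => i; exact: cG.
rewrite -(sqr_sqrtr Psi0).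
pose f p := Num.sqrt ((topval (Y p) -
  (\tr (gram (Y p)) - topval (Y p)) / (m%:R - 1)) / topval (Y p)).
have H : f @ \oo --> Num.sqrt Psi.
  apply: cvg_sqrt; apply: cvgM; last by apply: cvgV => //; rewrite gt_eqF.
  apply: cvgB => //; apply: cvgM; last exact: cvg_cst.
  exact: cvgB.
have : (fun p => f p ^+ 2) @ \oo --> Num.sqrt Psi ^+ 2 by exact: cvgM.
apply: cvg_trans; apply: near_eq_cvg; near=> p.
have p0 : (0 < p)%N by near: p; exact: near_pos.
have pR : p%:R != 0 :> R by rewrite pnatr_eq0 -lt0n.
have lp : 0 < topval (Y p) by near: p; exact: (cvgr_gt _ cl).
have sp : s2 (Y p) != 0.
  by apply/eqP => s0; move: lp; rewrite /topval s0 mulr0 mul0r ltxx.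
rewrite /f /psi; congr (Num.sqrt _ ^+ 2).
have -> : \tr (gram (Y p)) = m%:R / p%:R * \tr (scov (Y p)).
  rewrite /gram /scov !mxtraceZ mxtrace_mulC; field.
  by rewrite mR pR.
rewrite /topval /l2; field.
by rewrite ?mR ?pR ?sp ?m1R.
Unshelve. all: by end_near.
Qed.

End est.

(** * The two-block model *)

(** When both means are nonzero, expanding [dcov] gives exactly
    [mean (a b) = mu_a mu_b (1 + dcov)]. *)
Lemma mean_mul_cvg (R : realType) (a b : nat -> R) (ma mb g : R) :
  mu_ a @ \oo --> ma -> mu_ b @ \oo --> mb -> ma != 0 -> mb != 0 ->
  dcov a b @ \oo --> g ->
  (fun p : nat => p%:R^-1 * \sum_(i < p) (a i * b i)) @ \oo --> ma * mb * (1 + g).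
Proof.
move=> ca cb ma0 mb0 cg.
have : (fun p => mu_ a p * mu_ b p * (1 + dcov a b p)) @ \oo --> ma * mb * (1 + g).
  by apply: cvgM; [exact: cvgM|apply: cvgD => //; exact: cvg_cst].
apply: cvg_trans; apply: near_eq_cvg; near=> p.
have p0 : (0 < p)%N by near: p; exact: near_pos.
have pR : p%:R != 0 :> R by rewrite pnatr_eq0 -lt0n.
have a0 : mu_ a p != 0 by near: p; exact: (cvgr_neq0 _ ca).
have b0 : mu_ b p != 0 by near: p; exact: (cvgr_neq0 _ cb).
have Sa : \sum_(i < p) a i = p%:R * mu_ a p by rewrite /mu_ mulrA divff ?mul1r.
have Sb : \sum_(i < p) b i = p%:R * mu_ b p by rewrite /mu_ mulrA divff ?mul1r.
have -> : dcov a b p = p%:R^-1 * (\sum_(i < p) (a i * b i) / (mu_ a p * mu_ b p)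
    - (\sum_(i < p) a i) / mu_ a p - (\sum_(i < p) b i) / mu_ b p + p%:R).
  have pE : p%:R = \sum_(i < p) 1 :> R by rewrite sumr_const card_ord.
  rewrite /dcov !mulr_suml [X in _ - _ + X]pE -!sumrB -big_split/=.
  congr (_ * _); apply: eq_bigr => i _; field.
  by rewrite a0 b0.
by rewrite -mulr_suml Sa Sb; field; rewrite pR a0 b0.
Unshelve. all: by end_near.
Qed.

Lemma inv_sqrt_sqr (R : realType) (p : nat) :
  (Num.sqrt p%:R)^-1 * (Num.sqrt p%:R)^-1 = p%:R^-1 :> R.
Proof. by rewrite -invfM -expr2 sqr_sqrtr. Qed.

Lemma lscoreE (R : realType) p m (Y : 'M[R]_(p, m)) (x : 'rV[R]_p) j :
  lscore Y x 0 j = (Num.sqrt p%:R)^-1 * (x *m Y) 0 j.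
Proof. by rewrite mxE. Qed.

Lemma scalemxE (R : realType) m (a : R) (x : 'rV[R]_m) j : (a *: x) 0 j = a * x 0 j.
Proof. by rewrite mxE. Qed.

Lemma dcov_cauchy (R : realType) (a b : nat -> R) p :
  dcov a b p ^+ 2 <= dcov a a p * dcov b b p.
Proof.
have E (y z : nat -> R) : dcov y z p =
    p%:R^-1 * dotv (\row_(i < p) (y i / mu_ y p - 1)) (\row_(i < p) (z i / mu_ z p - 1)).
  by rewrite dotvE; congr (_ * _); apply: eq_bigr => i _; rewrite !mxE.
rewrite !E mulrACA exprMn expr2 ler_wpM2l ?mulr_ge0 ?invr_ge0//.
exact: dotv_cauchy.
Qed.

Lemma dcovC (R : realType) (a a' : nat -> R) p : dcov a a' p = dcov a' a p.
Proof. by rewrite /dcov; congr (_ * _); apply: eq_bigr => i _; rewrite mulrC. Qed.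

Lemma dcov_ge0 (R : realType) (a : nat -> R) p : 0 <= dcov a a p.
Proof.
rewrite /dcov mulr_ge0 ?invr_ge0// sumr_ge0// => i _.
by rewrite -expr2 sqr_ge0.
Qed.

Lemma enorm_gt0 (R : realType) p (y : 'rV[R]_p) : y != 0 -> 0 < enorm y.
Proof.
move=> y0; rewrite sqrtr_gt0 lt0r dotvv_ge0 andbT.
by apply: contra y0 => /eqP/dotv_eq0 ->.
Qed.

Lemma mul_outer (R : realType) p m (y z : 'rV[R]_p) (z' : 'rV[R]_m) :
  y *m (z^T *m z') = dotv y z *: z'.
Proof. by rewrite mulmxA (mx11_scalar (y *m z^T)) mul_scalar_mx. Qed.

Lemma dotv_row_mx (R : realType) p q (y1 z1 : 'rV[R]_p) (y2 z2 : 'rV[R]_q) :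
  dotv (row_mx y1 y2) (row_mx z1 z2) = dotv y1 z1 + dotv y2 z2.
Proof. by rewrite /dotv tr_row_mx mul_row_col mxE. Qed.

Lemma lscore_row_mx (R : realType) p q q' (A : 'M[R]_(p, q)) (A' : 'M[R]_(p, q'))
    (y : 'rV[R]_p) :
  lscore (row_mx A A') y = row_mx (lscore A y) (lscore A' y).
Proof. by rewrite /lscore mul_mx_row scale_row_mx. Qed.

(** * Limits along a fixed outcome *)

Section model_lim.
Context d (T : measurableType d) (R : realType) (P : probability T R) (n : nat).
Variables (beta : 'I_2 -> nat -> {RV P >-> R}) (X : 'I_2 -> 'I_n -> {RV P >-> R})
  (Z : nat -> 'I_2 -> 'I_n -> {RV P >-> R}) (w : T).
Variables (mu dd c delta : R).
Let b t := beta_path beta t w.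
Let x t := Xvec X t w.
Hypothesis cmu : forall t, mu_ (b t) @ \oo --> mu.
Hypothesis cd : forall t, d_ (b t) @ \oo --> dd.
Hypothesis cc : dcov (b blk1) (b blk2) @ \oo --> c.
Hypotheses (mu0 : 0 < mu) (dd0 : 0 < dd).
Hypothesis cZZ : forall k k' : 'I_2 * 'I_n,
  (fun p : nat => p%:R^-1 * \sum_(0 <= i < p) (Z i k.1 k.2 w * Z i k'.1 k'.2 w))
     @ \oo --> (if k == k' then delta ^+ 2 else 0 : R).
Hypothesis cZ : forall k : 'I_2 * 'I_n,
  (fun p : nat => p%:R^-1 * \sum_(0 <= i < p) Z i k.1 k.2 w) @ \oo --> (0 : R).
Hypothesis cbZ : forall t (k : 'I_2 * 'I_n),
  (fun p : nat => p%:R^-1 * \sum_(0 <= i < p) (beta t i w * Z i k.1 k.2 w))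
     @ \oo --> (0 : R).

Definition second_moment (s t : 'I_2) : R :=
  mu ^+ 2 * (1 + (if s == t then dd ^+ 2 else c)).

Lemma cvg_dcov s t : dcov (b s) (b t) @ \oo --> (if s == t then dd ^+ 2 else c).
Proof.
have [<-|st] := eqVneq s t.
  have -> : dcov (b s) (b s) = (fun p => d_ (b s) p ^+ 2).
    by apply/funext => p; rewrite /d_ sqr_sqrtr// dcov_ge0.
  exact: cvgM.
have [[-> ->]|[-> ->]] : (s = blk1 /\ t = blk2) \/ (s = blk2 /\ t = blk1).
- case: s t st => [[|[|//]] hs] [[|[|//]] ht] //= _; [left|right]; split; exact/val_inj.
- exact: cc.
- rewrite (_ : dcov _ _ = dcov (b blk1) (b blk2)); first exact: cc.
  by apply/funext => p; rewrite dcovC.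
Qed.

Lemma mean_bb s t :
  (fun p : nat => p%:R^-1 * \sum_(i < p) (b s i * b t i)) @ \oo --> second_moment s t.
Proof.
rewrite /second_moment expr2; have m0 : mu != 0 by rewrite gt_eqF.
exact: (mean_mul_cvg (cmu s) (cmu t) m0 m0 (@cvg_dcov s t)).
Qed.

Let Y t p := Rblk beta X Z t w p.

Lemma RblkE t p i j : Y t p i j = b t i * x t 0 j + Z i t j w.
Proof. by rewrite /Y /Rblk !mxE big_ord1 !mxE. Qed.

Lemma mean_bR s t j :
  (fun p : nat => p%:R^-1 * \sum_(i < p) (b s i * Y t p i j)) @ \oo -->
  second_moment s t * x t 0 j.
Proof.
have : (fun p : nat => (p%:R^-1 * \sum_(i < p) (b s i * b t i)) * x t 0 j
    + p%:R^-1 * \sum_(0 <= i < p) (beta s i w * Z i t j w)) @ \oo -->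
  second_moment s t * x t 0 j + 0.
  apply: cvgD; last exact: (cbZ s (t, j)).
  by apply: cvgM; [exact: mean_bb|exact: cvg_cst].
rewrite addr0; apply: cvg_trans; apply: near_eq_cvg; near=> p.
rewrite big_mkord -mulrA -mulrDr mulr_suml -big_split/=; congr (_ * _).
by apply: eq_bigr => i _; rewrite RblkE /b /beta_path; ring.
Unshelve. all: by end_near.
Qed.

Definition cgram s t p : 'M[R]_n := p%:R^-1 *: ((Y s p)^T *m Y t p).

Lemma cgram_cvg s t i j : (fun p => cgram s t p i j) @ \oo -->
  second_moment s t * (x s 0 i * x t 0 j) + (if (s, i) == (t, j) then delta ^+ 2 else 0).
Proof.
have : (fun p : nat => x s 0 i * (p%:R^-1 * \sum_(k < p) (b s k * Y t p k j))
    + x t 0 j * (p%:R^-1 * \sum_(0 <= k < p) (beta t k w * Z k s i w))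
    + p%:R^-1 * \sum_(0 <= k < p) (Z k s i w * Z k t j w)) @ \oo -->
  x s 0 i * (second_moment s t * x t 0 j) + x t 0 j * 0
    + (if (s, i) == (t, j) then delta ^+ 2 else 0).
  apply: cvgD; last exact: (@cZZ (s, i) (t, j)).
  apply: cvgD; apply: cvgM; try exact: cvg_cst; first exact: mean_bR.
  exact: (cbZ t (s, i)).
rewrite mulr0 addr0 mulrCA; apply: cvg_trans; apply: near_eq_cvg; near=> p.
rewrite !big_mkord /cgram !mxE mulrCA [X in _ + X + _]mulrCA -!mulrDr; congr (_ * _).
rewrite !mulr_sumr -!big_split/=; apply: eq_bigr => k _.
by rewrite [_^T i k]mxE !RblkE /b /beta_path /x !mxE; ring.
Unshelve. all: by end_near.
Qed.

Lemma qscore_cvg t j : (fun p => lscore (Y t p) (qvec p) 0 j) @ \oo --> mu * x t 0 j.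
Proof.
have : (fun p : nat => mu_ (b t) p * x t 0 j
    + p%:R^-1 * \sum_(0 <= k < p) Z k t j w) @ \oo --> mu * x t 0 j + 0.
  apply: cvgD; last exact: (cZ (t, j)).
  by apply: cvgM => //; exact: cvg_cst.
rewrite addr0; apply: cvg_trans; apply: near_eq_cvg; near=> p.
have E : (qvec p *m Y t p) 0 j = (Num.sqrt p%:R)^-1 * \sum_(i < p) Y t p i j.
  by rewrite mxE mulr_sumr; apply: eq_bigr => i _; rewrite [qvec p 0 i]mxE.
rewrite big_mkord lscoreE E mulrA -invfM -expr2 sqr_sqrtr// /mu_ -mulrA -mulrDr.
rewrite mulr_suml -big_split/=; congr (_ * _).
by apply: eq_bigr => i _; rewrite RblkE.
Unshelve. all: by end_near.
Qed.

Let B := second_moment blk2 blk2.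

Lemma B_gt0 : 0 < B.
Proof. by rewrite /B /second_moment eqxx mulr_gt0 ?exprn_gt0// ltr_pwDl// sqr_ge0. Qed.

Let mean_sqr p : R := p%:R^-1 * \sum_(i < p) (b blk2 i * b blk2 i).
Let bb p := normalize (trunc p (b blk2)).

Lemma trunc_sqr p :
  dotv (trunc p (b blk2)) (trunc p (b blk2)) = \sum_(i < p) (b blk2 i * b blk2 i).
Proof. by rewrite dotvE; apply: eq_bigr => i _; rewrite !mxE. Qed.

Lemma near_trunc : \forall p \near \oo, 0 < dotv (trunc p (b blk2)) (trunc p (b blk2)).
Proof.
near=> p.
have p0 : (0 < p)%N by near: p; exact: near_pos.
have h : 0 < p%:R^-1 * \sum_(i < p) (b blk2 i * b blk2 i).
  by near: p; apply: (cvgr_gt _ (@mean_bb blk2 blk2)); exact: B_gt0.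
by move: h; rewrite trunc_sqr pmulr_rgt0// invr_gt0 ltr0n.
Unshelve. all: by end_near.
Qed.

Lemma near_bb : \forall p \near \oo, dotv (bb p) (bb p) = 1.
Proof. by apply: filterS near_trunc => p; exact: normalize_unit. Qed.

Lemma enorm_trunc p : (0 < p)%N ->
  enorm (trunc p (b blk2)) = Num.sqrt p%:R * Num.sqrt (mean_sqr p).
Proof.
move=> p0; rewrite -sqrtrM// mulrA divff ?mul1r ?pnatr_eq0 -?lt0n//.
by rewrite /enorm trunc_sqr.
Qed.

Let csB : (fun p => (Num.sqrt (mean_sqr p))^-1) @ \oo --> (Num.sqrt B)^-1.
Proof.
apply: cvgV; first by rewrite gt_eqF// sqrtr_gt0 B_gt0.
by apply: cvg_sqrt; exact: mean_bb.
Qed.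

Lemma bscore_cvg t j : (fun p => lscore (Y t p) (bb p) 0 j) @ \oo -->
  second_moment blk2 t / Num.sqrt B * x t 0 j.
Proof.
have : (fun p => (Num.sqrt (mean_sqr p))^-1 *
    (p%:R^-1 * \sum_(i < p) (b blk2 i * Y t p i j))) @ \oo -->
   (Num.sqrt B)^-1 * (second_moment blk2 t * x t 0 j).
  by apply: cvgM => //; exact: mean_bR.
rewrite mulrA (mulrC (Num.sqrt B)^-1); apply: cvg_trans; apply: near_eq_cvg; near=> p.
have p0 : (0 < p)%N by near: p; exact: near_pos.
rewrite lscoreE /bb /normalize -scalemxAl scalemxE enorm_trunc// invfM.
have -> : (trunc p (b blk2) *m Y t p) 0 j = \sum_(i < p) b blk2 i * Y t p i j.
  by rewrite mxE; apply: eq_bigr => i _; rewrite [trunc _ _ 0 i]mxE.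
by rewrite -inv_sqrt_sqr; ring.
Unshelve. all: by end_near.
Qed.

Lemma qb_cvg : (fun p => dotv (qvec p) (bb p)) @ \oo --> mu / Num.sqrt B.
Proof.
have : (fun p => mu_ (b blk2) p * (Num.sqrt (mean_sqr p))^-1) @ \oo --> mu / Num.sqrt B.
  exact: cvgM.
apply: cvg_trans; apply: near_eq_cvg; near=> p.
have p0 : (0 < p)%N by near: p; exact: near_pos.
rewrite /bb /normalize dotvZr enorm_trunc// invfM dotvE.
have -> : \sum_i qvec p 0 i * trunc p (b blk2) 0 i =
    (Num.sqrt p%:R)^-1 * \sum_(i < p) b blk2 i.
  by rewrite mulr_sumr; apply: eq_bigr => i _; rewrite !mxE.
by rewrite /mu_ -inv_sqrt_sqr; ring.
Unshelve. all: by end_near.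
Qed.

Hypothesis dl0 : 0 < delta.
Variable h : 'I_2 -> forall p, 'rV[R]_p.
Hypothesis hpca : forall t p, (0 < p)%N -> is_pca (Y t p) (h t p).
Hypothesis x0 : forall t, x t != 0.
Hypothesis hn : (2 <= n)%N.

Let v := delta ^+ 2.
Let v0 : 0 < v. Proof. by rewrite exprn_gt0. Qed.
Let a t := enorm (x t).
Let D t := Num.sqrt B * a t.
Let lam t := D t ^+ 2 + v.
Let k t := (a t)^-1 *: x t.
Let sB : 0 < Num.sqrt B. Proof. by rewrite sqrtr_gt0 B_gt0. Qed.

Let a0 t : 0 < a t. Proof. exact: enorm_gt0. Qed.
Let D0 t : 0 < D t. Proof. by rewrite mulr_gt0. Qed.
Let lam0 t : 0 < lam t. Proof. by rewrite ltr_wpDl ?sqr_ge0. Qed.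
Let sl0 t : 0 < Num.sqrt (lam t). Proof. by rewrite sqrtr_gt0. Qed.
Let sl2 t : Num.sqrt (lam t) ^+ 2 = lam t. Proof. by rewrite sqr_sqrtr ?ltW. Qed.

Let xx t : dotv (x t) (x t) = a t ^+ 2. Proof. by rewrite enorm_sqr. Qed.
Let kk t : dotv (k t) (k t) = 1. Proof. by apply: normalize_unit; rewrite xx exprn_gt0. Qed.
Let xk t : x t = a t *: k t. Proof. by rewrite scalerA divff ?scale1r ?gt_eqF. Qed.
Let dxk t : dotv (x t) (k t) = a t. Proof. by rewrite xk dotvZl kk mulr1. Qed.

Let G t : 'M[R]_n := B *: ((x t)^T *m x t) + v%:M.

Let DB t : D t ^+ 2 = B * a t ^+ 2.
Proof. by rewrite exprMn sqr_sqrtr// ltW// B_gt0. Qed.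

Let mulG t y : y *m G t = (B * dotv y (x t)) *: x t + v *: y.
Proof. by rewrite mulmxDr -scalemxAr mul_outer scalerA mul_mx_scalar. Qed.

Let second_momentE t : second_moment t t = B.
Proof. by rewrite /B /second_moment !eqxx. Qed.

Let cG t i j : (fun p => gram (Y t p) i j) @ \oo --> G t i j.
Proof.
have := @cgram_cvg t t i j; rewrite second_momentE xpair_eqE eqxx/=.
suff -> : G t i j = B * (x t 0 i * x t 0 j) + (if i == j then delta ^+ 2 else 0) by [].
by rewrite /G /v; rewrite [LHS]mxE; congr (_ + _);
  [rewrite 2!mxE big_ord1 mxE|rewrite mxE; case: eqP].
Qed.

Let coff s t i j : s != t -> (fun p => cgram s t p i j) @ \oo -->
  (second_moment s t *: ((x s)^T *m x t)) i j.
Proof.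
move=> st; have := @cgram_cvg s t i j; rewrite xpair_eqE (negPf st) addr0.
suff -> : (second_moment s t *: ((x s)^T *m x t)) i j =
  second_moment s t * (x s 0 i * x t 0 j) by [].
by rewrite 2!mxE big_ord1 mxE.
Qed.

Let trG t : \tr (G t) = D t ^+ 2 + n%:R * v.
Proof.
rewrite /G mxtraceD mxtraceZ mxtrace_mulC mxtrace_scalar DB -[v *+ n]mulr_natl.
congr (_ * _ + _); rewrite -xx /mxtrace big_ord1 dotvE mxE.
by apply: eq_bigr => i _; rewrite [_^T _ _]mxE.
Qed.

Let cQ t j : (fun p => lscore (Y t p) (qvec p) 0 j) @ \oo --> (mu *: x t) 0 j.
Proof. by rewrite scalemxE; exact: qscore_cvg. Qed.

Let kG t : k t *m G t = lam t *: k t.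
Proof.
rewrite mulG dotvC dxk {1}(xk t) scalerA -scalerDl; congr (_ *: _).
by rewrite /lam DB; ring.
Qed.

Let gapG t y : dotv (y *m G t) y <=
  lam t * dotv y (k t) ^+ 2 + v * (dotv y y - dotv y (k t) ^+ 2).
Proof.
have e : dotv y (x t) = a t * dotv y (k t) by rewrite {1}(xk t) dotvZr.
rewrite mulG dotvDl !dotvZl (dotvC (x t) y) e /lam DB.
by rewrite le_eqVlt; apply/orP; left; apply/eqP; ring.
Qed.

Let gap t : v < lam t. Proof. by rewrite ltrDr exprn_gt0. Qed.

Let ak t : 0 < dotv (mu *: x t) (k t). Proof. by rewrite dotvZl dxk mulr_gt0. Qed.

Let n0 : (0 < n)%N. Proof. exact: ltnW. Qed.

Let ctop t : (fun p => topval (Y t p)) @ \oo --> lam t.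
Proof.
exact: (topval_cvg n0 (@hpca t) (@cG t) (kk t) (kG t) (lam0 t) (gap t) (@gapG t)).
Qed.

Let cscore t j :
  (fun p => lscore (Y t p) (h t p) 0 j) @ \oo --> Num.sqrt (lam t) * k t 0 j.
Proof.
exact: (lscore_cvg n0 (@hpca t) (@cG t) (@cQ t) (kk t) (kG t) (lam0 t) (gap t)
  (@gapG t) (ak t)).
Qed.

Let cdot t := pca_dotv_cvg n0 (@hpca t) (@cG t) (@cQ t) (kk t) (kG t) (lam0 t) (gap t)
  (@gapG t) (ak t).

(** [g] and [r] are the limits of [(q, b_2)] and [(b_1, b_2)]; [f t] is the limit of [psi] for block
    [t], and also the limiting cosine between the PCA direction of the block and its loadings. *)
Let g := mu / Num.sqrt B.
Let r := second_moment blk1 blk2 / B.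
Let f t := D t / Num.sqrt (lam t).

Let chq t : (fun p => dotv (h t p) (qvec p)) @ \oo --> g * f t.
Proof.
have -> : g * f t = dotv (mu *: x t) (k t) / Num.sqrt (lam t).
  by rewrite dotvZl dxk /g /f /D; field; rewrite !gt_eqF.
exact: cdot.
Qed.

Let chb t : (fun p => dotv (h t p) (bb p)) @ \oo --> second_moment blk2 t / B * f t.
Proof.
have -> : second_moment blk2 t / B * f t =
    dotv ((second_moment blk2 t / Num.sqrt B) *: x t) (k t) / Num.sqrt (lam t).
  rewrite dotvZl dxk /f /D.
  have [sB0 BE] := (sB, esym (sqr_sqrtr (ltW B_gt0))).
  move: (Num.sqrt B) sB0 BE => sb sb0 ->.
  by field; rewrite !gt_eqF.
by apply: cdot => j; rewrite scalemxE; exact: bscore_cvg.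
Qed.

(** By [lscore_cross], the score of [h_1] against block 2 is its score against block 1 times the
    cross Gram matrix, divided by [topval]. Its limit then feeds the general limit of inner products
    with [h_2]. *)
Let chh : (fun p => dotv (h blk1 p) (h blk2 p)) @ \oo --> r * f blk1 * f blk2.
Proof.
under eq_fun do rewrite dotvC.
pose e := (lam blk1)^-1 * (Num.sqrt (lam blk1) * a blk1 * second_moment blk1 blk2).
have -> : r * f blk1 * f blk2 = dotv (e *: x blk2) (k blk2) / Num.sqrt (lam blk2).
  rewrite dotvZl dxk /e /r /f /D.
  have [sB0 BE] := (sB, esym (sqr_sqrtr (ltW B_gt0))).
  have [sl1 lE1] := (sl0 blk1, esym (sl2 blk1)).
  move: (Num.sqrt B) (Num.sqrt (lam blk1)) sB0 sl1 BE lE1 => sb sl sb0 sl1 -> ->.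
  by field; rewrite !gt_eqF.
apply: cdot => j; rewrite scalemxE.
pose C := second_moment blk1 blk2 *: ((x blk1)^T *m x blk2).
have : (fun p => (topval (Y blk1 p))^-1 *
    (lscore (Y blk1 p) (h blk1 p) *m cgram blk1 blk2 p) 0 j) @ \oo -->
    (lam blk1)^-1 * ((Num.sqrt (lam blk1) *: k blk1) *m C) 0 j.
  apply: cvgM; first by apply: cvgV => //; rewrite gt_eqF.
  apply: cvg_mulmx_coord => i i'; first by rewrite (ord1 i) scalemxE; exact: cscore.
  exact: coff.
have -> : e * x blk2 0 j =
    (lam blk1)^-1 * ((Num.sqrt (lam blk1) *: k blk1) *m C) 0 j.
  by rewrite -scalemxAl -scalemxAr mul_outer !scalemxE dotvC dxk /e; ring.
apply: cvg_trans; apply: near_eq_cvg; near=> p.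
have p0 : (0 < p)%N by near: p; exact: near_pos.
have lp : 0 < topval (Y blk1 p) by near: p; exact: (cvgr_gt _ (@ctop blk1)).
rewrite /cgram lscore_cross//; last exact: hpca.
rewrite -/(lscore (Y blk2 p) (h blk1 p)).
by rewrite scalemxE mulrA mulVf ?mul1r ?gt_eqF.
Unshelve. all: by end_near.
Qed.

Let f0 t : 0 < f t. Proof. by rewrite divr_gt0. Qed.
Let f2 t : f t ^+ 2 = D t ^+ 2 / (D t ^+ 2 + v).
Proof. by rewrite /f exprMn exprVn sl2. Qed.
Let f2lt1 t : f t ^+ 2 < 1.
Proof. by rewrite f2 ltr_pdivrMr ?lam0// mul1r ltrDl. Qed.

(** The signal of a block has rank one, so the remaining [n - 1] eigenvalues of the limit average to
    exactly [v]. *)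
Let cpsi t : (fun p => psi (Y t p) ^+ 2) @ \oo --> f t ^+ 2.
Proof.
have n1 : n%:R - 1 != 0 :> R by rewrite subr_eq0 pnatr_eq1 gtn_eqF.
have fE : f t ^+ 2 = (lam t - (\tr (G t) - lam t) / (n%:R - 1)) / lam t.
  rewrite f2 trG /lam; field; rewrite n1 andbT.
  exact: lt0r_neq0 (lam0 t).
rewrite fE; apply: (psi_cvg hn (@cG t) (@ctop t) (lam0 t)).
by rewrite -fE sqr_ge0.
Qed.

Hypothesis bpos : forall p, (0 < p)%N -> 0 < dotv (trunc p (b blk1)) (trunc p (b blk2)).

(** Positivity of [(beta_1, beta_2)] passes to the limit. It makes [r] non-negative, which keeps the
    top eigenvector of the signal in the first quadrant. *)
Let c_ge : -1 <= c.
Proof.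
have : 0 <= second_moment blk1 blk2.
  apply: (cvgr_to_ge (@mean_bb blk1 blk2)).
  near=> p.
  have p0 : (0 < p)%N by near: p; exact: near_pos.
  have := bpos p0; rewrite dotvE.
  rewrite (_ : \sum_i _ = \sum_(i < p) b blk1 i * b blk2 i); last first.
    by apply: eq_bigr => i _; rewrite !mxE.
  by move=> /ltW b12; rewrite mulr_ge0 ?invr_ge0.
by rewrite /second_moment/= pmulr_rge0 ?exprn_gt0// -lerBlDl sub0r.
Unshelve. all: by end_near.
Qed.

Let c_sqr : c ^+ 2 <= (dd ^+ 2) ^+ 2.
Proof.
have c1 : (fun p => dcov (b blk1) (b blk2) p ^+ 2) @ \oo --> c ^+ 2 by exact: cvgM.
have c2 : (fun p => dcov (b blk1) (b blk1) p * dcov (b blk2) (b blk2) p)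
    @ \oo --> (dd ^+ 2) ^+ 2.
  by apply: cvgM; [have := @cvg_dcov blk1 blk1|have := @cvg_dcov blk2 blk2]; rewrite eqxx.
apply: (ler_cvg_to c1 c2); near=> p; exact: dcov_cauchy.
Unshelve. all: by end_near.
Qed.

Let s := 1 - g ^+ 2.
Let rho := c / dd ^+ 2.

Let BE : B = mu ^+ 2 * (1 + dd ^+ 2).
Proof. by rewrite /B /second_moment eqxx. Qed.

Let dd2 : 0 < dd ^+ 2. Proof. by rewrite exprn_gt0. Qed.
Let dd21 : 0 < 1 + dd ^+ 2. Proof. by rewrite ltr_pwDl// ltW. Qed.

Let g0 : 0 < g. Proof. by rewrite divr_gt0. Qed.

Let g2E : g ^+ 2 = (1 + dd ^+ 2)^-1.
Proof.
rewrite /g expr_div_n sqr_sqrtr ?(ltW B_gt0)// BE.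
by field; rewrite !gt_eqF.
Qed.

Let sE : s = dd ^+ 2 / (1 + dd ^+ 2).
Proof. by rewrite /s g2E; field; rewrite gt_eqF. Qed.

Let s01 : 0 < s < 1.
Proof. by rewrite sE divr_gt0//= ltr_pdivrMr// mul1r ltrDr. Qed.

Let g2s : g ^+ 2 = 1 - s. Proof. by rewrite /s subKr. Qed.

Let r0E : r = (1 + c) / (1 + dd ^+ 2).
Proof.
rewrite /r BE /second_moment/=.
by field; rewrite !gt_eqF.
Qed.

Let rE : r = s * rho + (1 - s).
Proof.
rewrite r0E -g2s g2E sE /rho.
by field; rewrite !gt_eqF.
Qed.

Let rho1 : rho ^+ 2 <= 1.
Proof. by rewrite /rho expr_div_n ler_pdivrMr ?exprn_gt0// mul1r. Qed.

Let r01 : 0 <= r <= 1.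
Proof.
rewrite r0E; apply/andP; split.
  by rewrite divr_ge0// ?(ltW dd21)// -lerBlDl sub0r.
rewrite ler_pdivrMr// mul1r lerD2l leNgt; apply/negP => H.
by move: c_sqr; rewrite leNgt ltr_pXn2r ?H// nnegrE ltW// (lt_trans dd2).
Qed.

Let sm21 : second_moment blk2 blk1 = B * r.
Proof. by rewrite /r mulrC divfK ?gt_eqF ?B_gt0// /second_moment. Qed.

Let GL := g ^+ 2 + f blk1 ^+ 2 * (r - g ^+ 2) ^+ 2 / (1 - f blk1 ^+ 2 * g ^+ 2).

Let g2_le1 : g ^+ 2 <= 1.
Proof. by rewrite g2E invf_le1// lerDl ltW. Qed.

Let ee0 : 0 < 1 - f blk1 ^+ 2 * g ^+ 2.
Proof.
by rewrite subr_gt0 (le_lt_trans _ (f2lt1 blk1))// ler_piMr ?sqr_ge0 ?g2_le1.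
Qed.

Let GL_ge : g ^+ 2 <= GL.
Proof. by rewrite lerDl divr_ge0 ?(ltW ee0)// mulr_ge0 ?sqr_ge0. Qed.

Let GL_gt : c != 0 -> g ^+ 2 < GL.
Proof.
move=> cn0; have s0 : s != 0 by case/andP: s01 => s0 _; rewrite gt_eqF.
have rg : 0 < (r - g ^+ 2) ^+ 2.
  rewrite exprn_even_gt0//= rE g2s addrK mulf_neq0// /rho mulf_neq0// invr_eq0.
  by rewrite gt_eqF.
by rewrite ltrDl divr_gt0// mulr_gt0// exprn_gt0.
Qed.

Let GL_le1 : GL <= 1.
Proof.
by have := anchor2_le1 s01 rho1 (D0 blk1) v0 g2s; rewrite -rE -f2.
Qed.

Let GL0 : 0 < GL <= 1.
Proof. by rewrite GL_le1 andbT (lt_le_trans _ GL_ge)// exprn_gt0. Qed.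

Let cosf (G : R) := Num.sqrt (gps_cos2 (f blk2 ^+ 2) G).

Lemma err_single_cvg : (fun p => enorm (gps (Y blk2 p) (h blk2 p) - bb p)) @ \oo -->
  Num.sqrt (2 - 2 * cosf (g ^+ 2)).
Proof.
have g21 : 0 < g ^+ 2 <= 1 by rewrite exprn_gt0.
have [Q0 QE] := gps_cos2_ratio (f0 blk2) (f2lt1 blk2) g21.
have cB := @chb blk2; rewrite divff ?gt_eqF ?B_gt0// mul1r in cB.
have := gps_cvg (@hpca blk2) near_bb (@chq blk2) cB qb_cvg (@cpsi blk2) (f2lt1 blk2).
rewrite -/g [(g * f blk2) ^+ 2]exprMn [g ^+ 2 * _]mulrC /cosf -QE.
rewrite (_ : g * f blk2 * g = f blk2 * g ^+ 2); last by ring.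
have {}Q0 := Q0; rewrite -![2 * gps_tau _ _ * _]mulrA in Q0.
by apply; rewrite -mulrA.
Qed.

Lemma err_maps_cvg :
  (fun p => enorm (maps (col_mx (h blk1 p) (qvec p)) (Y blk2 p) (h blk2 p) - bb p)) @ \oo -->
  Num.sqrt (2 - 2 * cosf GL).
Proof.
have [Q0 QE] := gps_cos2_ratio (f0 blk2) (f2lt1 blk2) GL0.
have cB2 := @chb blk2; rewrite divff ?gt_eqF ?B_gt0// mul1r in cB2.
have cB1 := @chb blk1; rewrite sm21 [B * r]mulrC mulfK ?gt_eqF ?B_gt0// in cB1.
have hu t p : (0 < p)%N -> dotv (h t p) (h t p) = 1.
  by move=> p0; exact: (enorm1_dotv (@hpca t p p0)).
have := maps_cvg (hu blk2) (hu blk1) near_bb (@chq blk1) (@chq blk2) chh cB1 cB2 qb_cvg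
  (@cpsi blk2) (f2lt1 blk2).
rewrite -/g.
have eeE : 1 - (g * f blk1) ^+ 2 = 1 - f blk1 ^+ 2 * g ^+ 2 by rewrite exprMn mulrC.
have ee1 : 1 - (f blk1 * g) ^+ 2 != 0 by rewrite exprMn gt_eqF.
have UE : (g * f blk2) ^+ 2 + (r * f blk1 * f blk2 - g * f blk1 * (g * f blk2)) ^+ 2
    / (1 - (g * f blk1) ^+ 2) = f blk2 ^+ 2 * GL.
  by rewrite eeE /GL; field.
have UBE : g * f blk2 * g + (r * f blk1 * f blk2 - g * f blk1 * (g * f blk2)) *
    (r * f blk1 - g * f blk1 * g) / (1 - (g * f blk1) ^+ 2) = f blk2 * GL.
  by rewrite eeE /GL; field.
rewrite UE UBE eeE /cosf -QE; apply => //.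
by case/andP: GL0 => GLp _; rewrite mulr_gt0// exprn_gt0.
Qed.

(** * The double block *)

Variable hR : forall p, 'rV[R]_p.
Let Yd p := Rfull beta X Z w p.
Hypothesis hRpca : forall p, (0 < p)%N -> is_pca (Yd p) (hR p).
Hypothesis ndeg : ~ double_degenerate beta X w.

(** Both alternatives fail only on the degenerate event: [r = 0] is [c = -1], and [D t] is the norm
    of [x t] times a factor common to the blocks. *)
Let DD12 : (D blk1 != D blk2) || (r != 0).
Proof.
apply/negPn/negP; rewrite negb_or !negbK => /andP[/eqP D12 /eqP rr].
apply: ndeg; split.
  have -> : limn (dcov (beta_path beta blk1 w) (beta_path beta blk2 w)) = c.
    exact/cvg_lim.
  move/eqP: rr; rewrite r0E mulf_eq0 invr_eq0 (gt_eqF dd21) orbF addrC addr_eq0.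
  by move/eqP.
by apply: (mulfI (lt0r_neq0 sB)).
Qed.

Lemma err_double_cvg : exists2 N, (fun p => enorm (gps (Yd p) (hR p) - bb p)) @ \oo -->
    Num.sqrt (2 - 2 * N) &
  N <= cosf GL /\ (c != 0 -> c ^+ 2 < (dd ^+ 2) ^+ 2 -> N < cosf GL).
Proof.
have [k1 [k2 [Lam [[k1p k2p k12] e1 e2 /andP[Lam2p LamLt] quad]]]] :=
  sym2_top_eigenvector (D0 blk1) (D0 blk2) r01 DD12.
set Lam2 := D blk1 ^+ 2 + D blk2 ^+ 2 - Lam in Lam2p LamLt quad.
have Lamp : 0 < Lam by exact: le_lt_trans LamLt.
pose lamd := Lam + v; pose L := Num.sqrt lamd.
have lamd0 : 0 < lamd by rewrite addr_gt0.
have Lp : 0 < L by rewrite sqrtr_gt0.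
have L2 : L ^+ 2 = Lam + v by rewrite sqr_sqrtr ?ltW.
pose sm := second_moment blk1 blk2.
have smE : sm = B * r by rewrite /r mulrC divfK ?gt_eqF ?B_gt0.
pose Gd : 'M[R]_(n + n) := block_mx (G blk1) (sm *: ((x blk1)^T *m x blk2))
  (sm *: ((x blk2)^T *m x blk1)) (G blk2).
pose kd := row_mx (k1 *: k blk1) (k2 *: k blk2).
have gramE p : gram (Yd p) = block_mx (gram (Y blk1 p)) (cgram blk1 blk2 p)
    (cgram blk2 blk1 p) (gram (Y blk2 p)).
  by rewrite /gram /Yd /Rfull tr_row_mx mul_col_row scale_block_mx.
have cGd i j : (fun p => gram (Yd p) i j) @ \oo --> Gd i j.
  under eq_fun do rewrite gramE.
  case: (split_ordP i) => i' ->; case: (split_ordP j) => j' ->.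
  - by rewrite block_mxEul; under eq_fun do rewrite block_mxEul; exact: cG.
  - by rewrite block_mxEur; under eq_fun do rewrite block_mxEur; exact: coff.
  - by rewrite block_mxEdl; under eq_fun do rewrite block_mxEdl; exact: (@coff blk2 blk1).
  - by rewrite block_mxEdr; under eq_fun do rewrite block_mxEdr; exact: cG.
have row_cvg (y : forall p, 'rV[R]_p) (x1 x2 : 'rV[R]_n) :
    (forall j, (fun p => lscore (Y blk1 p) (y p) 0 j) @ \oo --> x1 0 j) ->
    (forall j, (fun p => lscore (Y blk2 p) (y p) 0 j) @ \oo --> x2 0 j) ->
    forall j, (fun p => lscore (Yd p) (y p) 0 j) @ \oo --> (row_mx x1 x2) 0 j.
  move=> c1 c2 j; under eq_fun do rewrite /Yd /Rfull lscore_row_mx.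
  case: (split_ordP j) => j' ->.
  - by rewrite row_mxEl; under eq_fun do rewrite row_mxEl; exact: c1.
  - by rewrite row_mxEr; under eq_fun do rewrite row_mxEr; exact: c2.
have cad := row_cvg _ _ _ (@cQ blk1) (@cQ blk2).
have dkd y1 y2 : dotv (row_mx y1 y2) kd = k1 * dotv y1 (k blk1) + k2 * dotv y2 (k blk2).
  by rewrite dotv_row_mx (@dotvZr _ _ k1) (@dotvZr _ _ k2).
have kkd : dotv kd kd = 1.
  by rewrite dkd (@dotvZl _ _ k1) (@dotvZl _ _ k2) !kk !mulr1 -!expr2.
have kx t (z : R) : dotv (z *: k t) (x t) = z * a t.
  by rewrite (@dotvZl _ _ z) dotvC dxk.
have mulGd y1 y2 : row_mx y1 y2 *m Gd = row_mx
    (y1 *m G blk1 + (sm * dotv y2 (x blk2)) *: x blk1)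
    (y2 *m G blk2 + (sm * dotv y1 (x blk1)) *: x blk2).
  rewrite mul_row_block -!scalemxAr !mul_outer !scalerA.
  by congr row_mx; rewrite addrC.
have smD : sm * a blk1 * a blk2 = r * D blk1 * D blk2.
  rewrite smE /D; have BB : B = Num.sqrt B * Num.sqrt B.
    by rewrite -expr2 sqr_sqrtr// ltW// B_gt0.
  by rewrite {1}BB; ring.
have kxx t z : z *: x t = (z * a t) *: k t by rewrite {1}(xk t) scalerA.
have kGz t z : (z *: k t) *m G t = (z * lam t) *: k t.
  by rewrite -scalemxAl kG scalerA.
have kGd : kd *m Gd = lamd *: kd.
  have -> : lamd *: kd = row_mx ((lamd * k1) *: k blk1) ((lamd * k2) *: k blk2).
    by rewrite scale_row_mx; congr row_mx; exact: scalerA.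
  rewrite mulGd !kGz !kx !kxx -!scalerDl; congr row_mx; congr (_ *: _).
    by rewrite [RHS]mulrDl -e1 -[r * _ * _]smD /lam; ring.
  by rewrite [RHS]mulrDl -e2 -[r * _ * _]smD /lam; ring.
have gapd : Lam2 + v < lamd by rewrite ltrD2r.
have gapGd y : dotv (y *m Gd) y <=
    lamd * dotv y kd ^+ 2 + (Lam2 + v) * (dotv y y - dotv y kd ^+ 2).
  rewrite -(hsubmxK y) mulGd !dkd; move: (lsubmx y) (rsubmx y) => y1 y2.
  rewrite !dotv_row_mx !dotvDl !mulG !dotvDl !dotvZl.
  have y1k : dotv y1 (x blk1) = a blk1 * dotv y1 (k blk1) by rewrite {1}(xk blk1) dotvZr.
  have y2k : dotv y2 (x blk2) = a blk2 * dotv y2 (k blk2) by rewrite {1}(xk blk2) dotvZr.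
  rewrite (dotvC (x blk1) y1) (dotvC (x blk2) y2) y1k y2k.
  have := dotv_unit_le y1 (kk blk1); have := dotv_unit_le y2 (kk blk2).
  have := quad (dotv y1 (k blk1)) (dotv y2 (k blk2)).
  move: (dotv y1 (k blk1)) (dotv y2 (k blk2)) (dotv y1 y1) (dotv y2 y2)
    => t1 t2 q1 q2 Q2 h2 h1.
  rewrite [leLHS](_ : _ = D blk1 ^+ 2 * t1 ^+ 2 + 2 * r * D blk1 * D blk2 * t1 * t2
     + D blk2 ^+ 2 * t2 ^+ 2 + v * (q1 + q2)); last first.
    have -> : 2 * r * D blk1 * D blk2 = 2 * (sm * a blk1 * a blk2) by rewrite smD; ring.
    by rewrite !DB; ring.
  rewrite Q2 /lamd -subr_ge0.
  (* On the parts of [y1] and [y2] orthogonal to the block directions the form is only [v], while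
     the bound allows [Lam2 + v]; the slack is [Lam2] times their squared lengths. *)
  rewrite (_ : _ - _ = Lam2 * ((q1 - t1 ^+ 2) + (q2 - t2 ^+ 2))); last by ring.
  by rewrite mulr_ge0// addr_ge0// subr_ge0.
have akd : 0 < dotv (row_mx (mu *: x blk1) (mu *: x blk2)) kd.
  rewrite dkd !dotvZl !dxk.
  have [k10|k10] := eqVneq k1 0; last first.
    by rewrite ltr_pwDl ?mulr_ge0 ?(ltW mu0) ?(ltW (a0 _))// !mulr_gt0// lt0r k10.
  have k2_gt0 : 0 < k2.
    rewrite lt0r k2p andbT; apply/negP => /eqP k20.
    by move: k12; rewrite k10 k20 !expr0n addr0 => /eqP; rewrite eq_sym oner_eq0.
  by rewrite k10 mul0r add0r !mulr_gt0.
have nn0 : (0 < n + n)%N by rewrite addn_gt0 n0.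
have ctd := topval_cvg nn0 hRpca cGd kkd kGd lamd0 gapd gapGd.
have cdd := pca_dotv_cvg nn0 hRpca cGd cad kkd kGd lamd0 gapd gapGd akd.
pose cg := g * (k1 * D blk1 + k2 * D blk2) / L.
have chq' : (fun p => dotv (hR p) (qvec p)) @ \oo --> cg.
  have -> : cg = dotv (row_mx (mu *: x blk1) (mu *: x blk2)) kd / L.
    rewrite dkd !dotvZl !dxk /cg /g /D.
    by field; rewrite !gt_eqF.
  exact: cdd.
pose hb := (k1 * r * D blk1 + k2 * D blk2) / L.
have chb' : (fun p => dotv (hR p) (bb p)) @ \oo --> hb.
  have -> : hb = dotv (row_mx ((second_moment blk2 blk1 / Num.sqrt B) *: x blk1)
      ((second_moment blk2 blk2 / Num.sqrt B) *: x blk2)) kd / L.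
    rewrite dkd !dotvZl !dxk /hb sm21 -/B /D.
    have [sB0 BB] := (sB, esym (sqr_sqrtr (ltW B_gt0))).
    move: (Num.sqrt B) sB0 BB => sb sb0 ->.
    by field; rewrite !gt_eqF.
  apply: cdd; apply: row_cvg => // j; rewrite scalemxE; exact: bscore_cvg.
pose nu := ((n + n)%:R - 1)^-1 : R.
have nn1 : 1 <= (n + n)%:R - 1 :> R.
  rewrite lerBrDr (_ : 1 + 1 = 2%:R)// ler_nat; apply: leq_trans hn _; exact: leq_addr.
have nn10 : (n + n)%:R - 1 != 0 :> R by rewrite gt_eqF// (lt_le_trans ltr01).
have nup : 0 <= nu by rewrite invr_ge0 (le_trans ler01).
have nu1 : nu <= 1 by rewrite invf_le1// (lt_le_trans ltr01).
pose Psi := (Lam - nu * Lam2) / L ^+ 2.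
(* The [2 n - 1] lower eigenvalues sum to [Lam2 + (2 n - 1) v], whence the bias [nu * Lam2]. *)
have PsiE : Psi = (lamd - (\tr Gd - lamd) / ((n + n)%:R - 1)) / lamd.
  rewrite /Psi L2 -/lamd mxtrace_block !trG; congr (_ / _).
  have -> : D blk1 ^+ 2 + n%:R * v + (D blk2 ^+ 2 + n%:R * v) - lamd =
     Lam2 + ((n + n)%:R - 1) * v by rewrite /lamd /Lam2 natrD; ring.
  rewrite /nu /lamd; move: ((n + n)%:R - 1) nn10 => N0 hN0.
  by field.
have Psi0 : 0 <= Psi.
  rewrite divr_ge0 ?sqr_ge0// subr_ge0 (le_trans _ (ltW LamLt))//.
  by rewrite ler_piMl.
have cpsi' : (fun p => psi (Yd p) ^+ 2) @ \oo --> Psi.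
  rewrite PsiE; apply: (psi_cvg _ cGd ctd lamd0); last by rewrite -PsiE.
  by apply: leq_trans hn _; exact: leq_addr.
have e1' := e1; have e2' := e2; rewrite rE in e1' e2'.
have Psi1 : Psi < 1 := double_Psi_lt1 v0 Lp L2 Lam2p nup.
have Q0 := @double_Q_gt0 _ _ _ _ _ _ _ _ _ _ _ nu s01 rho1 (D0 blk1) (D0 blk2) v0
  k1p k2p k12 g0 g2s Lp L2 e1' e2'.
have := gps_cvg hRpca near_bb chq' chb' qb_cvg cpsi' Psi1 Q0.
set tau := (Psi - cg ^+ 2) / (1 - Psi).
set Q := tau ^+ 2 + 2 * tau * cg ^+ 2 + cg ^+ 2.
move=> H; exists ((tau * hb + cg * g) / Num.sqrt Q); first exact: H.
have {}Q0 : 0 < Q by exact: Q0.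
have sQ : 0 < Num.sqrt Q by rewrite sqrtr_gt0.
have K0 : 0 <= gps_cos2 (f blk2 ^+ 2) GL.
  have f201 : 0 < f blk2 ^+ 2 < 1 by rewrite f2lt1 exprn_gt0.
  have t0 := gps_tau_ge0 f201 GL_le1.
  by case/andP: GL0 => /ltW G0 _; apply: divr_ge0; apply: addr_ge0 => //; exact: ler01.
have cosQ : cosf GL * Num.sqrt Q = Num.sqrt (gps_cos2 (f blk2 ^+ 2) GL * Q).
  by rewrite /cosf -sqrtrM.
split.
  rewrite ler_pdivrMr// cosQ (le_trans (ler_norm _))// -sqrtr_sqr ler_wsqrtr//.
  have := @double_le _ _ _ _ _ _ _ _ _ _ _ nu s01 rho1 (D0 blk1) (D0 blk2) v0
    k12 g2s Lp L2 e1' e2'.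
  by rewrite -rE -!f2.
move=> cn0 clt.
have rho0 : rho != 0 by rewrite mulf_neq0// invr_eq0 gt_eqF.
have rholt : rho ^+ 2 < 1 by rewrite /rho expr_div_n ltr_pdivrMr ?exprn_gt0// mul1r.
have := double_lt s01 rho1 (D0 blk1) (D0 blk2) v0 k1p k2p k12 g0 g2s Lp L2
  e1' e2' Lam2p Lamp nup rho0 rholt.
rewrite -rE -!f2 => lt2.
rewrite ltr_pdivrMr// cosQ (le_lt_trans (ler_norm _))// -sqrtr_sqr ltr_sqrt//.
by apply: le_lt_trans lt2; exact: sqr_ge0.
Qed.

Let f201 : 0 < f blk2 ^+ 2 < 1.
Proof. by rewrite f2lt1 exprn_gt0. Qed.

Let cosf_le1 G' : G' <= 1 -> cosf G' <= 1.
Proof. by move=> G1; rewrite -sqrtr1 ler_wsqrtr// gps_cos2_le1. Qed.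

Let err_le N : N <= cosf GL ->
  Num.sqrt (2 - 2 * cosf GL) - Num.sqrt (2 - 2 * N) <= 0.
Proof.
by move=> NG; rewrite subr_le0 ler_wsqrtr// lerD2l lerN2 ler_pM2l.
Qed.

Let err_lt N : N < cosf GL ->
  Num.sqrt (2 - 2 * cosf GL) - Num.sqrt (2 - 2 * N) < 0.
Proof.
move=> NG; have N1 := lt_le_trans NG (cosf_le1 GL_le1).
rewrite subr_lt0 ltr_sqrt; first by rewrite ltrD2l ltrN2 ltr_pM2l.
by rewrite subr_gt0 -[ltRHS]mulr1 ltr_pM2l.
Qed.

(** Both cosines are values of the increasing function [gps_cos2]: at [g ^+ 2] for the anchor [q],
    at [GL] for the anchors [q] and [h_1]. The two arguments differ when [c] is nonzero. *)
Lemma gap_single_lim :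
  (cvgn (gap_single beta X Z w h) /\ limn (gap_single beta X Z w h) <= 0) /\
  (c != 0 -> limn (gap_single beta X Z w h) < 0).
Proof.
have cg : gap_single beta X Z w h @ \oo -->
    Num.sqrt (2 - 2 * cosf GL) - Num.sqrt (2 - 2 * cosf (g ^+ 2)).
  by apply: cvgB; [exact: err_maps_cvg|exact: err_single_cvg].
rewrite (cvg_lim (@Rhausdorff R) cg); split; first split.
- exact: cg.
- by apply: err_le; rewrite ler_wsqrtr// gps_cos2_le ?GL_le1 ?GL_ge.
- move=> cn0; apply: err_lt; rewrite ltr_sqrt.
    by rewrite gps_cos2_lt ?GL_le1 ?GL_gt.
  apply: (@le_lt_trans _ _ (gps_cos2 (f blk2 ^+ 2) (g ^+ 2))); last first.
    by rewrite gps_cos2_lt ?GL_le1 ?GL_gt.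
  by apply: divr_ge0; apply: addr_ge0; rewrite ?ler01 ?sqr_ge0 ?gps_tau_ge0//.
Qed.

Lemma gap_double_lim :
  (cvgn (gap_double beta X Z w h hR) /\ limn (gap_double beta X Z w h hR) <= 0) /\
  (c != 0 -> c ^+ 2 < (dd ^+ 2) ^+ 2 -> limn (gap_double beta X Z w h hR) < 0).
Proof.
have [N cN [N1 N2]] := err_double_cvg.
have cg : gap_double beta X Z w h hR @ \oo -->
    Num.sqrt (2 - 2 * cosf GL) - Num.sqrt (2 - 2 * N).
  by apply: cvgB; [exact: err_maps_cvg|exact: cN].
rewrite (cvg_lim (@Rhausdorff R) cg); split; first split.
- exact: cg.
- exact: err_le.
- by move=> cn0 clt; apply: err_lt; exact: N2.
Qed.

End model_lim.

(** * From fixed outcomes to almost sure statements *)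

Section almost_sure.
Context (R : realType) (d : measure_display) (T : measurableType d)
  (P : probability T R) (n : nat).
Variables (hn : (2 <= n)%N) (sigma delta : R) (hdelta : 0 < delta).
Variables (beta : 'I_2 -> nat -> {RV P >-> R}) (X : 'I_2 -> 'I_n -> {RV P >-> R})
  (Z : nat -> 'I_2 -> 'I_n -> {RV P >-> R}).
Hypotheses (A1 : assumption1 beta) (A2 : assumption2 beta X Z)
  (A3 : assumption3 X sigma) (A4 : assumption4 Z delta) (A5 : assumption5 beta).

(** The exceptional set depends on [beta], [X] and [Z] alone: the strong laws are indexed by finite
    types, so their null sets can be united, and the choice of [h] and [hR] comes after the
    outcome. *)
Lemma ae_gaps : {ae P, forall w, forall h hR, pca_choice beta X Z w h hR ->
  let strict := 0 < `|limn (rho_ (beta_path beta blk1 w) (beta_path beta blk2 w))| < 1 in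
  ((cvgn (gap_single beta X Z w h) /\ limn (gap_single beta X Z w h) <= 0) /\
   (strict -> limn (gap_single beta X Z w h) < 0)) /\
  (~ double_degenerate beta X w ->
   (cvgn (gap_double beta X Z w h hR) /\ limn (gap_double beta X Z w h hR) <= 0) /\
   (strict -> limn (gap_double beta X Z w h hR) < 0))}.
Proof.
have aeZZ : {ae P, forall w, forall k k' : 'I_2 * 'I_n,
    (fun p : nat => p%:R^-1 * \sum_(0 <= i < p) (Z i k.1 k.2 w * Z i k'.1 k'.2 w))
     @ \oo --> (if k == k' then delta ^+ 2 else 0 : R)}.
  apply: filter_forall => k; apply: filter_forall => k'.
  exact: (ae_mean_ZZ A4).
have aeZ : {ae P, forall w, forall k : 'I_2 * 'I_n,
    (fun p : nat => p%:R^-1 * \sum_(0 <= i < p) Z i k.1 k.2 w) @ \oo --> (0 : R)}.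
  by apply: filter_forall => k; exact: (ae_mean_Z A4).
have aebZ : {ae P, forall w, forall t (k : 'I_2 * 'I_n),
    (fun p : nat => p%:R^-1 * \sum_(0 <= i < p) (beta t i w * Z i k.1 k.2 w))
     @ \oo --> (0 : R)}.
  apply: filter_forall => t; apply: filter_forall => k.
  exact: (ae_mean_betaZ A1 A2 A4).
case: A1 => _ _ ae1; case: A3 => _ _ _ _ ae3.
near=> w => h hR hp strict.
have cZZ : forall k k' : 'I_2 * 'I_n,
    (fun p : nat => p%:R^-1 * \sum_(0 <= i < p) (Z i k.1 k.2 w * Z i k'.1 k'.2 w))
     @ \oo --> (if k == k' then delta ^+ 2 else 0 : R) by near: w.
have cZ : forall k : 'I_2 * 'I_n,
    (fun p : nat => p%:R^-1 * \sum_(0 <= i < p) Z i k.1 k.2 w) @ \oo --> (0 : R).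
  by near: w.
have cbZ : forall t (k : 'I_2 * 'I_n),
    (fun p : nat => p%:R^-1 * \sum_(0 <= i < p) (beta t i w * Z i k.1 k.2 w))
     @ \oo --> (0 : R) by near: w.
have X0 : forall t, Xvec X t w != 0 by near: w.
have h1 : forall t,
  [/\ cvgn (mu_ (beta_path beta t w)), 0 < limn (mu_ (beta_path beta t w)),
    cvgn (d_ (beta_path beta t w)) & 0 < limn (d_ (beta_path beta t w))] by near: w.
have [bpos mu12 d12 cc] : [/\ forall p, (0 < p)%N ->
    0 < dotv (trunc p (beta_path beta blk1 w)) (trunc p (beta_path beta blk2 w)),
    limn (mu_ (beta_path beta blk1 w)) = limn (mu_ (beta_path beta blk2 w)),
    limn (d_ (beta_path beta blk1 w)) = limn (d_ (beta_path beta blk2 w)) &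
    cvgn (dcov (beta_path beta blk1 w) (beta_path beta blk2 w))] by near: w.
set mu := limn (mu_ (beta_path beta blk1 w)) in mu12.
set dd := limn (d_ (beta_path beta blk1 w)) in d12.
have blkP t : t = blk1 \/ t = blk2.
  by case: t => [[|[|//]] ht]; [left|right]; exact/val_inj.
have cmu t : mu_ (beta_path beta t w) @ \oo --> mu.
  have [c1 _ _ _] := h1 t.
  by move: c1; case: (blkP t) => -> // c1; rewrite mu12.
have cd t : d_ (beta_path beta t w) @ \oo --> dd.
  have [_ _ c1 _] := h1 t.
  by move: c1; case: (blkP t) => -> // c1; rewrite d12.
have [_ mu0 _ dd0] := h1 blk1; rewrite -/mu -/dd in mu0 dd0.
have hpca t p : (0 < p)%N -> is_pca (Rblk beta X Z t w p) (h t p) by case/hp.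
have hRpca p : (0 < p)%N -> is_pca (Rfull beta X Z w p) (hR p) by case/hp.
set c := limn (dcov _ _) in cc.
have dd2 : 0 < dd * dd by rewrite mulr_gt0.
have rhoE : limn (rho_ (beta_path beta blk1 w) (beta_path beta blk2 w)) = c / (dd * dd).
  apply/cvg_lim => //; apply: cvgM => //; apply: cvgV; first by rewrite gt_eqF.
  by apply: cvgM; exact: cd.
have strictE : strict -> c != 0 /\ c ^+ 2 < (dd ^+ 2) ^+ 2.
  rewrite /strict rhoE normrM normfV (gtr0_norm dd2) => /andP[n0 n1].
  split.
    by apply/negP => /eqP c0; move: n0; rewrite c0 normr0 mul0r ltxx.
  move: n1; rewrite ltr_pdivrMr// mul1r -expr2 => n1.
  by rewrite -(real_normK (num_real c)) ltr_pXn2r ?nnegrE ?sqr_ge0.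
split; last move=> ndeg.
- have [H1 H2] := gap_single_lim cmu cd cc mu0 dd0 cZZ cZ cbZ hdelta hpca X0 hn.
  by split=> // /strictE[c0 _]; exact: H2.
- have [H1 H2] := gap_double_lim cmu cd cc mu0 dd0 cZZ cZ cbZ hdelta hpca X0 hn
    bpos hRpca ndeg.
  by split=> // /strictE[c0 c1]; exact: H2.
Unshelve. all: by end_near.
Qed.

End almost_sure.

Theorem theorem2p4 (R : realType) (d : measure_display) (T : measurableType d)
    (P : probability T R) (n : nat) (hn : (2 <= n)%N)
    (sigma delta : R) (hsigma : 0 < sigma) (hdelta : 0 < delta)
    (beta : 'I_2 -> nat -> {RV P >-> R})
    (X : 'I_2 -> 'I_n -> {RV P >-> R})
    (Z : nat -> 'I_2 -> 'I_n -> {RV P >-> R})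
    (A1 : assumption1 beta)
    (A2 : assumption2 beta X Z)
    (A3 : assumption3 X sigma)
    (A4 : assumption4 Z delta)
    (A5 : assumption5 beta) :
  {ae P, forall w, forall h hR, pca_choice beta X Z w h hR ->
    (cvgn (gap_single beta X Z w h) /\
     limn (gap_single beta X Z w h) <= 0) /\
    (~ double_degenerate beta X w ->
     cvgn (gap_double beta X Z w h hR) /\
     limn (gap_double beta X Z w h hR) <= 0)}
  /\
  ({ae P, forall w,
     0 < `|limn (rho_ (beta_path beta blk1 w) (beta_path beta blk2 w))| < 1} ->
   {ae P, forall w, forall h hR, pca_choice beta X Z w h hR ->
    (cvgn (gap_single beta X Z w h) /\
     limn (gap_single beta X Z w h) < 0) /\
    (~ double_degenerate beta X w ->
     cvgn (gap_double beta X Z w h hR) /\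
     limn (gap_double beta X Z w h hR) < 0)}).
Proof.
have ae := ae_gaps hn hdelta A1 A2 A3 A4 A5; split.
  apply: filterS ae => w H h hR hp; have [[H1 _] H2] := H h hR hp.
  by split; [exact: H1|move=> ndeg; have [H3 _] := H2 ndeg; exact: H3].
move=> aerho; apply: (filterS _ (filterI ae aerho)) => w [H rho01] h hR hp.
have [[[H1 _] H2] H3] := H h hR hp.
split; first by split; [exact: H1|apply: H2; exact: rho01].
move=> ndeg; have [[H4 _] H5] := H3 ndeg.
by split; [exact: H4|apply: H5; exact: rho01].
Qed.
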